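(* Under the standing assumptions in the context, assume that $d_0=d_1=:d$, that $\omega_1$ is convex, and that $c(x,\xi)=h(\xi-x)$ with a convex function $h:\mathbb R^d\to\mathbb R$ that is strongly convex on bounded sets: for all $R>0$ there is $\beta_R>0$ such that $$\langle x^*-\xi^*,x-\xi\rangle\ge\beta_R\|x-\xi\|^2\qquad\forall (x,x^* ),(\xi,\xi^* )\in\operatorname{graph}(\partial h)\text{ with }x,\xi\in B_R(0).$$ Let $\varrho>0$ be such that $\omega_1-\omega_0\subset B_\varrho(0)$ and set $\beta:=\beta_\varrho$. Let $\bar u$ be a locally optimal control of (P) with state $\bar y=S\bar u$ and adjoint state $p$. Assume that $p$ is continuously differentiable in $\omega_1$ and that there is a constant $\kappa<\alpha\beta$ with $$\langle\nabla p(\xi)-\nabla p(\zeta),\xi-\zeta\rangle\ge-\kappa\|\xi-\zeta\|^2\qquad\forall\,\xi,\zeta\in\omega_1 .$$ Then the optimal transport from $u^0$ to $\bar u$ is given by a unique optimal transport plan (i.e. $\mathcal K_c(u^0,\bar u)$ is a singleton), which is induced by a transport map $T:\omega_0\to\omega_1$, i.e., it equals $(\mathrm{id},T)_\#u^0$, such that $T_\#u^0=\bar u$. Moreover, $T$ is Hölder continuous with exponent $1/2$. If $h$ is continuously differentiable with Lipschitz continuous gradient in $\omega_1-\omega_0$, then $T$ is Lipschitz continuous.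
   Context: For a compact set $X\subset\mathbb R^n$, $\mathfrak M(X)=C(X)^*$ denotes the finite signed Borel measures on $X$ with the total variation norm. $r'$ denotes the conjugate exponent of $r$. $\partial h$ is the convex subdifferential; $B_R(0)$ is the open ball; $\omega_1-\omega_0=\{\xi-x:\xi\in\omega_1,x\in\omega_0\}$. ''$p$ is continuously differentiable in $\omega_1$'' means that $p|_{\omega_1}$ coincides with a $C^1$ function on an open neighborhood of $\omega_1$, whose gradient is denoted $\nabla p$. Standing assumptions. $d_0\in\mathbb N$, $d_1\in\{2,3\}$; $\Omega\subset\mathbb R^{d_1}$ is a bounded Lipschitz domain; $\omega_0\subset\mathbb R^{d_0}$ and $\omega_1\subset\overline\Omega$ are nonempty compact sets; $u^0\in\mathfrak M(\omega_0)$, $u^0\ge 0$; $c\in C(\omega_0\times\omega_1)$; $\alpha>0$. $p_\Omega>d_1$ is an exponent (provided by Theorem 0.5(a) of Jerison–Kenig 1995) such that for every $p\in(p_\Omega',p_\Omega)$ and every $f\in W^{-1,p}(\Omega)$ the equation $-\Delta y=f$ (weak Laplacian, $-\langle\Delta y,v\rangle=\int_\Omega\nabla y\cdot\nabla v\,d\lambda^{d_1}$) has a unique solution $y\in W^{1,p}_0(\Omega)$. The exponent $q$ is fixed with $q'\in(d_1,p_\Omega)$ and, if $d_1=3$, additionally $q'<6$. $J:W^{1,q}_0(\Omega)\to\mathbb R$ is continuous and Gâteaux differentiable. $E:W^{1,q'}_0(\Omega)\to C(\omega_1)$ is the Sobolev embedding into $C_0(\Omega)\subset C(\overline\Omega)$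 followed by restriction to $\omega_1$; $\langle E^*u,v\rangle=\int_{\omega_1}v\,du$. $S:=(-\Delta)^{-1}E^*:\mathfrak M(\omega_1)\to W^{1,q}_0(\Omega)$. $\mathrm D^c_{u^0}(u):=\inf\{\int c\,d\pi:\pi\in\mathfrak M(\omega_0\times\omega_1),\ \pi\ge0,\ (P_0)_\#\pi=u^0,\ (P_1)_\#\pi=u\}$ with coordinate projections $P_0,P_1$ and $\inf\emptyset=\infty$; $\mathcal K_c(u^0,u)$ is the set of minimizers $\pi$ (optimal transport plans). Problem (P): minimize $f(u)=J(Su)+\alpha\,\mathrm D^c_{u^0}(u)$ over $u\in\mathfrak M(\omega_1)$. $\bar u$ is locally optimal if $f(\bar u)<\infty$ and $f(\bar u)\le f(u)$ for all $u$ in some norm neighborhood of $\bar u$. The adjoint state associated with $\bar u$ is the unique $p\in W^{1,q'}_0(\Omega)\hookrightarrow C(\overline\Omega)$ with $-\Delta p=J'(S\bar u)$ in $W^{-1,q'}(\Omega)$. *)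

(* Defs.v *)
From HB Require Import structures.
From mathcomp Require Import all_boot all_order all_algebra.
From mathcomp Require Import all_classical all_reals all_analysis.
From mathcomp Require Import ring lra.
Set Implicit Arguments.
Unset Strict Implicit.
Unset Printing Implicit Defensive.
Import Order.TTheory GRing.Theory Num.Theory.
Import numFieldNormedType.Exports.
Local Open Scope classical_set_scope.
Local Open Scope ring_scope.

(* 'rV[R]_n carries the sup norm, hence the Euclidean topology; this is its
   Borel sigma-algebra. *)
Section borel.
Context (R : realType) (n : nat).
HB.instance Definition _ := @isMeasurable.Build
  (sigma_display (@open 'rV[R]_n)) 'rV[R]_n <<s @open 'rV[R]_n >>
  (@sigma_algebra0 _ setT _) (@sigma_algebraC _ _)
  (@sigma_algebra_bigcup _ setT _).
End borel.

Section lebesgue.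
Context {R : realType}.

Definition rv_cons n (x : measurableTypeR R * 'rV[R]_n) : 'rV[R]_n.+1 :=
  row_mx (const_mx x.1 : 'rV_1) x.2.

(* Lebesgue measure on R^n as an iterated product of the one on R. *)
Fixpoint leb n : set 'rV[R]_n -> \bar R :=
  if n is m.+1 then pushforward (lebesgue_measure \x @leb m)%E (@rv_cons m)
  else \d_(0 : 'rV[R]_0).

Lemma open_measurable_rV n (A : set 'rV[R]_n) : open A -> measurable A.
Proof. exact: sub_sigma_algebra. Qed.

Lemma rv_cons0 n (x : measurableTypeR R * 'rV[R]_n) : rv_cons x 0 ord0 = x.1.
Proof.
have := row_mxEl (const_mx x.1 : 'rV_1) x.2 0 0; rewrite [RHS]mxE => <-.
by rewrite /rv_cons; congr (_ 0 _); exact: val_inj.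
Qed.

Lemma rv_consS n (x : measurableTypeR R * 'rV[R]_n) (j : 'I_n) :
  rv_cons x 0 (lift ord0 j) = x.2 0 j.
Proof.
rewrite -(row_mxEr (const_mx x.1 : 'rV_1) x.2).
by rewrite /rv_cons; congr (_ _ _); exact: val_inj.
Qed.

Lemma ball_rV n (c : 'rV[R]_n) (r : R) x : 0 < r ->
  ball c r x <-> forall j, ball (c 0 j) r (x 0 j).
Proof.
move=> r0; split=> [[_ h] j|h]; first exact: h.
by split=> // i j; rewrite ord1; exact: h.
Qed.

Lemma rv_cons_ball n (c : 'rV[R]_n.+1) (r : R) : 0 < r ->
  @rv_cons n @^-1` ball c r =
  ball (c 0 ord0) r `*` ball (\row_j c 0 (lift ord0 j)) r.
Proof.
move=> r0; apply/seteqP; split=> x /=.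
- move=> /(ball_rV _ _ r0) h; split; first by rewrite -rv_cons0; exact: h.
  by apply/ball_rV => // j; rewrite mxE -rv_consS; exact: h.
- move=> [h0 /(ball_rV _ _ r0) h]; apply/ball_rV => // j.
  case: (unliftP ord0 j) => [k|] ->; last by rewrite rv_cons0.
  by have := h k; rewrite mxE rv_consS.
Qed.

Lemma measurable_rv_cons_ball n (c : 'rV[R]_n.+1) (r : R) :
  measurable (@rv_cons n @^-1` ball c r).
Proof.
have [r0|r0] := ltP 0 r.
  rewrite rv_cons_ball//; apply: measurableX; first by apply: measurable_realfun.open_measurable; exact: ball_open.
  by apply: open_measurable_rV; exact: ball_open.
rewrite (_ : ball c r = set0) ?preimage_set0//.
by apply/seteqP; split=> // x []; rewrite ltNge r0.
Qed.

Lemma measurable_rv_cons n : measurable_fun setT (@rv_cons n).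
Proof.
apply: (measurability (@open 'rV[R]_n.+1)) => // _ [U oU <-].
rewrite setTI.
pose q (x : 'rV[rat]_n.+1 * rat) := ball (map_mx ratr x.1 : 'rV[R]_n.+1) (ratr x.2).
have -> : U = \bigcup_x (if `[< q x `<=` U >] then q x else set0).
  apply/seteqP; split=> [x Ux|x [y _]]; last by case: asboolP => // h /h.
  have /nbhs_ballP[e /= e0 xe] := open_nbhs_nbhs (conj oU Ux).
  have [r] := @rat_in_itvoo R 0 (e / 2) (divr_gt0 e0 (ltr0Sn _ _)).
  rewrite in_itv/= => /andP[r0 re].
  have /choice[c ch] (j : 'I_n.+1) : exists c : rat, ball (ratr c : R) (ratr r) (x 0 j).
    have [c] := @rat_in_itvoo R (x 0 j - ratr r) (x 0 j + ratr r) ltac:(lra).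
    rewrite in_itv/= => hc; exists c; rewrite /ball/= ltr_norml; lra.
  have xc : ball (map_mx ratr (\row_j c j) : 'rV[R]_n.+1) (ratr r) x.
    by apply/ball_rV => // j; rewrite !mxE.
  exists (\row_j c j, r) => //; case: asboolP => //=; case.
  move=> y yc; apply: xe; rewrite [e]splitr.
  apply: ball_triangle.
    by apply: (le_ball (ltW re)); apply: ball_sym; exact: xc.
  by apply: (le_ball (ltW re)); exact: yc.
rewrite preimage_bigcup; apply: countable_bigcupT_measurable.
  exact: countableP.
move=> x; case: asboolP => _; last by rewrite preimage_set0.
exact: measurable_rv_cons_ball.
Qed.

(* Packages [mu] with the given facts, to feed [leb n] to the product measure
   theory before its own instance exists. *)
Section mk_sfm.
Context n (mu : set 'rV[R]_n -> \bar R).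
Hypotheses (mu0 : mu set0 = 0%E) (mu_ge0 : forall A, (0 <= mu A)%E)
  (mu_sigma : semi_sigma_additive mu)
  (mu_ball : forall r, (mu (ball (0%R : 'rV[R]_n) r) < +oo)%E).

Definition mk_sfm_of of mu set0 = 0%E & (forall A, 0 <= mu A)%E &
  semi_sigma_additive mu & (forall r, mu (ball (0%R : 'rV[R]_n) r) < +oo)%E :=
  mu.
Let mk_sfm := mk_sfm_of mu0 mu_ge0 mu_sigma mu_ball.

HB.instance Definition _ :=
  isMeasure.Build _ _ _
  (mk_sfm_of mu0 mu_ge0 mu_sigma mu_ball) mu0 mu_ge0 mu_sigma.

Lemma mk_sfm_sigma_finite : sigma_finite setT mk_sfm.
Proof.
exists (fun k : nat => ball (0 : 'rV[R]_n) k.+1%:R).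
  apply/seteqP; split=> // x _.
  exists (Num.truncn `|x|) => //; rewrite -ball_normE /= sub0r normrN.
  exact: truncnS_gt.
by move=> k; split; [apply: open_measurable_rV; exact: ball_open|exact: mu_ball].
Qed.

HB.instance Definition _ :=
  Measure_isSigmaFinite.Build _ _ _
  (mk_sfm_of mu0 mu_ge0 mu_sigma mu_ball) mk_sfm_sigma_finite.
End mk_sfm.

Lemma leb_spec n : [/\ @leb n set0 = 0%E, forall A, (0 <= @leb n A)%E,
  semi_sigma_additive (@leb n) & forall r, (leb (ball (0%R : 'rV[R]_n) r) < +oo)%E].
Proof.
elim: n => [|n [h0 h1 h2 h3]].
  split => //; first exact: measure_semi_sigma_additive.
  by move=> r; rewrite /= diracE ltry.
pose m : {sigma_finite_measure set 'rV[R]_n -> \bar R} :=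
  mk_sfm_of h0 h1 h2 h3.
pose p : {measure set (measurableTypeR R * 'rV[R]_n) -> \bar R} := (lebesgue_measure \x m)%E.
have lebE : @leb n.+1 = pushforward p (@rv_cons n) by [].
have mf := @measurable_rv_cons n.
rewrite lebE; split => [|A||r].
- by rewrite /pushforward preimage_set0 measure0.
- exact: measure_ge0.
- move=> F mF tF mUF; rewrite /pushforward preimage_bigcup.
  apply: measure_semi_sigma_additive.
  + by move=> k; rewrite -[X in measurable X]setTI; exact: mf.
  + by apply/trivIsetP => i j _ _ ij; rewrite -preimage_setI;
      move/trivIsetP : tF => /(_ _ _ _ _ ij) ->//; rewrite preimage_set0.
  + by rewrite -preimage_bigcup -[X in measurable X]setTI; exact: mf.
- rewrite /pushforward; have [r0|r0] := ltP 0 r; last first.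
    rewrite (_ : ball _ _ = set0) ?preimage_set0 ?measure0//.
    by apply/seteqP; split=> // x []; rewrite ltNge r0.
  rewrite rv_cons_ball// [X in (X < _)%E](product_measure1E lebesgue_measure m).
  + have bE := @lebesgue_measure_ball R ((0 : 'rV[R]_n.+1) 0 ord0) r (ltW r0).
    have -> : \row_j (0 : 'rV[R]_n.+1) 0 (lift ord0 j) = 0.
      by apply/rowP => j; rewrite !mxE.
    apply: lte_mul_pinfty; [exact: measure_ge0| |exact: h3].
    exact: (eq_ind_r (fun x => x \is a fin_num) _ bE).
  + by apply: measurable_realfun.open_measurable; exact: ball_open.
  + by apply: open_measurable_rV; exact: ball_open.
Qed.

Let leb0 n : @leb n set0 = 0%E. Proof. by case: (leb_spec n). Qed.
Let leb_ge0 n A : (0 <= @leb n A)%E. Proof. by case: (leb_spec n). Qed.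
Let leb_sigma n : semi_sigma_additive (@leb n).
Proof. by case: (leb_spec n). Qed.

HB.instance Definition _ n :=
  isMeasure.Build _ _ _ (@leb n) (leb0 n) (@leb_ge0 n) (@leb_sigma n).

Let leb_sigma_finite n : sigma_finite setT (@leb n).
Proof. by case: (leb_spec n) => *; exact: mk_sfm_sigma_finite. Qed.

HB.instance Definition _ n :=
  Measure_isSigmaFinite.Build _ _ _ (@leb n) (@leb_sigma_finite n).
End lebesgue.
Arguments leb {R n} _.

Section euclidean.
Context {R : realType} {d : nat}.
Local Notation V := 'rV[R]_d.
Implicit Types (x y : V) (f h : V -> R) (Omega omega : set V).

(* The library norm on 'rV is the sup norm, so the Euclidean one is explicit. *)
Definition dot x y : R := \sum_(i < d) x 0 i * y 0 i.
Definition enorm x : R := Num.sqrt (dot x x).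
Definition eball (r : R) : set V := [set x | enorm x < r].

Definition subdiff h x : set V :=
  [set g | forall y, h x + dot g (y - x) <= h y].

Definition set_diff (A B : set V) : set V := [set xi - x | xi in A & x in B].

Definition partial (i : 'I_d) f x : R := 'D_(delta_mx 0 i) (f : V -> R^o) x.
Definition gradient f x : V := \row_i partial i f x.

(* [f] coincides on [omega] with [g], which is C^1 on an open neighborhood;
   the gradient of [f] on [omega] is then [gradient g]. *)
Definition C1_extension omega f (g : V -> R) : Prop := exists U : set V,
  [/\ open U, omega `<=` U,
      forall x, U x -> differentiable (g : V -> R^o) x /\
                       {for x, continuous (gradient g)}
    & forall x, omega x -> f x = g x].

Fixpoint Ck (k : nat) f : Prop :=
  if k is k'.+1 then
    [/\ continuous f,
        forall x i, derivable (f : V -> R^o) x (delta_mx 0 i)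
      & forall i, Ck k' (partial i f)]
  else continuous f.

Definition test_function Omega f : Prop :=
  (forall k, Ck k f) /\
  exists K : set V, [/\ compact K, K `<=` Omega & forall x, ~ K x -> f x = 0].

(* Near each boundary point, in the orthonormal coordinates given by the
   vertical direction [e] and the hyperplane orthogonal to it, [Omega] is the
   region above the graph of a Lipschitz function. *)
Definition lipschitz_domain Omega : Prop :=
  [/\ open Omega, connected Omega, Omega !=set0, bounded_set Omega &
  forall x0, (closure Omega `\` Omega) x0 ->
  exists (r : R) (e : V) (gamma : V -> R) (L : R),
  [/\ 0 < r, enorm e = 1,
      forall x y, `|gamma x - gamma y| <= L * enorm (x - y)
    & forall x, enorm (x - x0) < r ->
        Omega x <-> gamma (x - dot x e *: e) < dot x e]].

End euclidean.

(* An element of W^{1,r}(Omega) is represented by a pair: a function and its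
   weak gradient; pairs at [sobolev_norm] distance 0 are the same element. *)
Notation sobolev R d := (('rV[R]_d -> R^o) * ('rV[R]_d -> 'rV[R]_d))%type.

Section sobolev.
Context {R : realType} {d : nat}.
Local Notation V := 'rV[R]_d.
Local Notation W := (sobolev R d).
Variable Omega : set V.
Implicit Types (r : \bar R) (y z v : W) (F : W -> R) (J : W -> R).

Definition weak_gradient y : Prop := forall (phi : V -> R) (i : 'I_d),
  test_function Omega phi ->
  \int[leb]_(x in Omega) (y.1 x * partial i phi x) =
  - \int[leb]_(x in Omega) (y.2 x 0 i * phi x).

Definition W1 r y : Prop :=
  [/\ (patch (fun=> 0) Omega y.1 : V -> R) \in Lfun leb r,
      forall i, (patch (fun=> 0) Omega (fun x => y.2 x 0 i) : V -> R) \in Lfun leb r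
    & weak_gradient y].

Definition sobolev_norm r y : \bar R :=
  ('N[leb]_r [EFin \o (patch (fun=> 0%R) Omega y.1 : V -> R)] +
   \sum_(i < d) 'N[leb]_r [EFin \o
    (patch (fun=> 0%R) Omega (fun x => y.2 x 0%R i) : V -> R)])%E.

Definition W10 r y : Prop := W1 r y /\ forall e : R, 0 < e ->
  exists phi : V -> R, test_function Omega phi /\
    (sobolev_norm r (y - ((phi : V -> R^o), gradient phi))%R < e%:E)%E.

(* The dual space of W^{1,r}_0(Omega), so W^{-1,r} is
   [W10_dual (hoelder_conjugate r)] *)
Definition W10_dual r F : Prop :=
  (forall (a : R) y z, W10 r y -> W10 r z -> F (a *: y + z) = a * F y + F z) /\
  exists C : R, forall y, W10 r y -> (`|F y|%:E <= C%:E * sobolev_norm r y)%E.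

Definition weak_poisson r F y : Prop := W10 r y /\
  forall v, W10 (hoelder_conjugate r) v ->
    \int[leb]_(x in Omega) dot (y.2 x) (v.2 x) = F v.

Definition poisson_uniquely_solvable r : Prop :=
  forall F, W10_dual (hoelder_conjugate r) F ->
  exists2 y, weak_poisson r F y &
    forall z, weak_poisson r F z -> sobolev_norm r (z - y) = 0%E.

(* The representative of [v] in C_0(Omega), extended by zero. *)
Definition C0_rep v : V -> R := xget (fun=> 0) [set w : V -> R |
  [/\ continuous w, forall x, ~ Omega x -> w x = 0
    & {ae leb, forall x, Omega x -> w x = v.1 x}]].

Definition W10_continuous r J : Prop :=
  forall y, W10 r y -> forall e : R, 0 < e -> exists2 delta : R, 0 < delta &
  forall z, W10 r z -> (sobolev_norm r (z - y)%R < delta%:E)%E ->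
    `|J z - J y| < e.

Definition is_gateaux r J y (L : W -> R) : Prop := W10_dual r L /\
  forall z, W10 r z ->
    t^-1 * (J (y + t *: z) - J y) @[t --> (0 : R)^'] --> L z.

End sobolev.

Section charges.
Context {dT : measure_display} {T : measurableType dT} {R : realType}.

Definition concentrated (X : set T) (u : set T -> \bar R) : Prop :=
  forall A, measurable A -> A `&` X = set0 -> u A = 0%E.

Variable u : {charge set T -> \bar R}.

Lemma hahn_exists : exists PN, hahn_decomposition u PN.1 PN.2.
Proof. by have [P [N h]] := Hahn_decomposition u; exists (P, N). Qed.

Definition hahn := svalP (cid hahn_exists).

Definition tv_norm : \bar R := charge_variation hahn setT.

Definition charge_integral (X : set T) (f : T -> R) : R :=
  \int[jordan_pos hahn]_(x in X) f x - \int[jordan_neg hahn]_(x in X) f x.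

End charges.

Section transport.
Context {R : realType} {d : nat}.
Local Notation V := 'rV[R]_d.
Variables (omega0 omega1 : set V) (c : V * V -> R).

Definition transport_plan (u0 u : set V -> \bar R) : set {finite_measure set (V * V)%type -> \bar R} :=
  [set pi | [/\ concentrated (omega0 `*` omega1) pi,
    forall A, measurable A -> pushforward pi fst A = u0 A
  & forall A, measurable A -> pushforward pi snd A = u A]].

Definition transport_cost (pi : {finite_measure set (V * V)%type -> \bar R}) :=
  (\int[pi]_(z in omega0 `*` omega1) (c z)%:E)%E.

Definition Dc (u0 u : set V -> \bar R) : \bar R :=
  ereal_inf [set transport_cost pi | pi in transport_plan u0 u].

Definition optimal_plan (u0 u : set V -> \bar R) : set {finite_measure set (V * V)%type -> \bar R} :=
  [set pi | transport_plan u0 u pi /\ transport_cost pi = Dc u0 u].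

End transport.

Section control.
Context {R : realType} {d : nat}.
Local Notation V := 'rV[R]_d.
Local Notation W := (sobolev R d).
Variables (Omega omega0 omega1 : set V) (u0 : {finite_measure set V -> \bar R}).
Variables (c : V * V -> R) (alpha : R) (q : \bar R) (J : W -> R).

(* S u = (-Delta)^{-1} E^* u *)
Definition state (u : {charge set V -> \bar R}) : W := xget 0
  (weak_poisson Omega q (fun v => charge_integral u omega1 (C0_rep Omega v))).

Definition objective (u : {charge set V -> \bar R}) : \bar R :=
  ((J (state u))%:E + alpha%:E * Dc omega0 omega1 c u0 u)%E.

Definition locally_optimal (ubar : {charge set V -> \bar R}) : Prop :=
  [/\ concentrated omega1 ubar, (objective ubar < +oo)%E &
  exists2 e : R, 0 < e & forall u : {charge set V -> \bar R},
    concentrated omega1 u -> (tv_norm (cadd u (copp ubar)) < e%:E)%E ->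
    (objective ubar <= objective u)%E].

End control.

(* Main.v *)
Require Import Defs.
From HB Require Import structures.
From mathcomp Require Import all_boot all_order all_algebra.
From mathcomp Require Import all_classical all_reals all_analysis.
From mathcomp Require Import measurable_realfun ring lra.
Set Implicit Arguments.
Unset Strict Implicit.
Unset Printing Implicit Defensive.
Import Order.TTheory GRing.Theory Num.Theory.
Import numFieldNormedType.Exports.
Local Open Scope classical_set_scope.
Local Open Scope ring_scope.

(* Let w be the continuous representative of p, delta = alpha * beta - kappa > 0.
   For x in omega0 the function psi_x(xi) = w(xi) + alpha * h(xi - x) is strongly
   convex on omega1, so it has a unique minimizer T x and
     psi_x(xi) >= psi_x(T x) + delta / 4 * |xi - T x|^2.
   Comparing ubar with (1 - t) ubar + t T#u0 and letting t tend to 0 gives, through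
   the adjoint equation,
     int w dubar + alpha * D(ubar) <= int w d(T#u0) + alpha * cost of (id, T)#u0
                                    = int psi_x(T x) du0(x).
   Integrating the growth inequality against an epsilon-optimal plan pi of ubar then
   yields int |xi - T x|^2 dpi = O(epsilon).  Letting epsilon tend to 0, Chebyshev's
   inequality gives ubar = T#u0, whence the optimality of (id, T)#u0; with epsilon = 0
   it gives uniqueness.  Adding the growth inequalities at x and y bounds
   |T x - T y|^2 by a second difference of h, which gives both regularity statements.
   The state operator is well defined because W^{1,q'}_0 embeds into C_0 (Morrey). *)

(** * Convexity *)

(** Three obstacles shape the argument. [h] is convex but possibly not differentiable and [omega1]
    is a constraint set, so no Euler condition at T x is used: the growth of psi_x is read off from
    a midpoint inequality 2 psi(m) + delta / 4 |b - a|^2 <= psi(a) + psi(b), which is also where the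
    factor 1/4 comes from. No minimizing plan is known beforehand; near-optimal ones exist as soon
    as the infimum is finite, and they suffice because the two marginals compared in the limit are
    the same for all of them. Finally [ubar] is a signed charge and states are chosen
    representatives: finiteness of the transport cost yields a plan whose second marginal is [ubar],
    which is therefore nonnegative, and continuity makes [J] blind to the choice of a
    representative. The perturbation runs along a segment towards T#u0 because [J] is only Gateaux
    differentiable and because plans can be mixed along a segment: D((1 - t) ubar + t T#u0) is at
    most the convex combination of D(ubar) and the cost of (id, T)#u0. *)

Section euclidean_theory.
Context {R : realType} {d : nat}.
Local Notation V := 'rV[R]_d.
Implicit Types (x y z : V) (a b : R).

Lemma dotC x y : dot x y = dot y x.
Proof. by apply: eq_bigr => i _; rewrite mulrC. Qed.

Lemma dotDl x y z : dot (x + y) z = dot x z + dot y z.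
Proof. by rewrite -big_split; apply: eq_bigr => i _ /=; rewrite !mxE mulrDl. Qed.

Lemma dotZl a x y : dot (a *: x) y = a * dot x y.
Proof. by rewrite /dot mulr_sumr; apply: eq_bigr => i _ /=; rewrite !mxE mulrA. Qed.

Lemma dotDr x y z : dot z (x + y) = dot z x + dot z y.
Proof. by rewrite dotC dotDl !(dotC z). Qed.

Lemma dotZr a x y : dot x (a *: y) = a * dot x y.
Proof. by rewrite dotC dotZl dotC. Qed.

Lemma dotNl x y : dot (- x) y = - dot x y.
Proof. by rewrite -scaleN1r dotZl mulN1r. Qed.

Lemma dotNr x y : dot x (- y) = - dot x y.
Proof. by rewrite dotC dotNl dotC. Qed.

Lemma dotBl x y z : dot (x - y) z = dot x z - dot y z.
Proof. by rewrite dotDl dotNl. Qed.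

Lemma dotBr x y z : dot z (x - y) = dot z x - dot z y.
Proof. by rewrite dotDr dotNr. Qed.

Lemma dot0l x : dot 0 x = 0.
Proof. by rewrite /dot big1// => i _; rewrite mxE mul0r. Qed.

Lemma dot0r x : dot x 0 = 0.
Proof. by rewrite dotC dot0l. Qed.

Lemma dot_delta x i : dot x (delta_mx 0 i) = x 0 i.
Proof.
rewrite /dot (bigD1 i)//= big1 => [|j ji].
  by rewrite !mxE !eqxx mulr1 addr0.
by rewrite !mxE (negbTE ji) andbF mulr0.
Qed.

Lemma dotxx_ge0 x : 0 <= dot x x.
Proof. by apply: sumr_ge0 => i _; rewrite -expr2 sqr_ge0. Qed.

Lemma enorm_ge0 x : 0 <= enorm x.
Proof. exact: sqrtr_ge0. Qed.

Lemma enorm_sqr x : enorm x ^+ 2 = dot x x.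
Proof. by rewrite sqr_sqrtr// dotxx_ge0. Qed.

Lemma enormZ a x : enorm (a *: x) = `|a| * enorm x.
Proof. by rewrite /enorm dotZl dotZr mulrA -expr2 sqrtrM ?sqr_ge0// sqrtr_sqr. Qed.

Lemma enormN x : enorm (- x) = enorm x.
Proof. by rewrite -scaleN1r enormZ normrN1 mul1r. Qed.

Lemma enorm_dist x y : enorm (x - y) = enorm (y - x).
Proof. by rewrite -enormN opprB. Qed.

Lemma mxnorm_le_enorm x : `|x| <= enorm x.
Proof.
rewrite [leLHS]/Num.norm/= mx_normrE.
apply/bigmax_leP; split => [|[i j] _]; first exact: enorm_ge0.
rewrite /= ord1 -sqrtr_sqr ler_sqrt ?sqr_ge0//; last exact: dotxx_ge0.
rewrite /dot (bigD1 j)//= -expr2 lerDl; apply: sumr_ge0 => k _.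
by rewrite -expr2 sqr_ge0.
Qed.

Lemma enorm_eq0 x : enorm x = 0 -> x = 0.
Proof.
move=> x0; apply/eqP; rewrite -normr_le0.
by rewrite -x0 mxnorm_le_enorm.
Qed.

Lemma coord_le_mxnorm x i : `|x 0 i| <= `|x|.
Proof.
rewrite [leRHS]/Num.norm/= mx_normrE.
by apply: (le_bigmax _ (fun ij : 'I_1 * 'I_d => `|x ij.1 ij.2|) (0, i)).
Qed.

Lemma dot_le_enorm x y : dot x y <= enorm x * enorm y.
Proof.
have [x0|x0] := eqVneq (enorm x) 0.
  by rewrite x0 (enorm_eq0 x0) dot0l mul0r.
(* Expanding this square gives 2 |x| |y| (|x| |y| - <x, y>) >= 0. *)
have := dotxx_ge0 (enorm y *: x - enorm x *: y).
have [y0|y0] := eqVneq (enorm y) 0.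
  by rewrite y0 (enorm_eq0 y0) dot0r mulr0.
rewrite !(dotBl, dotBr, dotZl, dotZr) -!enorm_sqr (dotC y x).
have xp : 0 < enorm x by rewrite lt_def x0 enorm_ge0.
have yp : 0 < enorm y by rewrite lt_def y0 enorm_ge0.
move=> h; rewrite -subr_ge0.
have h2 : 0 <= (enorm x * enorm y *+ 2) * (enorm x * enorm y - dot x y).
  by move: h; congr (0 <= _); ring.
by move: h2; rewrite pmulr_rge0// mulrn_wgt0// mulr_gt0.
Qed.

Lemma dot_le_sum x y : dot x y <= (\sum_i `|x 0 i|) * `|y|.
Proof.
rewrite /dot mulr_suml; apply: ler_sum => i _.
by rewrite (le_trans (ler_norm _))// normrM ler_wpM2l// coord_le_mxnorm.
Qed.

End euclidean_theory.

Lemma MVT01 {R : realType} (f df : R -> R) :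
  (forall t : R, 0 <= t <= 1 -> is_derive t 1 f (df t)) ->
  exists2 c : R, 0 <= c <= 1 & f 1 - f 0 = df c.
Proof.
move=> fdf.
have d1 (x : R) : x \in `]0, 1[%R -> is_derive x 1 f (df x).
  by rewrite in_itv/= => /andP[x0 x1]; apply: fdf; rewrite !ltW.
have d2 : {within `[(0 : R), 1], continuous f}.
  by apply: derivable_within_continuous => x; rewrite in_itv/= => /fdf[].
have [c c01 E] := MVT_segment ler01 d1 d2.
by exists c => //; rewrite E subr0 mulr1.
Qed.

Section segments.
Context {R : realType} {d : nat}.
Local Notation V := 'rV[R]_d.

Lemma convex_set_segment (A : set V) (x y : V) (t : R) :
  convex_set (A : set (convex_lmodType V)) -> A x -> A y -> 0 <= t <= 1 ->
  A (x + t *: (y - x)).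
Proof.
move=> cA Ax Ay /andP[t0 t1].
have := cA y x (Itv01 t0 t1) (mem_set Ay) (mem_set Ax).
move/set_mem; congr (A _); rewrite /conv/= /unstable.onem scalerBl scale1r scalerBr.
by rewrite addrCA.
Qed.

Lemma convex_function_conv (h : V -> R) (x y : V) (s t : R) :
  convex_function [set: convex_lmodType V] h -> 0 < s -> 0 < t ->
  (s + t) * h ((s + t)^-1 *: (s *: x + t *: y)) <= s * h x + t * h y.
Proof.
move=> ch s0 t0; have st0 : 0 < s + t by rewrite addr_gt0.
have l0 : 0 <= s / (s + t) by rewrite divr_ge0// ltW.
have l1 : s / (s + t) <= 1 by rewrite ler_pdivrMr// mul1r lerDl ltW.
have := ch (Itv01 l0 l1) x y (in_setT _) (in_setT _).
have e : unstable.onem (s / (s + t)) = t / (s + t).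
  by rewrite /unstable.onem; field; rewrite gt_eqF.
rewrite convRE/= e {1}/conv/= e => /(ler_wpM2l (ltW st0)).
rewrite [X in _ <= X -> _](_ : _ = s * h x + t * h y); last first.
  by field; rewrite gt_eqF.
by rewrite scalerDr !scalerA ![_^-1 * _]mulrC.
Qed.

Lemma is_derive_line (f : V -> R) (x v : V) (s df : R) :
  is_derive (x + s *: v) v (f : V -> R^o) df ->
  is_derive s 1 (fun t : R => f (x + t *: v)) df.
Proof.
move=> [fd <-]; have e : (fun h : R => h^-1 *: ((f \o shift (x + s *: v)) (h *: v) -
    f (x + s *: v)) : R^o) = (fun h : R => h^-1 *: (((fun t : R => f (x + t *: v) : R^o) \o shift s)
    (h *: 1) - f (x + s *: v))).
  apply/funext => h /=; congr (_ *: (f _ - _)).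
  by rewrite /shift/= scalerDl [h *: 1]mulr1 addrCA addrA.
by split; [move: fd; rewrite /derivable e|rewrite /derive e].
Qed.

Lemma derive_gradient (f : V -> R) (x v : V) : differentiable (f : V -> R^o) x ->
  is_derive x v (f : V -> R^o) (dot (gradient f x) v).
Proof.
move=> df; apply: DeriveDef; first exact: diff_derivable.
rewrite deriveE// {1}(row_sum_delta v) linear_sum /dot; apply: eq_bigr => i _.
by rewrite linearZ/= mxE /partial deriveE// mulrC.
Qed.

End segments.

(** * Subgradients of a finite convex function *)

Section convex_analysis.
Context {R : realType} {d : nat}.
Local Notation V := 'rV[R]_d.
Variable h : V -> R.
Hypothesis ch : convex_function [set: convex_lmodType V] h.

(* Hahn-Banach, one coordinate at a time. *)
Lemma subdiff_nonempty (a : V) : exists g, subdiff h a g.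
Proof.
suff H k : (k <= d)%N -> exists g : V, forall w : V,
    (forall j : 'I_d, (k <= j)%N -> w 0 j = 0) -> h a + dot g w <= h (a + w).
  have [g hg] := H d (leqnn d); exists g => y.
  rewrite -{2}(subrKC a y); apply: hg => j.
  by rewrite leqNgt ltn_ord.
elim: k => [_|k IH kd].
  exists 0 => w w0; have -> : w = 0.
    by apply/rowP => j; rewrite w0// mxE.
  by rewrite dot0l !addr0.
have [g hg] := IH (ltnW kd); pose e : V := delta_mx 0 (Ordinal kd).
pose Wk (w : V) := forall j : 'I_d, (k <= j)%N -> w 0 j = 0.
(* Backward slopes in the new direction [e]. Any number between these and the forward slopes can
   serve as the next coordinate of the subgradient; the supremum of [S] is one. *)
pose S := [set r : R | exists s w, [/\ 0 < s, Wk w &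
  r = (h a + dot g w - h (a + (w - s *: e))) / s]].
(* With weights s and t the [e]-components of w + t e and w' - s e cancel, so the convex combination
   lies in the subspace where [g] already supports [h]. *)
have key (s t : R) w w' : 0 < s -> 0 < t -> Wk w -> Wk w' ->
    (h a + dot g w' - h (a + (w' - s *: e))) / s <=
    (h (a + (w + t *: e)) - h a - dot g w) / t.
  move=> s0 t0 hw hw'; rewrite ler_pdivrMr// mulrAC ler_pdivlMr//.
  have := convex_function_conv (a + (w + t *: e)) (a + (w' - s *: e)) ch s0 t0.
  have st0 : 0 < s + t by rewrite addr_gt0.
  have -> : (s + t)^-1 *: (s *: (a + (w + t *: e)) + t *: (a + (w' - s *: e))) =
      a + (s + t)^-1 *: (s *: w + t *: w').
    by apply/rowP => j; rewrite !mxE; field; rewrite gt_eqF.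
  have := hg ((s + t)^-1 *: (s *: w + t *: w')).
  rewrite dotZr dotDr !dotZr => /(_ _)/(ler_wpM2l (ltW st0)) hg'.
  have {}/hg' : forall j : 'I_d, (k <= j)%N -> ((s + t)^-1 *: (s *: w + t *: w')) 0 j = 0.
    by move=> j kj; rewrite !mxE hw// hw'// !mulr0 addr0 mulr0.
  rewrite mulrDr mulVKf ?gt_eqF//; lra.
have S0 : S !=set0.
  exists ((h a + dot g 0 - h (a + (0 - 1 *: e))) / 1), 1, 0; split => // j _.
  by rewrite mxE.
have Sub (t : R) w : 0 < t -> Wk w ->
    ubound S ((h (a + (w + t *: e)) - h a - dot g w) / t).
  by move=> t0 hw _ [s [w' [s0 hw' ->]]]; exact: key.
have hsS : has_sup S.
  split=> //; exists ((h (a + (0 + 1 *: e)) - h a - dot g 0) / 1).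
  by apply: Sub => // j _; rewrite mxE.
pose c := sup S.
exists (g + (c - g 0 (Ordinal kd)) *: e) => w' hw'.
pose t := w' 0 (Ordinal kd); pose w := w' - t *: e.
have hw : Wk w.
  move=> j; rewrite leq_eqVlt => /predU1P[kj|kj].
    have -> : j = Ordinal kd by exact/val_inj.
    by rewrite !mxE !eqxx mulr1 subrr.
  rewrite !mxE hw'// eqxx /= (_ : j == _ = false) ?mulr0 ?subr0//.
  by apply/negbTE; rewrite -val_eqE/= gtn_eqF.
have w'E : w' = w + t *: e by rewrite subrK.
rewrite dotDl dotZl (dotC e) dot_delta -/t.
have -> : dot g w' = dot g w + t * g 0 (Ordinal kd).
  by rewrite w'E dotDr dotZr dot_delta.
rewrite [X in h a + X](_ : _ = dot g w + c * t); last by ring.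
have [t0|t0|t0] := ltgtP t 0.
- have := ub_le_sup (proj2 hsS) (_ : S ((h a + dot g w - h (a + (w - - t *: e))) / - t)).
  rewrite -/c scaleNr opprK -w'E => /(_ _); rewrite ler_pdivrMr ?oppr_gt0// => H.
  have /H : S ((h a + dot g w - h (a + w')) / - t).
    by exists (- t), w; rewrite oppr_gt0 scaleNr opprK -w'E.
  lra.
- have := ge_sup S0 (Sub _ _ t0 hw); rewrite -w'E -/c ler_pdivlMr//; lra.
- by rewrite t0 mulr0 addr0 w'E t0 scale0r addr0; exact: hg.
Qed.

(** Formally this integrates <G(a + s v), v> >= <g, v> + be s |v|^2 over s in [0, 1], where G is a
    selection of subgradients. Since [h] need not be differentiable, the integral is replaced by
    Riemann sums on N + 1 equal pieces. *)
Lemma subdiff_strong (r be : R) (a v g : V) :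
  (forall x xs xi xis, subdiff h x xs -> subdiff h xi xis ->
    eball r x -> eball r xi ->
    be * enorm (x - xi) ^+ 2 <= dot (xs - xis) (x - xi)) ->
  (forall t, 0 <= t <= 1 -> eball r (a + t *: v)) -> subdiff h a g ->
  h a + dot g v + be / 2 * enorm v ^+ 2 <= h (a + v).
Proof.
move=> mono seg ag.
have [G hG] := choice subdiff_nonempty.
(* The subgradient at the left end of each piece is used, so the gains are proportional to 0 + 1 +
   ... + (k - 1) = k (k - 1) / 2. On the first piece the subgradient is [g] itself; monotonicity
   says nothing between [a] and [a]. *)
have step (N k : nat) : (k <= N)%N ->
  h a + k%:R / N.+1%:R * dot g v +
    be * enorm v ^+ 2 / N.+1%:R ^+ 2 * (k%:R * (k%:R - 1) / 2) <=
  h (a + (k%:R / N.+1%:R) *: v) /\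
  h a + k.+1%:R / N.+1%:R * dot g v +
    be * enorm v ^+ 2 / N.+1%:R ^+ 2 * (k.+1%:R * (k.+1%:R - 1) / 2) <=
  h (a + (k.+1%:R / N.+1%:R) *: v).
  elim: k => [_|k IH kN].
    split; first by rewrite !mul0r scale0r !addr0 mulr0 addr0.
    rewrite subrr mulr0 mul0r mulr0 addr0 -dotZr.
    by have := ag (a + (1%:R / N.+1%:R) *: v); rewrite [a + _ - a]addrAC subrr add0r; exact.
  have [_ H] := IH (ltnW kN); split=> //.
  set s : R := k.+1%:R / N.+1%:R in H *.
  have s0 : 0 < s by rewrite divr_gt0.
  have s1 : s <= 1 by rewrite ler_pdivrMr// mul1r ler_nat ltnW.
  have := hG (a + s *: v) (a + (k.+2%:R / N.+1%:R) *: v).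
  have -> : a + (k.+2%:R / N.+1%:R) *: v - (a + s *: v) = N.+1%:R^-1 *: v.
    rewrite opprD addrACA subrr add0r -scalerBl; congr (_ *: _).
    by rewrite /s -mulrBl -natrB// subSnn mul1r.
  have bs : eball r (a + s *: v) by apply: seg; rewrite ltW.
  have ba : eball r a by have := seg 0; rewrite scale0r addr0 lexx ler01; exact.
  have := mono _ _ _ _ (hG (a + s *: v)) ag bs ba.
  rewrite addrAC subrr add0r enormZ ger0_norm ?(ltW s0)// dotZr dotZr dotBl.
  rewrite exprMn expr2 -mulrA [X in X <= _]mulrCA ler_pM2l// => H1 H2.
  apply: le_trans H2; set D := dot (G _) v in H1 *.
  apply: le_trans (lerD H (ler_wpM2l (_ : 0 <= N.+1%:R^-1) (_ : dot g v + be * (s * enorm v ^+ 2) <= D))) => //.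
  - have N0 : (N.+1%:R : R) != 0 by rewrite pnatr_eq0.
    rewrite /s -[k.+2%:R]natr1; move: N0; move: (N.+1%:R : R) (k.+1%:R : R) => n m n0.
    by rewrite le_eqVlt; apply/orP; left; apply/eqP; field.
  - lra.
apply/ler_addgt0Pr => e e0.
(* At k = N + 1 the quadratic term falls short of be / 2 |v|^2 by be |v|^2 / (2 (N + 1)), which the
   choice of N makes at most e. *)
pose c := `|be * enorm v ^+ 2| / 2.
have [N hN] : exists N : nat, c / e < N.+1%:R.
  by exists (Num.truncn (c / e)); exact: truncnS_gt.
have [_] := step N N (leqnn N).
rewrite divff ?pnatr_eq0// mul1r scale1r => H.
rewrite -lerBlDr; apply: le_trans H.
have N0 : (0 : R) < N.+1%:R by [].
have -> : be * enorm v ^+ 2 / N.+1%:R ^+ 2 * (N.+1%:R * (N.+1%:R - 1) / 2) =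
    be / 2 * enorm v ^+ 2 - be * enorm v ^+ 2 / 2 / N.+1%:R.
  by move: N0; move: (N.+1%:R : R) => n n0; field; rewrite gt_eqF.
have : be * enorm v ^+ 2 / 2 / N.+1%:R <= e.
  rewrite ler_pdivrMr//; move: hN; rewrite ltr_pdivrMr// mulrC => /ltW; apply: le_trans.
  by rewrite /c ler_wpM2r// ler_norm.
move: (_ / N.+1%:R) => z; lra.
Qed.

(** Test [g] at the vertex of the cube of half-width [|M| + 1] whose signs are those of [g]. Each
    coordinate then moves by at least 1 in the direction of its sign, so the l^1 norm of [g] is at
    most h(vertex) - h(x). There are finitely many vertices, and a subgradient at 0 bounds h(x) from
    below. *)
Lemma subdiff_bounded (M : R) : exists L : R, forall x g, `|x| <= M ->
  subdiff h x g -> \sum_i `|g 0 i| <= L.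
Proof.
pose S := `|M| + 1.
pose b (s : {ffun 'I_d -> bool}) : V := \row_i ((-1) ^+ s i * S).
have [g0 hg0] := subdiff_nonempty 0.
exists (\sum_s `|h (b s)| - (h 0 - (\sum_i `|g0 0 i|) * `|M|)) => x g xM hg.
pose s := [ffun i => g 0 i < 0].
have H1 : h x + \sum_i `|g 0 i| <= h (b s).
  apply: le_trans (hg (b s)); rewrite lerD2l; apply: ler_sum => i _.
  rewrite !mxE ffunE; have := le_trans (coord_le_mxnorm x i) (le_trans xM (ler_norm M)).
  rewrite ler_norml /S => /andP[xl xr]; case: ltP => g0'.
    rewrite ltr0_norm// expr1 -subr_ge0; nra.
  rewrite ger0_norm// expr0 mul1r -subr_ge0; nra.
have H2 : h (b s) <= \sum_s `|h (b s)|.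
  rewrite (bigD1 s)//= (le_trans (ler_norm _))// lerDl; exact: sumr_ge0.
have H3 : h 0 - (\sum_i `|g0 0 i|) * `|M| <= h x.
  apply: le_trans (hg0 x); rewrite subr0 lerD2l lerNl -dotNr.
  apply: le_trans (dot_le_sum _ _) _; rewrite normrN ler_wpM2l//.
    exact: sumr_ge0.
  by rewrite (le_trans xM)// ler_norm.
lra.
Qed.

(** The subgradient at the point with the larger value bounds the difference of the two values. *)
Lemma convex_lipschitz_bounded (M : R) : exists2 L : R, 0 <= L &
  forall x y, `|x| <= M -> `|y| <= M -> `|h x - h y| <= L * `|x - y|.
Proof.
have [L hL] := subdiff_bounded M; exists `|L| => // x y xM yM.
wlog xy : x y xM yM / h y <= h x.
  move=> H; have [/H|/ltW /H] := leP (h y) (h x); first exact.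
  by rewrite (distrC (h x)) (distrC x); exact.
rewrite ger0_norm ?subr_ge0//.
have [g hg] := subdiff_nonempty x.
have := hg y; rewrite -(opprB x y) dotNr.
have := dot_le_sum g (x - y).
have := ler_wpM2r (normr_ge0 (x - y)) (le_trans (hL _ _ xM hg) (ler_norm L)).
lra.
Qed.

Lemma convex_function_continuous : continuous h.
Proof.
move=> x; have [L L0 hL] := convex_lipschitz_bounded (`|x| + 1).
apply: (proj2 (@cvgrPdist_le _ R^o _ (nbhs (x : V)) _ h (h x))) => e e0.
apply/nbhs_ballP.
have L1 : 0 < L + 1 by rewrite ltr_wpDl.
exists (Num.min 1 (e / (L + 1))); first by rewrite /= lt_min ltr01 divr_gt0.
move=> y; rewrite -ball_normE /= lt_min => /andP[xy1 xye].
apply: le_trans (hL _ _ _ _) _.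
- by rewrite lerDl.
- rewrite -[X in `|X|](subKr x) (le_trans (ler_normB _ _))// lerD2l; exact: ltW.
- apply: le_trans (_ : (L + 1) * `|x - y| <= _); first by rewrite ler_wpM2r// lerDl.
  by rewrite mulrC -ler_pdivlMr//; exact: ltW.
Qed.

End convex_analysis.

(** * Midpoint inequality for the sum of a semiconvex and a strongly convex function *)

Section quadratic_growth.
Context {R : realType} {d : nat}.
Local Notation V := 'rV[R]_d.

(** Along the segment, P(a + t v) - <grad P(a), v> t + ka / 2 |v|^2 t^2 has a nonnegative derivative
    by the monotonicity assumption; compare its values at 1 and 0. *)
Lemma gradient_lower_bound (P : V -> R) (omega : set V) (ka : R) (a b : V) :
  (forall x, omega x -> differentiable (P : V -> R^o) x) ->
  convex_set (omega : set (convex_lmodType V)) ->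
  (forall x y, omega x -> omega y -> - ka * enorm (x - y) ^+ 2 <=
     dot (gradient P x - gradient P y) (x - y)) ->
  omega a -> omega b ->
  P a + dot (gradient P a) (b - a) - ka / 2 * enorm (b - a) ^+ 2 <= P b.
Proof.
move=> dP co mono oa ob; set v := b - a.
have seg (t : R) : 0 <= t <= 1 -> omega (a + t *: v).
  by move=> t01; exact: convex_set_segment.
pose c := dot (gradient P a) v.
pose f (t : R) := P (a + t *: v) - c * t + ka / 2 * enorm v ^+ 2 * t ^+ 2.
have df (t : R) : 0 <= t <= 1 -> is_derive t 1 f
    (dot (gradient P (a + t *: v)) v - c + ka * enorm v ^+ 2 * t).
  move=> t01.
  have := is_derive_line (derive_gradient v (dP _ (seg _ t01))) => D1.
  have D2 : is_derive t 1 (fun s : R => c * s) c.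
    by apply: is_derive_eq (is_deriveZ c (is_derive_id t 1)) _; exact: mulr1.
  have D3 : is_derive t 1 (fun s : R => ka / 2 * enorm v ^+ 2 * s ^+ 2)
      (ka / 2 * enorm v ^+ 2 * (2 * t)).
    apply: is_derive_eq (is_deriveZ _ (is_deriveX 2 (is_derive_id t 1))) _.
    by rewrite /GRing.scale/= expr1 mulr1.
  apply: is_derive_eq (is_deriveD (is_deriveB D1 D2) D3) _.
  by field.
have [x x01] := MVT01 df.
rewrite /f !scale1r scale0r subrKC addr0 !mulr1 !mulr0 expr0n/= mulr0 => E.
suff: 0 <= dot (gradient P (a + x *: v)) v - c + ka * enorm v ^+ 2 * x.
  by rewrite -E expr1n -/c; lra.
have := mono _ _ (seg _ x01) oa; rewrite addrAC subrr add0r enormZ dotZr dotBl.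
move: x01 => /andP[x0 _]; rewrite (ger0_norm x0).
have [->|xn] := eqVneq x 0; first by move=> _; rewrite scale0r addr0 -/c subrr mulr0 add0r lexx.
have xp : 0 < x by rewrite lt_def xn.
rewrite exprMn expr2 -mulrA [X in X <= _]mulrCA ler_pM2l// -/c; lra.
Qed.

(** Expand both summands at the midpoint m towards a and towards b. The linear terms cancel because
    a - m = - (b - m), and each side contributes (al be - ka) / 2 times |b - a|^2 / 4. *)
Lemma midpoint_strong_convexity (P h : V -> R) (omega : set V)
    (x : V) (al be ka r : R) (a b : V) :
  convex_function [set: convex_lmodType V] h -> 0 < al ->
  (forall x xs xi xis, subdiff h x xs -> subdiff h xi xis ->
    eball r x -> eball r xi ->
    be * enorm (x - xi) ^+ 2 <= dot (xs - xis) (x - xi)) ->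
  (forall x, omega x -> differentiable (P : V -> R^o) x) ->
  convex_set (omega : set (convex_lmodType V)) ->
  (forall x y, omega x -> omega y -> - ka * enorm (x - y) ^+ 2 <=
     dot (gradient P x - gradient P y) (x - y)) ->
  (forall y, omega y -> eball r (y - x)) ->
  omega a -> omega b ->
  2 * (P (a + 2^-1 *: (b - a)) + al * h (a + 2^-1 *: (b - a) - x)) + (al * be - ka) / 4 * enorm (b - a) ^+ 2 <=
  (P a + al * h (a - x)) + (P b + al * h (b - x)).
Proof.
move=> ch al0 mono dP co monoP obx oa ob; set m := a + _.
have om : omega m by apply: convex_set_segment => //; lra.
have [g hg] := subdiff_nonempty ch (m - x).
have am : a - m = - 2^-1 *: (b - a) by rewrite /m opprD addrA subrr add0r scaleNr.
have bm : b - m = 2^-1 *: (b - a).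
  by rewrite /m; apply/rowP => j; rewrite !mxE; field.
have Ha := gradient_lower_bound dP co monoP om oa.
have Hb := gradient_lower_bound dP co monoP om ob.
have seg c : omega c -> forall t, 0 <= t <= 1 -> eball r (m - x + t *: (c - m)).
  by move=> oc t t01; rewrite addrAC; apply: obx; exact: convex_set_segment.
have ha := subdiff_strong ch mono (seg _ oa) hg.
have hb := subdiff_strong ch mono (seg _ ob) hg.
have e c : m - x + (c - m) = c - x by rewrite addrC addrA subrK.
move: Ha Hb ha hb; rewrite !e am bm !enormZ !dotZr normrN ger0_norm// !exprMn => Ha Hb ha hb.
have {}ha := ler_wpM2l (ltW al0) ha.
have {}hb := ler_wpM2l (ltW al0) hb.
lra.
Qed.

End quadratic_growth.

(** * Borel sets of R^n *)

Section borel_rV.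
Context {R : realType} {d : nat}.
Local Notation V := 'rV[R]_d.

Lemma closed_measurable_rV (A : set V) : closed A -> measurable A.
Proof.
move=> cA; rewrite -(setCK A); apply: measurableC.
by apply: open_measurable_rV; exact: closed_openC.
Qed.

Lemma compact_measurable_rV (A : set V) : compact A -> measurable A.
Proof.
move=> cA; apply: closed_measurable_rV; exact: compact_closed.
Qed.

Lemma continuous_measurable_rV (f : V -> R) : continuous f -> measurable_fun setT f.
Proof.
move=> cf; apply: (measurability _ (RGenOInfty.measurableE R)) => _ [_ [x ->] <-].
rewrite setTI; apply: open_measurable_rV.
by move/continuousP: cf; apply; exact: interval_open.
Qed.

Lemma rat_ball (x : V) (e : R) : 0 < e -> exists c : 'rV[rat]_d * rat,
  ball (map_mx ratr c.1 : V) (ratr c.2) x /\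
  ball (map_mx ratr c.1 : V) (ratr c.2) `<=` ball x e.
Proof.
move=> e0.
have [r] := @rat_in_itvoo R 0 (e / 2) (divr_gt0 e0 (ltr0Sn _ _)).
rewrite in_itv/= => /andP[r0 re].
have /choice[c hc] (j : 'I_d) : exists c : rat, ball (ratr c : R) (ratr r) (x 0 j).
  have [c] := @rat_in_itvoo R (x 0 j - ratr r) (x 0 j + ratr r) ltac:(lra).
  rewrite in_itv/= => hc; exists c; rewrite /ball/= ltr_norml; lra.
have xc : ball (map_mx ratr (\row_j c j) : V) (ratr r) x.
  by apply/ball_rV => // j; rewrite !mxE.
exists (\row_j c j, r); split=> //= y yc.
rewrite [e]splitr; apply: ball_triangle.
  by apply: (le_ball (ltW re)); apply: ball_sym; exact: xc.
by apply: (le_ball (ltW re)); exact: yc.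
Qed.

(** [V * V] carries the product sigma-algebra, and an open set is a countable union of products of
    rational balls. This makes continuous costs measurable for plans. *)
Lemma open_measurable_rV2 (U : set (V * V)) : open U -> measurable U.
Proof.
move=> oU.
pose q (x : 'rV[rat]_d * rat) := ball (map_mx ratr x.1 : V) (ratr x.2).
have -> : U = \bigcup_(x : ('rV[rat]_d * rat) * ('rV[rat]_d * rat))
    (if `[< q x.1 `*` q x.2 `<=` U >] then q x.1 `*` q x.2 else set0).
  apply/seteqP; split=> [[x y] Uxy|x [y _]]; last by case: asboolP => // h /h.
  have /nbhs_ballP[e /= e0 xe] := open_nbhs_nbhs (conj oU Uxy).
  have [c1 [xc1 c1x]] := rat_ball x e0; have [c2 [xc2 c2x]] := rat_ball y e0.
  exists (c1, c2) => //=; case: asboolP => //=; case => -[x' y'] /= [x'1 y'2].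
  by apply: xe; split; [exact: c1x|exact: c2x].
apply: countable_bigcupT_measurable; first exact: countableP.
move=> x; case: asboolP => // _; apply: measurableX; apply: open_measurable_rV;
  exact: ball_open.
Qed.

Lemma continuous_measurable_rV2 (f : V * V -> R) :
  continuous f -> measurable_fun setT f.
Proof.
move=> cf; apply: (measurability _ (RGenOInfty.measurableE R)) => _ [_ [x ->] <-].
rewrite setTI; apply: open_measurable_rV2.
by move/continuousP: cf; apply; exact: interval_open.
Qed.

(** Taking complements, the measures agree on open sets, a generating class stable under
    intersection. *)
Lemma finite_measure_eq_closed (m1 m2 : {finite_measure set V -> \bar R}) :
  (forall A, closed A -> m1 A = m2 A) -> forall A, measurable A -> m1 A = m2 A.
Proof.
move=> h A mA; apply: (@measure_unique _ _ _ (@open V) (fun=> setT)) => //.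
- by move=> B C; exact: openI.
- by move=> _; exact: openT.
- by rewrite bigcup_const//; exists 0%N.
- move=> B oB; have cB := open_closedC oB.
  have mB := closed_measurable_rV cB.
  rewrite -(setCK B) -setTD; transitivity (m1 setT - m1 (setT `&` ~` B))%E.
    by apply: measureD => //; rewrite ltey_eq fin_num_measure.
  rewrite setTI (h _ closedT) (h _ cB) -{1}(setTI (~` B)); apply/esym/measureD => //.
  by rewrite ltey_eq fin_num_measure.
- by move=> _; rewrite ltey_eq fin_num_measure.
Qed.

(** Meant for the transport map, which is continuous relative to [omega0] and constant outside, with
    a possible jump in between. *)
Lemma measurable_fun_closed_patch (D : set V) (f : V -> V) (y : V) :
  closed D -> (forall x, D x -> forall e : R, 0 < e -> exists2 r : R, 0 < r &
    forall z, D z -> `|x - z| < r -> `|f x - f z| < e) ->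
  measurable_fun setT (patch (fun=> y) D f).
Proof.
move=> cD cf; apply: (measurability (@open V)) => // _ [U oU <-].
rewrite setTI.
(* An open set whose trace on [D] is the trace of the preimage: the union of the balls given by
   relative continuity. *)
pose W := \bigcup_(c in [set c : V * R | D c.1 /\ 0 < c.2 /\
   forall z, D z -> `|c.1 - z| < c.2 -> U (f z)]) ball c.1 c.2.
have oW : open W by apply: bigcup_open => c _; exact: ball_open.
have -> : patch (fun=> y) D f @^-1` U = (D `&` W) `|` (~` D `&` (cst y @^-1` U)).
  apply/seteqP; split=> x /=.
    rewrite /patch; case: ifPn => [/set_mem Dx Ux|/negP xD Uy].
      left; split=> //.
      have /nbhs_ballP[e /= e0 Ue] := open_nbhs_nbhs (conj oU Ux).
      have [r r0 hr] := cf _ Dx _ e0.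
      exists (x, r) => /=; last exact: ballxx.
      split=> //; split=> // z Dz xz; apply: Ue; rewrite -ball_normE/=; exact: hr.
    by right; split=> // Dx; apply: xD; exact/mem_set.
  move=> [[Dx [[c r] /= [Dc [r0 hc]]]]|[nDx Uy]].
    by rewrite -ball_normE/= /patch mem_set// => cx; exact: hc.
  by rewrite /patch memNset.
apply: measurableU; apply: measurableI.
- exact: closed_measurable_rV.
- exact: open_measurable_rV.
- by apply: measurableC; exact: closed_measurable_rV.
- by have [Uy|nUy] := pselect (U y); [rewrite (_ : _ @^-1` _ = setT)|rewrite (_ : _ @^-1` _ = set0)] => //;
    apply/seteqP; split=> // x.
Qed.

End borel_rV.

(** * Affine changes of variables *)

Section push.
Context d d' (T1 : measurableType d) (T2 : measurableType d') (R : realType).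
Variables (m : {measure set T1 -> \bar R}) (f : T1 -> T2).
Hypothesis mf : measurable_fun setT f.

Definition push_measure : {measure set T2 -> \bar R} :=
  measure_function_pushforward__canonical__measure_function_Measure m mf.

Lemma push_measureE A : push_measure A = m (f @^-1` A).
Proof. by []. Qed.

End push.

Section lebesgue_affine.
Context {R : realType}.

Lemma measurable_affine (a s : R) :
  measurable_fun setT (fun t : measurableTypeR R => (a + s * t : measurableTypeR R)).
Proof. by apply: measurable_funD => //; exact: measurable_funM. Qed.

(** Once multiplied by s, the left side is a measure in [A] with the same values as Lebesgue measure
    on the intervals ]x, y]. *)
Lemma lebesgue_measure_affine (a s : R) (A : set (measurableTypeR R)) :
  0 < s -> measurable A ->
  lebesgue_measure ((fun t => a + s * t) @^-1` A) = (s^-1%:E * lebesgue_measure A)%E.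
Proof.
move=> s0 mA.
pose m : {measure set (measurableTypeR R) -> \bar R} :=
  mscale (NngNum (ltW s0)) (push_measure lebesgue_measure (measurable_affine a s)).
suff -> : lebesgue_measure A = m A.
  rewrite /m/= /mscale/= muleA -EFinM mulVf ?gt_eqF// mul1e.
  by [].
apply: lebesgue_measure_unique => // X /ocitvP[->|[[x y] /= xy ->]].
  by rewrite !measure0.
rewrite /m/= /mscale/= [X in (_ * X)%E]push_measureE.
rewrite (_ : _ @^-1` _ = `](x - a) / s, (y - a) / s]%classic); last first.
  apply/seteqP; split=> t /=; rewrite !in_itv/= ltr_pdivrMr// ler_pdivlMr// => /andP[h1 h2];
    apply/andP; split; lra.
have H (u v : R) : u < v -> lebesgue_measure (`]u, v]%classic : set R) = (v - u)%:E.
  by move=> uv; rewrite lebesgue_measure_itv/= lte_fin uv EFinB.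
apply: etrans (H _ _ xy) _; apply/esym.
apply: etrans (congr1 (mule s%:E) (H ((x - a) / s) ((y - a) / s) _)) _.
  by rewrite ltr_pM2r ?invr_gt0// ltrD2r.
  by rewrite -EFinM; congr EFin; field; rewrite gt_eqF.
exact: measurable_affine.
Qed.

End lebesgue_affine.

Section leb_affine.
Context {R : realType}.

Lemma measurable_affine_rV n (a : 'rV[R]_n) (s : R) :
  measurable_fun setT (fun x : 'rV[R]_n => a + s *: x).
Proof.
apply: (measurability (@open 'rV[R]_n)) => // _ [U oU <-].
rewrite setTI; apply: open_measurable_rV.
suff /continuousP : continuous (fun x : 'rV[R]_n => a + s *: x) by exact.
move=> x; apply: (@continuousD R 'rV[R]_n 'rV[R]_n (cst a) (s \*: id)).
  exact: cst_continuous.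
by apply: continuousZl_tmp => A.
Qed.

(** Induction through the iterated product: the slice at t of the preimage is the affine preimage of
    the slice at a_0 + s t, which gives the factor s^-n; the substitution in the outer integral
    gives the last s^-1. *)
Lemma leb_affine n (a : 'rV[R]_n) (s : R) (A : set 'rV[R]_n) : 0 < s -> measurable A ->
  leb ((fun x => a + s *: x) @^-1` A) = ((s^-1 ^+ n)%:E * leb A)%E.
Proof.
move=> s0; elim: n a A => [|n IH] a A mA.
  rewrite expr0 mul1e (_ : _ @^-1` _ = A)//.
  by apply/seteqP; split=> x /=; rewrite (thinmx0 x) (thinmx0 (_ + _)).
pose B := @rv_cons R n @^-1` A.
have mB : measurable B by rewrite -[B]setTI; exact: measurable_rv_cons.
have lebE (C : set 'rV[R]_n.+1) : leb C = (lebesgue_measure \x leb)%E (@rv_cons R n @^-1` C) by [].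
rewrite !lebE /product_measure1.
pose a' : 'rV[R]_n := \row_j a 0 (lift ord0 j).
pose phi (t : measurableTypeR R) := leb (xsection B t).
have mphi : measurable_fun setT phi by exact: measurable_fun_xsection.
transitivity (\int[lebesgue_measure]_t ((s^-1 ^+ n)%:E * phi (a 0%R ord0 + s * t)%R))%E.
  apply: eq_integral => t _ /=; rewrite /phi -(IH a'); last exact: measurable_xsection.
  have E y : rv_cons (a 0 ord0 + s * t, a' + s *: y) = a + s *: rv_cons (t, y).
    apply/rowP => j; rewrite [RHS]mxE [X in _ = _ + X]mxE.
    by case: (unliftP ord0 j) => [k|] ->; rewrite ?rv_consS ?rv_cons0 ?mxE//= !mxE.
  by congr leb; apply/seteqP; split=> y; rewrite /xsection/= !inE /B /= E.
have mphi' : measurable_fun setT (fun t : measurableTypeR R => phi (a 0 ord0 + s * t)).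
  exact: (measurableT_comp mphi (measurable_affine _ _)).
rewrite ge0_integralZl ?lee_fin ?exprn_ge0 ?invr_ge0 ?(ltW s0)//.
rewrite exprSr EFinM -muleA; congr (_ * _)%E.
have s'0 : 0 <= s^-1 by rewrite invr_ge0 ltW.
transitivity (\int[mscale (NngNum s'0) lebesgue_measure]_t phi t)%E.
  transitivity (\int[push_measure lebesgue_measure (measurable_affine (a 0%R ord0) s)]_t phi t)%E.
    by rewrite ge0_integral_pushforward//; exact: measurable_affine.
  apply: eq_measure_integral => C mC _.
  exact: lebesgue_measure_affine.
by rewrite ge0_integral_mscale// => t _; exact: measure_ge0.
Qed.

Lemma ge0_integral_leb_affine n (a : 'rV[R]_n) (s : R) (f : 'rV[R]_n -> \bar R) :
  0 < s -> measurable_fun setT f -> (forall x, (0 <= f x)%E) ->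
  (\int[leb]_x f (a + s *: x)%R = (s^-1 ^+ n)%:E * \int[leb]_x f x)%E.
Proof.
move=> s0 mf f0; have sn0 : 0 <= s^-1 ^+ n by rewrite exprn_ge0// invr_ge0 ltW.
transitivity (\int[push_measure leb (measurable_affine_rV a s)]_x f x)%E.
  by rewrite ge0_integral_pushforward//; exact: measurable_affine_rV.
transitivity (\int[mscale (NngNum sn0) leb]_x f x)%E.
  apply: eq_measure_integral => C mC _.
  exact: leb_affine.
by rewrite ge0_integral_mscale.
Qed.

Lemma leb_ball_gt0 n (c : 'rV[R]_n) (r : R) : 0 < r -> (0 < leb (ball c r))%E.
Proof.
move=> r0; elim: n c => [|n IH] c.
  rewrite /= diracE mem_set ?lte01//; split=> // i j; by case: j.
rewrite [X in (_ < X)%E](_ : _ = (lebesgue_measure \x leb)%E (@rv_cons R n @^-1` ball c r))//.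
rewrite rv_cons_ball// product_measure1E//=; last 2 first.
- by apply: measurable_realfun.open_measurable; exact: ball_open.
- by apply: open_measurable_rV; exact: ball_open.
rewrite mule_gt0 ?IH// [X in (_ < X)%E]lebesgue_measure_ball ?(ltW r0)//.
by rewrite lte_fin mulrn_wgt0.
Qed.

Lemma leb_ball_lty n (r : R) : (leb (ball (0%R : 'rV[R]_n) r) < +oo)%E.
Proof. by case: (@leb_spec R n). Qed.

Lemma leb_bounded_lty n (A : set 'rV[R]_n) : measurable A -> bounded_set A ->
  (leb A < +oo)%E.
Proof.
move=> mA [M [_ bA]]; apply: le_lt_trans (leb_ball_lty n (`|M| + 2)).
apply: le_measure; rewrite ?inE//; first by apply: open_measurable_rV; exact: ball_open.
move=> x Ax; rewrite -ball_normE/= sub0r normrN.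
apply: le_lt_trans (bA (`|M| + 1) _ x Ax) _; last by rewrite ltrD2l ltr1n.
by rewrite (le_lt_trans (ler_norm M))// ltrDl.
Qed.

End leb_affine.

(** * Directional derivatives out of continuous partial derivatives *)

Section directional.
Context {R : realType} {d : nat}.
Local Notation V := 'rV[R]_d.

(** [Ck] speaks of partial derivatives only, so the derivative in a general direction is built by
    adding one coordinate direction at a time. The increment h (z + t e) is split into h z, handled
    by the derivative along z, and h t e, handled by the mean value theorem and the continuity of
    the derivative along e. *)
Lemma is_derive_addv (f : V -> R) (y z e : V) (t : R) :
  derivable (f : V -> R^o) y z ->
  (forall w, derivable (f : V -> R^o) w e) ->
  {for y, continuous (fun w => 'D_e (f : V -> R^o) w)} ->
  is_derive y (z + t *: e) (f : V -> R^o) ('D_z (f : V -> R^o) y + t * 'D_e (f : V -> R^o) y).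
Proof.
move=> dz de ce.
suff H : h^-1 *: (f (h *: (z + t *: e) + y) - f y : R^o) @[h --> 0^'] -->
    'D_z (f : V -> R^o) y + t * 'D_e (f : V -> R^o) y.
  by apply: DeriveDef; [apply/cvg_ex; eexists; exact: H|exact: (cvg_lim _ H)].
have mvt h : exists c : R, 0 <= c <= 1 /\ f (h *: (z + t *: e) + y) - f (h *: z + y) =
    h * t * 'D_e (f : V -> R^o) (h *: z + y + (h * t * c) *: e).
  pose g (u : R) := f (h *: z + y + u *: e).
  have dg (c : R) : is_derive c 1 (g \o ( *%R (h * t)))
      ('D_e (f : V -> R^o) (h *: z + y + (h * t * c) *: e) * (h * t)).
    have D1 : is_derive (h * t * c) 1 g
        ('D_e (f : V -> R^o) (h *: z + y + (h * t * c) *: e)).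
      exact: is_derive_line (DeriveDef (de _) erefl).
    have D2 : is_derive c 1 ( *%R (h * t)) (h * t).
      apply: is_derive_eq (is_deriveZ (h * t) (is_derive_id c 1)) _; exact: mulr1.
    exact: is_derive1_comp D1 D2.
  have [c c01 E] := MVT01 (fun c _ => dg c).
  exists c; split=> //; move: E; rewrite /= mulr1 mulr0 /g scale0r addr0 [RHS]mulrC => <-.
  by congr (f _ - _); rewrite scalerDr scalerA addrAC.
have [c hc] := choice mvt.
apply: (@cvg_trans _ ((h^-1 *: (f (h *: z + y) - f y : R^o) +
    t * 'D_e (f : V -> R^o) (h *: z + y + (h * t * c h) *: e)) @[h --> 0^'])).
  apply: near_eq_cvg; near=> h.
  have h0 : h != 0 by near: h; exact: nbhs_dnbhs_neq.
  have [_ E] := hc h.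
  rewrite -[X in _ = _ *: (X - _)](subrK (f (h *: z + y))) E -(addrA (h * t * _)).
  rewrite [RHS]scalerDr [LHS]addrC; congr (_ + _).
  set D := 'D_e _ _; rewrite -[RHS]/(h^-1 * (h * t * D)).
  by rewrite -(mulrA h) mulKf.
apply: cvgD; first exact: dz.
apply: cvgMl_tmp.
apply: (@cvg_comp _ _ _ (fun h => h *: z + y + (h * t * c h) *: e)
  (fun w => 'D_e (f : V -> R^o) w) (0^') (nbhs y) _ _ ce).
apply/cvgrPdist_le => eps eps0; pose K := `|z| + `|t| * `|e| + 1.
have K0 : 0 < K by rewrite ltr_wpDl// addr_ge0// mulr_ge0.
near=> h; have [/andP[c0 c1] _] := hc h.
have -> : y - (h *: z + y + (h * t * c h) *: e) = - (h *: z + (h * t * c h) *: e).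
  by apply/rowP => j; rewrite !mxE; ring.
have nz : `|h *: z| = `|h| * `|z| by rewrite normrZ.
have ne : `|(h * t * c h) *: e| <= `|h| * (`|t| * `|e|).
  rewrite normrZ normrM (ger0_norm c0) normrM mulrAC -mulrA -[leRHS]mulr1.
  by rewrite mulrA (mulrA `|h|) ler_wpM2l// !mulr_ge0.
rewrite normrN; apply: le_trans (ler_normD _ _) _; rewrite nz.
apply: le_trans (lerD (lexx _) ne) _.
apply: le_trans (_ : `|h| * K <= _).
  by rewrite /K -mulrDr ler_wpM2l// lerDl.
rewrite -ler_pdivlMr//; near: h; apply: dnbhs0_le; rewrite divr_gt0//.
Unshelve. all: by end_near. Qed.

Lemma is_derive_dot (f : V -> R) (y z : V) :
  (forall w i, derivable (f : V -> R^o) w (delta_mx 0 i)) ->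
  (forall i, continuous (partial i f)) ->
  is_derive y z (f : V -> R^o) (dot (gradient f y) z).
Proof.
move=> df cf.
suff H (s : seq 'I_d) : is_derive y (\sum_(i <- s) z 0 i *: delta_mx 0 i) (f : V -> R^o)
    (\sum_(i <- s) gradient f y 0 i * z 0 i).
  by have := H (index_enum 'I_d); rewrite -row_sum_delta.
elim: s => [|i s IH].
  rewrite !big_nil; apply: DeriveDef; first exact: derivable0.
  exact: derive0.
rewrite !big_cons [_ *: _ + _]addrC [_ * _ + _]addrC [gradient f y 0 i]mxE [partial i f y * _]mulrC.
have [IH1 <-] := IH.
exact: (@is_derive_addv f y (\sum_(j <- s) z 0 j *: delta_mx 0 j) (delta_mx 0 i)
  (z 0 i) IH1 (fun w => df w i) (cf i y)).
Qed.

End directional.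

(** * Morrey's inequality *)

Section powR_bound.
Context {R : realType}.

(** k s^(1 - a) with k = C / (1 - a) is a primitive of C s^(- a), so its difference with G is
    nondecreasing on [e, 1] for every e > 0. The derivative may blow up at 0, which is reached
    through the continuity of G. *)
Lemma derive_powR_bound (G dG : R -> R) (C a : R) : 0 <= a -> a < 1 -> 0 <= C ->
  (forall s : R, 0 < s -> s <= 1 -> is_derive s 1 G (dG s)) ->
  (forall s : R, 0 < s -> s <= 1 -> dG s <= C * s `^ (- a)) ->
  {for 0, continuous G} -> G 1 - G 0 <= C / (1 - a).
Proof.
move=> a0 a1 C0 dGE dGb cG; have a1' : 0 < 1 - a by rewrite subr_gt0.
have H e : 0 < e -> e < 1 -> G 1 - G e <= C / (1 - a).
  move=> e0 e1; pose k := C / (1 - a).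
  pose F (s : R) := k * s `^ (1 - a) - G s.
  have dF (s : R) : 0 < s -> s <= 1 -> is_derive s 1 F (C * s `^ (- a) - dG s).
    move=> s0 s1; apply: is_derive_eq
      (is_deriveB (is_deriveZ k (is_derive1_powR (1 - a) s0)) (dGE _ s0 s1)) _.
    rewrite /GRing.scale/= mulrA /k divfK ?gt_eqF//.
    by congr (_ * powR _ _ - _); rewrite addrAC subrr add0r.
  have d1 (s : R) : s \in `]e, 1[%R -> is_derive s 1 F (C * s `^ (- a) - dG s).
    by rewrite in_itv/= => /andP[es s1]; apply: dF; [exact: lt_trans es|exact: ltW].
  have d2 : {within `[e, 1], continuous F}.
    apply: derivable_within_continuous => s; rewrite in_itv/= => /andP[es s1].
    by have [] := dF s (lt_le_trans e0 es) s1.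
  have [c /[!in_itv]/= /andP[ec c1]] := MVT e1 d1 d2.
  rewrite /F powR1 mulr1 => E.
  have : 0 <= (C * c `^ (- a) - dG c) * (1 - e).
    rewrite mulr_ge0 ?subr_ge0 ?(ltW e1)// dGb//; [exact: lt_trans ec|exact: ltW].
  rewrite -E -/k; have : 0 <= k * e `^ (1 - a) by rewrite mulr_ge0 ?powR_ge0// divr_ge0// ltW.
  lra.
apply/ler_addgt0Pr => eps eps0.
have /cvgrPdist_le/(_ _ eps0)/nbhs_ballP[r /= r0 hr] := cG.
pose e := Num.min (r / 2) 2^-1.
have e0 : 0 < e by rewrite lt_min divr_gt0//= invr_gt0.
have e1 : e < 1 by rewrite gt_min orbC invf_lt1// ltr1n.
have er : ball 0 r e.
  rewrite /ball/= sub0r normrN gtr0_norm// gt_min ltr_pdivrMr// ltr_pMr//.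
  by rewrite ltr1n.
have := hr _ er; rewrite ler_norml => /andP[h1 h2].
have := H _ e0 e1; lra.
Qed.

End powR_bound.

Section morrey.
Context {R : realType} {d : nat}.
Local Notation V := 'rV[R]_d.

Lemma compact_support_bounded (f : V -> R) (K : set V) :
  continuous f -> compact K -> (forall x, ~ K x -> f x = 0) ->
  exists M : R, forall x, `|f x| <= M.
Proof.
move=> cf cK fK.
have /compact_bounded[M [_ hM]] : compact (f @` K).
  by apply: continuous_compact => //; exact: continuous_subspaceT.
exists (`|M| + 1) => x; have [Kx|nKx] := pselect (K x).
  by apply: hM; [rewrite (le_lt_trans (ler_norm M))// ltrDl|exists x].
by rewrite fK// normr0 addr_ge0.
Qed.

Lemma partial_out (f : V -> R) (K : set V) i : closed K ->
  (forall x, ~ K x -> f x = 0) -> forall x, ~ K x -> partial i f x = 0.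
Proof.
move=> cK fK x nKx; rewrite /partial.
rewrite (@near_eq_derive _ _ _ _ (cst 0)); first exact: derive_cst.
have : nbhs x (~` K) by apply: open_nbhs_nbhs; split=> //; exact: closed_openC.
by apply: filterS => y /fK.
Qed.

(* From [`|g| <= s^-a (1 + `|s^a g|^r)] with [a := d / r], for which the Jacobian
   [s^-d] of the dilation is cancelled. *)
Lemma integral_dilate_le (g : V -> R) (x : V) (s r : R) :
  continuous g -> 0 < s -> 1 <= r ->
  (\int[leb]_x (`|g x| `^ r)%:E <= 1)%E ->
  (\int[leb]_(z in ball (0%R : V) 1) `|g (x + s *: z)%R|%:E <=
   (s `^ (- (d%:R / r)) * (fine (leb (ball (0%R : V) 1)) + 1))%:E)%E.
Proof.
move=> cg s0 r1 g1; set B := ball _ _; set a := d%:R / r.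
have mB : measurable B by apply: open_measurable_rV; exact: ball_open.
have mg := continuous_measurable_rV cg.
have r0 : 0 < r by rewrite (lt_le_trans _ r1).
have mgr : measurable_fun setT (fun y : V => `|g y| `^ r).
  by apply: (measurableT_comp (measurable_powR _)) => //; exact: measurableT_comp.
have mA := measurable_affine_rV x s.
have Bfin : leb B \is a fin_num by rewrite ge0_fin_numE ?leb_ball_lty.
have sd : 0 <= s ^+ d by rewrite exprn_ge0 ?ltW.
have sa0 : 0 <= s `^ (- a) by rewrite powR_ge0.
apply: (@le_trans _ _ (\int[leb]_(z in B)
    ((s `^ (- a))%:E * (1%:E + (s ^+ d)%:E * (`|g (x + s *: z)%R| `^ r)%:E)))%E).
  apply: ge0_le_integral => //.
  - apply/measurable_EFinP; apply: measurable_funTS.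
    by apply: measurableT_comp => //; exact: measurableT_comp mg mA.
  - apply/measurable_EFinP; apply: measurable_funTS.
    apply: measurable_funM => //; apply: measurable_funD => //.
    by apply: measurable_funM => //; exact: measurableT_comp mgr mA.
  - move=> z _.
    rewrite -[leRHS]/((s `^ (- a) * (1 + s ^+ d * `|g (x + s *: z)| `^ r))%:E) lee_fin.
    set y := `|g _|; have y0 : 0 <= y by exact: normr_ge0.
    have -> : s ^+ d * y `^ r = (s `^ a * y) `^ r.
      rewrite powRM ?powR_ge0// -powRrM /a divfK ?gt_eqF//.
      by rewrite powR_mulrn// ltW.
    rewrite -ler_pdivrMl ?powR_gt0// -powRN opprK.
    have t0 : 0 <= s `^ a * y by rewrite mulr_ge0// powR_ge0.
    have [t1|t1] := leP (s `^ a * y) 1.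
      by rewrite (le_trans t1)// lerDl powR_ge0.
    rewrite ler_wpDl// -[leLHS]powRr1//.
    by rewrite ler_powR// ltW.
rewrite ge0_integralZl//; last 2 first.
- apply/measurable_EFinP; apply: measurable_funTS.
  apply: measurable_funD => //.
  by apply: measurable_funM => //; exact: measurableT_comp mgr mA.
- by move=> z _; rewrite lee_fin addr_ge0// mulr_ge0// powR_ge0.
rewrite EFinM lee_pmul2l ?lte_fin ?powR_gt0//.
rewrite ge0_integralD//; last 2 first.
- by move=> z _; rewrite -EFinM lee_fin mulr_ge0// powR_ge0.
- apply/measurable_EFinP; apply: measurable_funTS.
  by apply: measurable_funM => //; exact: measurableT_comp mgr mA.
rewrite integral_cst// mul1e EFinD fineK// leeD2l//.
rewrite ge0_integralZl//; last first.
  by apply/measurable_EFinP; apply: measurable_funTS; exact: measurableT_comp mgr mA.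
apply: (@le_trans _ _ ((s ^+ d)%:E * ((s^-1 ^+ d)%:E * \int[leb]_x (`|g x| `^ r)%:E)))%E.
  apply: lee_wpmul2l; first by rewrite lee_fin.
  rewrite -(ge0_integral_leb_affine x s0 (f := fun y => (`|g y| `^ r)%:E)); last 2 first.
  - exact/measurable_EFinP.
  - by move=> z; rewrite lee_fin powR_ge0.
  apply: ge0_subset_integral => //.
  by apply/measurable_EFinP; exact: measurableT_comp mgr mA.
by rewrite muleA -EFinM -exprMn mulfV ?gt_eqF// expr1n mul1e.
Qed.

(* The integral [G s] of [z |-> phi (x + s z)] over the unit ball satisfies
   [`|G' s| = O(s^(- d / r))], which is integrable at 0 since [d < r]. *)
Lemma morrey_normalized (phi : V -> R) (K : set V) (r : R) (x : V) :
  d%:R < r -> 1 <= r -> continuous phi ->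
  (forall w i, derivable (phi : V -> R^o) w (delta_mx 0 i)) ->
  (forall i, continuous (partial i phi)) ->
  compact K -> (forall x, ~ K x -> phi x = 0) ->
  (\int[leb]_x (`|phi x| `^ r)%:E <= 1)%E ->
  (forall i, (\int[leb]_x (`|partial i phi x| `^ r)%:E <= 1)%E) ->
  `|phi x| <= (fine (leb (ball (0%R : V) 1)) + 1) * (1 + d%:R / (1 - d%:R / r)) /
    fine (leb (ball (0%R : V) 1)).
Proof.
move=> dr r1 cphi dphi cdphi cK phiK iphi idphi; set M := fine _.
have r0 : 0 < r by rewrite (lt_le_trans _ r1).
set a := d%:R / r; set B : set V := ball 0 1 in M *.
have mB : measurable B by apply: open_measurable_rV; exact: ball_open.
have Bfin : leb B \is a fin_num by rewrite ge0_fin_numE ?leb_ball_lty.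
have M0 : 0 < M.
  by rewrite fine_gt0// -ge0_fin_numE ?measure_ge0// Bfin leb_ball_gt0.
have a0 : 0 <= a by rewrite divr_ge0// ltW.
have a1 : a < 1 by rewrite ltr_pdivrMr// mul1r.
pose f (s : R) (z : V) := phi (x + s *: z).
have df (s : R) (z : V) : is_derive s 1 (f ^~ z) (dot (gradient phi (x + s *: z)) z).
  by apply: is_derive_line; exact: is_derive_dot.
have d1E (s : R) (z : V) : partial1of2 f s z = dot (gradient phi (x + s *: z)) z.
  by rewrite partial1of2E; have [_ ->] := df s z.
have /choice[N hN] i : exists N : R, forall y, `|partial i phi y| <= N.
  apply: (compact_support_bounded (cdphi i) cK); apply: partial_out => //.
  exact: compact_closed.
have [N0 hN0] := compact_support_bounded cphi cK phiK.
have N_ge0 i : 0 <= N i by rewrite (le_trans _ (hN i 0)).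
have N0_ge0 : 0 <= N0 by rewrite (le_trans _ (hN0 0)).
have dotB (s : R) (z : V) : B z -> `|dot (gradient phi (x + s *: z)) z| <=
    \sum_i `|partial i phi (x + s *: z)|.
  rewrite /B -ball_normE/= sub0r normrN => z1.
  apply: le_trans (ler_norm_sum _ _ _) _; apply: ler_sum => i _.
  rewrite normrM mxE ler_piMr//.
  by rewrite (le_trans (coord_le_mxnorm z i))// ltW.
have mf (s : R) : measurable_fun setT (f s).
  by apply: measurableT_comp (continuous_measurable_rV cphi) (measurable_affine_rV x s).
have intf (s : R) : leb.-integrable B (EFin \o f s).
  apply: measurable_bounded_integrable => //.
  - exact: leb_ball_lty.
  - exact: measurable_funTS.
  - by exists N0; split; [exact: num_real|move=> y /ltW Ny z _; exact: le_trans (hN0 _) _].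
have intc (k : R) : leb.-integrable B (EFin \o cst k).
  apply: measurable_bounded_integrable => //.
  - exact: leb_ball_lty.
  - by exists `|k|; split; [exact: num_real|move=> y /ltW Ny z _].
have dGb (s : R) (z : V) : B z -> `|partial1of2 f s z| <= \sum_i N i.
  move=> Bz; rewrite d1E; apply: le_trans (dotB _ _ Bz) _.
  by apply: ler_sum => i _; exact: hN.
pose G s := \int[leb]_(z in B) f s z.
pose dG s := \int[leb]_(z in B) partial1of2 f s z.
(* The interval ]-1, 2[ has 0 and 1 in its interior, which gives continuity of [G] at 0 and a
   two-sided derivative up to 1. The constant sum of the [N i] dominates the derivative; it serves
   differentiability only and does not enter the final bound. *)
have GdG (s : R) : -1 < s -> s < 2 -> is_derive s 1 G (dG s).
  move=> s1 s2.
  have Is : (`]-1, 2[%classic : set R) s by rewrite /= in_itv/= s1 s2.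
  have der (t : R) (z : V) : (`]-1, 2[%classic : set R) t -> B z -> derivable (f^~ z) t 1.
    by move=> _ _; have [] := df t z.
  have G0 (z : V) : 0 <= cst (\sum_i N i) z by exact: sumr_ge0.
  have Gub (t : R) (z : V) (_ : (`]-1, 2[%classic : set R) t) (Bz : B z) := dGb t z Bz.
  apply: DeriveDef.
    exact: (derivable_under_integral mB Is (fun t _ => intf t) der G0 (intc _) Gub).
  rewrite -derive1E.
  exact: (differentiation_under_integral mB Is (fun t _ => intf t) der G0 (intc _) Gub).
have mpart i (s : R) : measurable_fun setT (fun z : V => `|partial i phi (x + s *: z)|).
  apply: measurableT_comp => //.
  exact: measurableT_comp (continuous_measurable_rV (cdphi i)) (measurable_affine_rV x s).
(* The coordinates of z are at most 1 in absolute value on the unit ball of the sup norm, so each of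
   the d partial derivatives contributes at most (M + 1) s^(- a). *)
have dGle (s : R) : 0 < s -> s <= 1 -> `|dG s| <= (d%:R * (M + 1)) * s `^ (- a).
  move=> s0 s1.
  have mdf : measurable_fun B (partial1of2 f s).
    rewrite (_ : partial1of2 f s = fun z => \sum_i partial i phi (x + s *: z) * z 0 i); last first.
      by apply/funext => z; rewrite d1E; apply: eq_bigr => i _; rewrite mxE.
    apply: measurable_funTS; apply: measurable_sum => i; apply: measurable_funM.
      exact: measurableT_comp (continuous_measurable_rV (cdphi i)) (measurable_affine_rV x s).
    by apply: continuous_measurable_rV; exact: coord_continuous.
  have intdf : leb.-integrable B (EFin \o partial1of2 f s).
    apply: measurable_bounded_integrable => //.
    - exact: leb_ball_lty.
    - exists (\sum_i N i); split; [exact: num_real|move=> y /ltW Ny z Bz].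
      exact: le_trans (dGb _ _ Bz) _.
  rewrite -lee_fin EFin_normr_Rintegral//.
  apply: le_trans (le_abse_integral _ _ _) _ => //; first exact/measurable_EFinP.
  apply: (@le_trans _ _ (\int[leb]_(z in B) \sum_i `|partial i phi (x + s *: z)%R|%:E)%E).
    apply: ge0_le_integral => //.
    - by apply/measurable_EFinP; exact: measurableT_comp.
    - apply: emeasurable_sum => i; apply/measurable_EFinP; exact: measurable_funTS.
    - by move=> z Bz; rewrite /= d1E sumEFin lee_fin dotB.
  rewrite ge0_integral_sum//; last by move=> i; apply/measurable_EFinP; exact: measurable_funTS.
  apply: (@le_trans _ _ (\sum_(i < d) (s `^ (- a) * (M + 1))%:E)%E).
    apply: lee_sum => i _; exact: integral_dilate_le.
  by rewrite sumEFin lee_fin sumr_const card_ord -[leRHS]mulrA mulr_natl [(M + 1) * _]mulrC.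
have cG : {for 0, continuous G}.
  apply/differentiable_continuous/derivable1_diffP.
  by have [] := GdG 0 ltac:(lra) ltac:(lra).
have C0 : 0 <= d%:R * (M + 1) by rewrite mulr_ge0// addr_ge0// ltW.
have GdG' (s : R) : 0 < s -> s <= 1 -> is_derive s 1 G (dG s).
  by move=> s0 s1; apply: GdG; lra.
have H1 : G 1 - G 0 <= d%:R * (M + 1) / (1 - a).
  apply: (derive_powR_bound a0 a1 C0 GdG') => // s s0 s1.
  by rewrite (le_trans (ler_norm _))// dGle.
have H2 : (- G) 1 - (- G) 0 <= d%:R * (M + 1) / (1 - a).
  apply: (derive_powR_bound a0 a1 C0 (dG := - dG)) => // [s s0 s1|s s0 s1|].
  - by apply: is_deriveN; exact: GdG'.
  - by rewrite (le_trans (ler_norm _))// normrN dGle.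
  - exact: continuousN.
(* At s = 0 the integrand is constant, at s = 1 it is controlled by the L^r bound. The claim is |phi
   x| M <= |G 1| + |G 1 - G 0| divided by M. *)
have G0 : G 0 = phi x * M.
  rewrite /G /f; under eq_Rintegral do rewrite scale0r addr0.
  exact: Rintegral_cst.
have G1 : `|G 1| <= M + 1.
  rewrite -lee_fin EFin_normr_Rintegral//.
  apply: le_trans (le_abse_integral _ _ _) _ => //.
    by apply/measurable_EFinP; exact: measurable_funTS.
  apply: le_trans (integral_dilate_le x cphi ltr01 r1 iphi) _.
  by rewrite powR1 mul1r.
rewrite ler_pdivlMr// -[M in _ * M <= _]gtr0_norm// -normrM -G0.
move: H1 H2 G1; rewrite !fctE /= ler_norml => H1 H2 /andP[G1 G1'].
rewrite ler_norml mulrDr mulr1 mulrA [X in X / (1 - a)]mulrC; apply/andP; split; lra.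
Qed.

End morrey.

(** * Sobolev spaces *)

Section Lnorm_extra.
Context d (T : measurableType d) (R : realType) (mu : {measure set T -> \bar R}).

Lemma LfunP_measurable (f : T -> R) (p : \bar R) :
  f \in Lfun mu p <-> measurable_fun setT f /\ ('N[mu]_p[EFin \o f] < +oo)%E.
Proof.
split=> [/andP[mf ff]|[mf ff]]; last by apply/andP; split; rewrite inE.
by split; [move: mf|move: ff]; rewrite inE.
Qed.

Lemma Lnorm_scale (f : T -> R) (a r : R) : measurable_fun setT f -> 0 < r ->
  ('N[mu]_r%:E[EFin \o (fun x => a * f x)%R] = `|a|%:E * 'N[mu]_r%:E[EFin \o f])%E.
Proof.
move=> mf r0; rewrite unlock.
under eq_integral do rewrite /= normrM powRM// EFinM.
rewrite ge0_integralZl//; last first.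
  apply/measurable_EFinP; apply: (measurableT_comp (measurable_powR _)) => //.
  exact: measurableT_comp.
rewrite poweRM ?lee_fin ?powR_ge0//; last by apply: integral_ge0 => x _; rewrite lee_fin powR_ge0.
by rewrite poweR_EFin -powRrM mulfV ?gt_eqF// powRr1.
Qed.

Lemma Lnorm_le (f g : T -> R) (r : R) : measurable_fun setT f -> measurable_fun setT g ->
  0 < r -> (forall x, `|f x| <= `|g x|) ->
  ('N[mu]_r%:E[EFin \o f] <= 'N[mu]_r%:E[EFin \o g])%E.
Proof.
move=> mf mg r0 fg; rewrite unlock; apply: gt0_ler_poweR.
- by rewrite invr_ge0 ltW.
- by rewrite in_itv/= leey andbT integral_ge0// => x _; rewrite lee_fin powR_ge0.
- by rewrite in_itv/= leey andbT integral_ge0// => x _; rewrite lee_fin powR_ge0.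
have mp (k : T -> R) : measurable_fun setT k ->
    measurable_fun setT (fun x => (`|k x| `^ r)%:E).
  move=> mk; apply/measurable_EFinP; apply: (measurableT_comp (measurable_powR _)) => //.
  exact: measurableT_comp.
apply: ge0_le_integral => //.
- by move=> x _; rewrite lee_fin powR_ge0.
- exact: mp.
- exact: mp.
- by move=> x _; rewrite lee_fin ge0_ler_powR// ltW.
Qed.

End Lnorm_extra.

Section test_functions.
Context {R : realType} {d : nat}.
Local Notation V := 'rV[R]_d.
Variable Omega : set V.

Lemma continuous_lin (f g : V -> R) (a : R) : continuous f -> continuous g ->
  continuous (fun x => a * f x + g x).
Proof.
move=> cf cg x.
apply: (@continuousD R R^o V (a \*: (f : V -> R^o)) g x); last exact: cg.
by apply: continuousZl_tmp; exact: cf.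
Qed.

Lemma partial_lin (f g : V -> R) (a : R) i x :
  derivable (f : V -> R^o) x (delta_mx 0 i) -> derivable (g : V -> R^o) x (delta_mx 0 i) ->
  is_derive x (delta_mx 0 i) ((fun y => a * f y + g y) : V -> R^o)
    (a * partial i f x + partial i g x).
Proof.
move=> df dg; have d1 := DeriveDef df erefl; have d2 := DeriveDef dg erefl.
exact: (is_deriveD (is_deriveZ a d1) d2).
Qed.

Lemma Ck_lin k (f g : V -> R) (a : R) : Ck k f -> Ck k g ->
  Ck k (fun x => a * f x + g x).
Proof.
elim: k f g => [|k IH] f g; first exact: continuous_lin.
move=> [cf df pf] [cg dg pg]; split.
- exact: continuous_lin.
- by move=> x i; have [] := partial_lin a (df x i) (dg x i).
- move=> i; rewrite (_ : partial i _ = fun x => a * partial i f x + partial i g x).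
    exact: (IH _ _ (pf i) (pg i)).
  by apply/funext => x; have [_] := partial_lin a (df x i) (dg x i).
Qed.

Lemma test_function_lin (f g : V -> R) (a : R) :
  test_function Omega f -> test_function Omega g ->
  test_function Omega (fun x => a * f x + g x) /\
  gradient (fun x => a * f x + g x) = (fun x => a *: gradient f x + gradient g x).
Proof.
move=> [Cf [K [cK KO fK]]] [Cg [L [cL LO gL]]]; split.
  split; first by move=> k; exact: Ck_lin.
  exists (K `|` L); split.
  - exact: compactU.
  - by move=> x [/KO|/LO].
  - by move=> x /not_orP[/fK -> /gL ->]; rewrite mulr0 addr0.
have [_ df _] := Cf 1%N; have [_ dg _] := Cg 1%N.
apply/funext => x; apply/rowP => i; rewrite !mxE.
by have [_] := partial_lin a (df x i) (dg x i).
Qed.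

Lemma test_function_partial (f : V -> R) i :
  test_function Omega f -> test_function Omega (partial i f).
Proof.
move=> [Cf [K [cK KO fK]]]; split; first by move=> k; have [_ _ pf] := Cf k.+1; exact: pf.
exists K; split=> //; apply: partial_out => //; exact: compact_closed.
Qed.

Lemma test_function_bounded (f : V -> R) :
  test_function Omega f -> exists M : R, forall x, `|f x| <= M.
Proof.
by move=> [Cf [K [cK KO fK]]]; apply: compact_support_bounded cK fK; exact: (Cf 0%N).
Qed.

Lemma test_function_measurable (f : V -> R) :
  test_function Omega f -> measurable_fun setT f.
Proof. by move=> [Cf _]; apply: continuous_measurable_rV; exact: (Cf 0%N). Qed.

Lemma patch_test_function (f : V -> R) : test_function Omega f ->
  patch (fun=> 0) Omega f = f.
Proof.
move=> [_ [K [_ KO fK]]]; apply/funext => x; rewrite /patch; case: ifPn => // /negP xO.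
by rewrite fK// => /KO Ox; apply: xO; exact: mem_set.
Qed.

End test_functions.

Section sobolev_norm_theory.
Context {R : realType} {d : nat}.
Local Notation V := 'rV[R]_d.
Local Notation W := (sobolev R d).
Variables (Omega : set V) (r : R).
Hypothesis r1 : 1 <= r.
Implicit Types (y z v : W) (a : R).

Let r0 : 0 < r. Proof. exact: lt_le_trans r1. Qed.
Local Notation ext f := (patch (fun=> 0) Omega (f) : V -> R).
Local Notation N := (sobolev_norm Omega r%:E).

Definition sobolev_measurable y : Prop := measurable_fun setT (ext y.1) /\
  forall i, measurable_fun setT (ext (fun x => y.2 x 0 i)).

Definition test_sobolev (f : V -> R) : W := ((f : V -> R^o), gradient f).

Lemma ext_lin1 a y z : ext (a *: y + z).1 = fun x => a * ext y.1 x + ext z.1 x.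
Proof. by apply/funext => x; rewrite /patch; case: ifP => //; rewrite mulr0 addr0. Qed.

Lemma ext_lin2 a y z i : ext (fun x => (a *: y + z).2 x 0 i) =
  fun x => a * ext (fun x => y.2 x 0 i) x + ext (fun x => z.2 x 0 i) x.
Proof.
apply/funext => x; rewrite /patch; case: ifP => _; last by rewrite mulr0 addr0.
by rewrite /= !mxE.
Qed.

Lemma sobolev_measurable_lin a y z : sobolev_measurable y -> sobolev_measurable z ->
  sobolev_measurable (a *: y + z).
Proof.
move=> [y1 y2] [z1 z2]; split; first by rewrite ext_lin1; apply: measurable_funD => //; exact: measurable_funM.
by move=> i; rewrite ext_lin2; apply: measurable_funD => //; exact: measurable_funM.
Qed.

Lemma sobolev_norm_ge0 y : (0 <= N y)%E.
Proof. by rewrite adde_ge0 ?Lnorm_ge0// sume_ge0// => i _; exact: Lnorm_ge0. Qed.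

Lemma sobolev_norm_lin a y z : sobolev_measurable y -> sobolev_measurable z ->
  (N (a *: y + z)%R <= `|a|%:E * N y + N z)%E.
Proof.
move=> [y1 y2] [z1 z2].
have H (f g : V -> R) : measurable_fun setT f -> measurable_fun setT g ->
    ('N[leb]_r%:E[EFin \o (fun x => (a * f x + g x)%R)] <=
     `|a|%:E * 'N[leb]_r%:E[EFin \o f] + 'N[leb]_r%:E[EFin \o g])%E.
  move=> mf mg; rewrite -Lnorm_scale//.
  apply: (@eminkowski _ _ _ leb (fun x => a * f x) g r%:E) => //.
  exact: measurable_funM.
rewrite /sobolev_norm ext_lin1.
under eq_bigr do rewrite ext_lin2.
apply: le_trans (leeD (H _ _ y1 z1) (lee_sum _ (fun i _ => H _ _ (y2 i) (z2 i)))) _.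
rewrite big_split/= -ge0_sume_distrr; last by move=> i _; exact: Lnorm_ge0.
rewrite ge0_muleDr ?Lnorm_ge0 ?sume_ge0// => [|i _]; last exact: Lnorm_ge0.
by rewrite addeACA.
Qed.

Lemma sobolev_normB y z : sobolev_measurable y -> sobolev_measurable z ->
  (N (y - z)%R <= N y + N z)%E.
Proof.
move=> my mz; have -> : y - z = (-1) *: z + y by rewrite scaleN1r addrC.
by rewrite (le_trans (sobolev_norm_lin _ mz my))// normrN1 mul1e addeC.
Qed.

Lemma W1_measurable y : W1 Omega r%:E y -> sobolev_measurable y.
Proof.
by move=> [/LfunP_measurable[y1 _] y2 _]; split=> // i; have /LfunP_measurable[] := y2 i.
Qed.

Lemma W1_norm_lty y : W1 Omega r%:E y -> (N y < +oo)%E.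
Proof.
move=> [/LfunP_measurable[_ y1] y2 _]; rewrite lte_add_pinfty//.
by apply: lte_sum_pinfty => i _; have /LfunP_measurable[] := y2 i.
Qed.

Lemma test_sobolev_measurable f : test_function Omega f -> sobolev_measurable (test_sobolev f).
Proof.
move=> tf; split=> [|i] /=.
  rewrite patch_test_function//; exact: test_function_measurable tf.
have tp := test_function_partial i tf.
have -> : (fun x => gradient f x 0 i) = partial i f by apply/funext => x; rewrite mxE.
by rewrite patch_test_function//; exact: test_function_measurable tp.
Qed.

Lemma test_sobolev_lin a f g : test_function Omega f -> test_function Omega g ->
  a *: test_sobolev f + test_sobolev g = test_sobolev (fun x => a * f x + g x).
Proof. by move=> tf tg; rewrite /test_sobolev (test_function_lin a tf tg).2. Qed.

Definition morrey_constant : R :=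
  (fine (leb (ball (0%R : V) 1)) + 1) * (1 + d%:R / (1 - d%:R / r)) /
    fine (leb (ball (0%R : V) 1)).

Lemma morrey_constant_ge0 : d%:R < r -> 0 <= morrey_constant.
Proof.
move=> dr; rewrite divr_ge0 ?fine_ge0 ?measure_ge0// mulr_ge0//.
  by rewrite addr_ge0// fine_ge0 ?measure_ge0.
by rewrite addr_ge0// divr_ge0// subr_ge0 ler_pdivrMr// mul1r ltW.
Qed.

(* Homogeneity: apply the normalized inequality to [f / t] for [t > N f]. *)
Lemma morrey_test f x : d%:R < r -> test_function Omega f ->
  (`|f x|%:E <= morrey_constant%:E * N (test_sobolev f))%E.
Proof.
move=> dr tf; have C0 := morrey_constant_ge0 dr.
have Nfe : N (test_sobolev f) =
    ('N[leb]_r%:E[EFin \o f] + \sum_(i < d) 'N[leb]_r%:E[EFin \o partial i f])%E.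
  rewrite /sobolev_norm/= patch_test_function//; congr (_ + _)%E.
  apply: eq_bigr => i _.
  have -> : (fun x => gradient f x 0 i) = partial i f by apply/funext => y; rewrite mxE.
  by rewrite patch_test_function//; exact: test_function_partial.
have N0 := sobolev_norm_ge0 (test_sobolev f).
have C1 : 0 < morrey_constant.
  rewrite divr_gt0 ?mulr_gt0//.
  - by rewrite ltr_wpDl// fine_ge0 ?measure_ge0.
  - by rewrite ltr_pwDl// divr_ge0// subr_ge0 ler_pdivrMr// mul1r ltW.
  - by rewrite fine_gt0// leb_ball_gt0//= leb_ball_lty.
have [Noo|] := eqVneq (N (test_sobolev f)) +oo%E.
  by rewrite Noo gt0_muley ?leey.
move=> Nf; have {}Nf : N (test_sobolev f) \is a fin_num.
  by rewrite ge0_fin_numE// lt_neqAle Nf leey.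
have main (t : R) : (N (test_sobolev f) < t%:E)%E -> `|f x| <= morrey_constant * t.
  move=> Nt; have t0 : 0 < t by rewrite -lte_fin (le_lt_trans N0).
  have le1 (g : V -> R) : measurable_fun setT g ->
      ('N[leb]_r%:E[EFin \o g] <= N (test_sobolev f))%E ->
      (\int[leb]_x (`|t^-1 * g x| `^ r)%:E <= 1)%E.
    move=> mg gN.
    rewrite [leLHS](_ : _ = ('N[leb]_r%:E[EFin \o (fun x => t^-1 * g x)%R] `^ r)%E); last first.
      by rewrite powR_Lnorm ?gt_eqF//; apply: eq_integral => y _.
    rewrite Lnorm_scale// gtr0_norm ?invr_gt0//.
    have [s sE] : exists s : R, 'N[leb]_r%:E[EFin \o g]%E = s%:E.
      exists (fine 'N[leb]_r%:E[EFin \o g]%E); rewrite fineK// ge0_fin_numE ?Lnorm_ge0//.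
      by rewrite (le_lt_trans gN)// (lt_trans Nt)// ltry.
    have s0 : 0 <= s by rewrite -lee_fin -sE Lnorm_ge0.
    have st : s < t by rewrite -lte_fin -sE (le_lt_trans gN).
    rewrite sE -EFinM poweR_EFin lee_fin.
    apply: (@le_trans _ _ (1 `^ r)); last by rewrite powR1.
    rewrite ge0_ler_powR ?nnegrE ?(ltW r0)//.
      by rewrite mulr_ge0// invr_ge0 ltW.
    by rewrite ler_pdivrMl// mulr1 ltW.
  have [Cf [K [cK KO fK]]] := tf; have [cf df pf] := Cf 1%N.
  pose g (y : V) := t^-1 * f y + 0 * f y.
  have gE : g = fun y : V => t^-1 * f y by apply/funext => y; rewrite /g mul0r addr0.
  have cZ (k : V -> R) : continuous k -> continuous (fun y : V => t^-1 * k y).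
    move=> ck; rewrite (_ : (fun y : V => _) = fun y : V => t^-1 * k y + cst 0 y).
      by apply: continuous_lin => //; exact: cst_continuous.
    by apply/funext => y; rewrite addr0.
  have pg i : partial i g = fun y : V => t^-1 * partial i f y.
    apply/funext => y; rewrite /partial gE.
    by have [_ ->] := is_deriveZ t^-1 (DeriveDef (df y i) erefl).
  have : `|g x| <= morrey_constant.
    apply: (morrey_normalized (K := K)) => //.
    - by rewrite gE; exact: cZ.
    - by move=> w i; rewrite gE; have [] := is_deriveZ t^-1 (DeriveDef (df w i) erefl).
    - by move=> i; rewrite pg; exact: cZ.
    - by move=> y /fK fy0; rewrite gE fy0 mulr0.
    - rewrite gE; apply: le1; first exact: test_function_measurable tf.
      by rewrite Nfe leeDl// sume_ge0// => i _; exact: Lnorm_ge0.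
    - move=> i; rewrite pg; apply: le1.
        exact: test_function_measurable (test_function_partial i tf).
      rewrite Nfe (bigD1 i)//= addeCA leeDl// adde_ge0 ?Lnorm_ge0// sume_ge0// => j _.
      exact: Lnorm_ge0.
  rewrite gE normrM gtr0_norm ?invr_gt0// ler_pdivrMl// => /le_trans; apply.
  by rewrite mulrC.
rewrite -(fineK Nf) -EFinM lee_fin; apply/ler_addgt0Pr => e e0.
(* [main] requires t strictly above the norm; exceeding it by e divided by the constant costs
   exactly e. *)
apply: le_trans (main (fine (N (test_sobolev f)) + e / morrey_constant) _) _.
  by rewrite -{1}(fineK Nf) lte_fin ltrDl divr_gt0.
by rewrite mulrDr mulrCA divff ?gt_eqF// mulr1.
Qed.

End sobolev_norm_theory.

Section W1_theory.
Context {R : realType} {d : nat}.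
Local Notation V := 'rV[R]_d.
Local Notation W := (sobolev R d).
Variables (Omega : set V).
Hypotheses (mO : measurable Omega) (Ofin : (leb Omega < +oo)%E).
Implicit Types (y z v : W) (a r : R).
Local Notation ext f := (patch (fun=> 0) Omega (f) : V -> R).

Lemma ext_integrable (f : V -> R) :
  leb.-integrable setT (EFin \o ext f) -> leb.-integrable Omega (EFin \o f).
Proof.
move=> /integrableS-/(_ _ measurableT mO (@subsetT _ _)); apply: eq_integrable => // x xO.
by rewrite /= /patch xO.
Qed.

(** On a set of finite measure, 1 + |f|^r is integrable and dominates |f|. *)
Lemma Lfun_ext_integrable (f : V -> R) r : 1 <= r ->
  ext f \in Lfun leb r%:E -> leb.-integrable Omega (EFin \o f).
Proof.
move=> r1 fr; have [mf _] := (LfunP_measurable _ _ _).1 fr.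
have r0 : 0 < r by exact: lt_le_trans r1.
have mfO : measurable_fun Omega f.
  apply: (eq_measurable_fun (ext f)); last exact: measurable_funTS.
  by move=> x xO; rewrite /patch xO.
have i1 : leb.-integrable Omega (EFin \o cst (1 : R)).
  apply: measurable_bounded_integrable => //.
  by exists 1; split=> [|e /ltW e1 x _]; [exact: num_real|rewrite /= normr1].
have i2 : leb.-integrable Omega (fun x => (`|ext f x| `^ r)%:E).
  by apply: integrableS (Lfun_integrable r1 fr).
apply: le_integrable (integrableD mO i1 i2) => //; first exact/measurable_EFinP.
move=> x Ox; rewrite /= lee_fin /patch mem_set//.
rewrite [leRHS]ger0_norm ?addr_ge0 ?powR_ge0//.
have [f1|f1] := leP `|f x| 1; first by rewrite (le_trans f1)// lerDl powR_ge0.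
rewrite ler_wpDl// -[leLHS]powRr1// ler_powR//; exact: ltW.
Qed.

(** The integrals defining the weak gradient can be split because L^r functions are integrable on
    [Omega] while test functions and their partial derivatives are bounded. *)
Lemma W1_lin a r y z : 1 <= r -> W1 Omega r%:E y -> W1 Omega r%:E z ->
  W1 Omega r%:E (a *: y + z).
Proof.
move=> r1 [y1 y2 wy] [z1 z2 wz].
have L (f g : V -> R) : f \in Lfun leb r%:E -> g \in Lfun leb r%:E ->
    (fun x => a * f x + g x) \in Lfun leb r%:E.
  move=> Lf Lg; have r1E : (1 <= r%:E)%E by rewrite lee_fin.
  have [mf Nf] := (LfunP_measurable _ _ _).1 Lf; have [mg Ng] := (LfunP_measurable _ _ _).1 Lg.
  have maf : measurable_fun setT (fun x => a * f x) by exact: measurable_funM.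
  apply/LfunP_measurable; split; first exact: measurable_funD.
  apply: le_lt_trans (@eminkowski _ _ _ leb _ _ r%:E maf mg r1E) _.
  rewrite Lnorm_scale ?(lt_le_trans _ r1)// lte_add_pinfty// lte_mul_pinfty//.
split; first by rewrite ext_lin1; exact: L.
  by move=> i; rewrite ext_lin2; exact: L.
move=> phi i tphi.
have [M hM] := test_function_bounded tphi.
have [M' hM'] := test_function_bounded (test_function_partial i tphi).
have bd (f g : V -> R) (N : R) : ext f \in Lfun leb r%:E -> (forall x, `|g x| <= N) ->
    measurable_fun setT g -> leb.-integrable Omega (EFin \o (fun x => f x * g x)).
  move=> Lf gN mg.
  have -> : EFin \o (fun x => f x * g x) = ((EFin \o f) \* (EFin \o g))%E.
    by apply/funext => x; rewrite /= EFinM.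
  apply: integrableMl => //.
  - exact: (Lfun_ext_integrable r1).
  - exact: measurable_funTS.
  - by exists N; split=> [|e /ltW Ne x _]; [exact: num_real|exact: le_trans (gN x) _].
have mp := test_function_measurable tphi.
have mpi := test_function_measurable (test_function_partial i tphi).
have I1 := bd _ _ _ y1 hM' mpi; have I2 := bd _ _ _ z1 hM' mpi.
have I3 := bd _ _ _ (y2 i) hM mp; have I4 := bd _ _ _ (z2 i) hM mp.
have key (f1 f2 g : V -> R) (h : V -> R) :
    leb.-integrable Omega (EFin \o (fun x => f1 x * g x)) ->
    leb.-integrable Omega (EFin \o (fun x => f2 x * g x)) ->
    (forall x, h x = a * f1 x + f2 x) ->
    \int[leb]_(x in Omega) (h x * g x) =
    a * \int[leb]_(x in Omega) (f1 x * g x) + \int[leb]_(x in Omega) (f2 x * g x).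
  move=> i1 i2 hE; rewrite -RintegralZl// -RintegralD//.
    by apply: eq_Rintegral => x _; rewrite hE mulrDl mulrA.
  by rewrite /comp; under eq_fun do rewrite EFinM; exact: integrableZl.
rewrite (key _ _ _ _ I1 I2)// (key _ _ _ _ I3 I4); last by move=> x; rewrite !mxE.
by rewrite (wy phi i tphi) (wz phi i tphi) opprD mulrN.
Qed.

Lemma pairing_integrable (p q : R) y v : 0 < p -> 0 < q -> p^-1 + q^-1 = 1 ->
  W1 Omega p%:E y -> W1 Omega q%:E v ->
  leb.-integrable Omega (EFin \o (fun x => dot (y.2 x) (v.2 x))).
Proof.
move=> p0 q0 pq [_ y2 _] [_ v2 _].
rewrite (_ : EFin \o _ = fun x => (\sum_(i < d) (y.2 x 0%R i * v.2 x 0%R i)%:E)%E); last first.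
  by apply/funext => x; rewrite sumEFin.
apply: integrable_sum => // i _; apply: ext_integrable.
have [my Ny] := (LfunP_measurable _ _ _).1 (y2 i).
have [mv Nv] := (LfunP_measurable _ _ _).1 (v2 i).
apply/Lfun1_integrable/LfunP_measurable.
have -> : ext (fun x => y.2 x 0 i * v.2 x 0 i) =
    ext (fun x => y.2 x 0 i) \* ext (fun x => v.2 x 0 i).
  by apply/funext => x; rewrite /= /patch; case: ifP => //; rewrite mulr0.
split; first exact: measurable_funM.
apply: le_lt_trans (hoelder leb my mv p0 q0 pq) _.
by rewrite lte_mul_pinfty ?Lnorm_ge0// ge0_fin_numE ?Lnorm_ge0.
Qed.

Lemma pairing_linl (p q : R) a y z v : 1 <= p -> 0 < q -> p^-1 + q^-1 = 1 ->
  W1 Omega p%:E y -> W1 Omega p%:E z -> W1 Omega q%:E v ->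
  \int[leb]_(x in Omega) dot ((a *: y + z).2 x) (v.2 x) =
  a * \int[leb]_(x in Omega) dot (y.2 x) (v.2 x) +
  \int[leb]_(x in Omega) dot (z.2 x) (v.2 x).
Proof.
move=> p1 q0 pq Wy Wz Wv; have p0 : 0 < p by exact: lt_le_trans p1.
have I1 := pairing_integrable p0 q0 pq Wy Wv.
have I2 := pairing_integrable p0 q0 pq Wz Wv.
rewrite -RintegralZl// -RintegralD//.
  by apply: eq_Rintegral => x _; rewrite -dotZl -dotDl.
by rewrite /comp; under eq_fun do rewrite EFinM; exact: integrableZl.
Qed.

End W1_theory.

(** * Continuous representatives of elements of [W10] *)

Section embedding.
Context {R : realType} {d : nat}.
Local Notation V := 'rV[R]_d.
Local Notation W := (sobolev R d).
Variables (Omega : set V) (r : R).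
Hypotheses (r1 : 1 <= r) (dr : d%:R < r) (oO : open Omega) (bO : bounded_set Omega).
Implicit Types (y z v : W) (a : R).

Let r0 : 0 < r. Proof. exact: lt_le_trans r1. Qed.
Local Notation ext f := (patch (fun=> 0) Omega (f) : V -> R).
Local Notation N := (sobolev_norm Omega r%:E).
Local Notation C := (@morrey_constant R d r).

Let C0 : 0 <= C. Proof. exact: morrey_constant_ge0. Qed.

Let mO : measurable Omega. Proof. exact: open_measurable_rV. Qed.

Let Ofin : (leb Omega < +oo)%E. Proof. exact: leb_bounded_lty. Qed.

(** If they differed at a point of [Omega], they would differ on a ball contained in [Omega], and
    balls have positive measure. *)
Lemma ae_eq_continuous (f g : V -> R) : continuous f -> continuous g ->
  {ae leb, forall x, Omega x -> f x = g x} -> forall x, Omega x -> f x = g x.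
Proof.
move=> cf cg [A [mA A0 sub]] x Ox; apply/eqP; rewrite -subr_eq0; apply/negPn/negP => fg.
pose k (y : V) := - 1 * g y + f y; have ck : continuous k by exact: continuous_lin.
have kE (y : V) : k y = f y - g y by rewrite /k mulN1r addrC.
have oU : open (Omega `&` k @^-1` (~` [set 0])).
  apply: openI => //; move/continuousP : ck; apply.
  exact/closed_openC/closed_eq.
have /nbhs_ballP[e /= e0 eU] : nbhs x (Omega `&` k @^-1` (~` [set 0])).
  by apply: open_nbhs_nbhs; split=> //; split=> //=; rewrite kE; exact/eqP.
have : (0 < leb A)%E.
  apply: lt_le_trans (leb_ball_gt0 x e0) _; apply: le_measure; rewrite ?inE//.
    by apply: open_measurable_rV; exact: ball_open.
  move=> y /eU[Oy /= ky]; apply: sub => /= /(_ Oy) fgy.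
  by apply: ky; rewrite kE fgy subrr.
by rewrite A0 ltxx.
Qed.

(** By Morrey's inequality, test functions converging to [v] in the Sobolev norm are uniformly
    Cauchy. Their uniform limit inherits continuity, vanishing outside [Omega] and the sup bound. *)
Lemma sobolev_embedding v : W10 Omega r%:E v -> exists w : V -> R,
  [/\ continuous w, forall x, ~ Omega x -> w x = 0,
      {ae leb, forall x, Omega x -> w x = v.1 x}
    & forall x, (`|w x|%:E <= C%:E * N v)%E].
Proof.
have mt f x : test_function Omega f -> (`|f x|%:E <= C%:E * N (test_sobolev f))%E.
  exact: morrey_test.
move: C C0 mt => k k0 mt.
move=> [W1v apx]; have mv := W1_measurable W1v.
have Nv : N v \is a fin_num by rewrite ge0_fin_numE ?sobolev_norm_ge0//; exact: W1_norm_lty.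
have /choice[phi hphi] (n : nat) : exists phi : V -> R, test_function Omega phi /\
    (N (v - test_sobolev phi)%R < (n.+1%:R^-1)%:E)%E.
  by apply: apx; rewrite invr_gt0.
have tphi n : test_function Omega (phi n) by have [] := hphi n.
have mphi n : sobolev_measurable Omega (test_sobolev (phi n)).
  exact: test_sobolev_measurable.
have mvphi n : sobolev_measurable Omega (v - test_sobolev (phi n)).
  by rewrite addrC -scaleN1r; exact: sobolev_measurable_lin.
have D n m x : `|phi n x - phi m x| <= k * n.+1%:R^-1 + k * m.+1%:R^-1.
  have [tD _] := test_function_lin (-1) (tphi m) (tphi n).
  have := mt _ x tD; rewrite -(test_sobolev_lin (Omega := Omega))//.
  rewrite mulN1r [- _ + _]addrC -lee_fin => /le_trans; apply.
  rewrite -mulrDr EFinM.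
  apply: lee_wpmul2l; first by rewrite lee_fin.
  have -> : -1 *: test_sobolev (phi m) + test_sobolev (phi n) =
      (v - test_sobolev (phi m)) - (v - test_sobolev (phi n)).
    by rewrite scaleN1r opprB [RHS]addrC subrKA addrC.
  apply: le_trans (sobolev_normB r1 (mvphi m) (mvphi n)) _.
  by rewrite addeC EFinD leeD// ltW//; have [] := hphi n; have [] := hphi m.
pose ep (n : nat) := k * n.+1%:R^-1.
have {}D n m x : `|phi n x - phi m x| <= ep n + ep m by exact: D.
pose S x := [set phi n x + ep n | n in [set: nat]].
(* By [D] every phi m - ep m lies below every phi n + ep n. The infimum thus lies in all intervals
   [phi n - ep n, phi n + ep n], which is uniform convergence with an explicit rate. *)
pose w x := inf (S x).
have Slb x n : lbound (S x) (phi n x - ep n).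
  by move=> _ [m _ <-]; have := D n m x; rewrite ler_norml => /andP[_]; lra.
have S0 x : S x !=set0 by exists (phi 0%N x + ep 0%N), 0%N.
have wphi n x : `|w x - phi n x| <= ep n.
  rewrite ler_norml; apply/andP; split.
    have := lb_le_inf (S0 x) (Slb x n); rewrite -/(w x); lra.
  have : w x <= phi n x + ep n.
    by apply: ge_inf; [exists (phi n x - ep n); exact: Slb|exists n].
  lra.
have cphi n : continuous (phi n) by have [Cf _] := tphi n; exact: (Cf 0%N).
have small (c e : R) : 0 <= c -> 0 < e -> exists n : nat, c * n.+1%:R^-1 <= e.
  move=> c0 e0; exists (Num.truncn (c / e)); rewrite ler_pdivrMr// mulrC -ler_pdivrMr//.
  by apply/ltW; exact: truncnS_gt.
have cw : continuous w.
  move=> x; apply: (proj2 (@cvgrPdist_le _ R^o _ (nbhs (x : V)) _ w (w x))) => e e0.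
  have [n hn] : exists n, ep n <= e / 3 by apply: small => //; lra.
  have := (proj1 (@cvgrPdist_le _ R^o _ (nbhs (x : V)) _ (phi n) (phi n x)) (cphi n x)).
  have e3 : 0 < e / 3 by lra.
  move=> /(_ _ _ e3); apply: filterS => y hy.
  have := wphi n x; have := wphi n y; move: hy; rewrite !ler_norml.
  move=> /andP[? ?] /andP[? ?] /andP[? ?]; apply/andP; split; lra.
have w0 x : ~ Omega x -> w x = 0.
  move=> nOx; apply/eqP; rewrite -normr_le0; apply/ler_addgt0Pr => e e0.
  have [n hn] : exists n, ep n <= e by apply: small.
  rewrite add0r (le_trans _ hn)//.
  have := wphi n x; have [_ [K [_ KO fK]]] := tphi n.
  by rewrite fK ?subr0// => /KO.
exists w; split=> //; last first.
  move=> x; rewrite -(fineK Nv) -EFinM lee_fin; apply/ler_addgt0Pr => e e0.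
  have [n hn] : exists n, ep n <= e / 2 by apply: small => //; lra.
  have N2 : (N (test_sobolev (phi n)) <= (fine (N v) + n.+1%:R^-1)%:E)%E.
    have -> : test_sobolev (phi n) = v - (v - test_sobolev (phi n)) by rewrite subKr.
    apply: le_trans (sobolev_normB r1 mv (mvphi n)) _.
    by rewrite EFinD fineK// leeD2l// ltW//; have [] := hphi n.
  have := le_trans (mt _ x (tphi n)) (lee_wpmul2l _ N2).
  rewrite -EFinM !lee_fin => /(_ k0); have := wphi n x; rewrite mulrDr -/(ep n).
  have := ler_normD (w x - phi n x) (phi n x); rewrite subrK.
  move: hn; lra.
have [mv1 _] := mv.
have mw := continuous_measurable_rV cw.
(* Its L^r norm is shown to be 0: w - phi n is at most [ep n] times the indicator of [Omega], which
   has finite norm [K], and phi n - v is controlled by the Sobolev norm. *)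
pose f x := w x + (-1) * ext v.1 x.
have mf : measurable_fun setT f by apply: measurable_funD => //; exact: measurable_funM.
pose K := 'N[leb]_r%:E[EFin \o (\1_Omega : V -> R)]%E.
have Kfin : K \is a fin_num.
  rewrite ge0_fin_numE ?Lnorm_ge0// /K unlock poweR_lty//.
  under eq_integral => x _.
    rewrite /= indicE [X in (X%:E)%E](_ : _ = \1_Omega x); last first.
      rewrite indicE; case: (x \in Omega); first by rewrite normr1 powR1.
      by rewrite normr0 powR0// gt_eqF.
    over.
  by rewrite integral_indic// setIT.
have bound n : ('N[leb]_r%:E[EFin \o f] <= (n.+1%:R^-1 * (k * fine K + 1))%:E)%E.
  pose f1 x := w x - phi n x.
  pose f2 x := phi n x + (-1) * ext v.1 x.
  have mf1 : measurable_fun setT f1.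
    apply: measurable_funB => //; exact: test_function_measurable (tphi n).
  have mf2 : measurable_fun setT f2.
    apply: measurable_funD; first exact: test_function_measurable (tphi n).
    exact: measurable_funM.
  have -> : f = f1 \+ f2 by apply/funext => x; rewrite /f /f1 /f2/= addrA subrK.
  apply: le_trans (@eminkowski _ _ _ leb f1 f2 r%:E mf1 mf2 _) _ => //.
  rewrite mulrDr mulr1 EFinD; apply: leeD.
    rewrite mulrA [_ * k]mulrC EFinM fineK// -[X in (X%:E * K)%E]ger0_norm; last first.
      by rewrite mulr_ge0.
    rewrite -Lnorm_scale//; apply: Lnorm_le => //; first exact: measurable_funM.
    move=> x; rewrite normrM ger0_norm ?mulr_ge0// /f1 indicE.
    have [xO|/negP xO] := boolP (x \in Omega); first by rewrite normr1 mulr1 wphi.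
    have nOx : ~ Omega x by move=> Ox; apply: xO; exact: mem_set.
    have [_ [L [_ LO fL]]] := tphi n.
    by rewrite w0// fL ?subrr ?normr0 ?mulr0// => /LO.
  have [_ /ltW] := hphi n; apply: le_trans.
  apply: (@le_trans _ _ ('N[leb]_r%:E[EFin \o ext (v - test_sobolev (phi n))%R.1])%E); last first.
    by rewrite leeDl// sume_ge0// => i _; exact: Lnorm_ge0.
  apply: Lnorm_le => //; first by have [] := mvphi n.
  move=> x; rewrite /f2 /patch; case: ifPn => [_|/negP xO].
    by rewrite mulN1r distrC.
  have [_ [L [_ LO fL]]] := tphi n.
  by rewrite fL ?mulr0 ?addr0// => /LO Ox; apply: xO; exact: mem_set.
have Nf0 : 'N[leb]_r%:E[EFin \o f]%E = 0%E.
  apply/eqP; rewrite eq_le Lnorm_ge0 andbT; apply/lee_addgt0Pr => e e0.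
  have K0 : 0 <= k * fine K + 1 by rewrite addr_ge0// mulr_ge0// fine_ge0// Lnorm_ge0.
  have [n hn] := small _ e K0 e0; rewrite add0e (le_trans (bound n))// lee_fin mulrC.
  exact: hn.
have := Lnorm_eq0_eq0 (proj2 (measurable_EFinP _ _) mf) _ Nf0.
rewrite lte_fin => /(_ r0); apply: filterS => x /(_ I) [].
rewrite /f /patch => fx Ox; move: fx; rewrite mem_set// mulN1r => /eqP.
by rewrite subr_eq0 => /eqP.
Qed.

(** [C0_rep] is an arbitrary choice, so the sup bound has to be carried over from the limit built in
    [sobolev_embedding]; two continuous representatives agree on [Omega]. *)
Lemma C0_repP v : W10 Omega r%:E v ->
  [/\ continuous (C0_rep Omega v), forall x, ~ Omega x -> C0_rep Omega v x = 0,
      {ae leb, forall x, Omega x -> C0_rep Omega v x = v.1 x}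
    & forall x, (`|C0_rep Omega v x|%:E <= C%:E * N v)%E].
Proof.
move=> Wv; have [w [w1 w2 w3 w4]] := sobolev_embedding Wv.
have [c1 c2 c3] : [set w : V -> R | [/\ continuous w, forall x, ~ Omega x -> w x = 0
    & {ae leb, forall x, Omega x -> w x = v.1 x}]] (C0_rep Omega v).
  by apply: xgetPex; exists w.
split=> // x; suff -> : C0_rep Omega v x = w x by [].
have [Ox|nOx] := pselect (Omega x); last by rewrite c2// w2.
apply: ae_eq_continuous Ox => //; apply: filterS2 c3 w3 => y h1 h2 Oy.
by rewrite h1// h2.
Qed.

Lemma W10_lin a y z : W10 Omega r%:E y -> W10 Omega r%:E z ->
  W10 Omega r%:E (a *: y + z).
Proof.
move=> [W1y apy] [W1z apz]; split; first exact: (W1_lin mO Ofin a r1 W1y W1z).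
move=> e e0; have a0 : 0 < `|a| + 1 by rewrite ltr_wpDl.
have [f [tf hf]] := apy (e / 2 / (`|a| + 1)) ltac:(by rewrite !divr_gt0).
have [g [tg hg]] := apz (e / 2) ltac:(by rewrite divr_gt0).
exists (fun x => a * f x + g x); split; first exact: (test_function_lin a tf tg).1.
rewrite -[X in _ - X]/(test_sobolev (fun x => a * f x + g x)).
rewrite -(test_sobolev_lin (Omega := Omega))//.
have -> : a *: y + z - (a *: test_sobolev f + test_sobolev g) =
    a *: (y - test_sobolev f) + (z - test_sobolev g).
  by rewrite scalerBr opprD addrACA.
have mB (u : W) (k : V -> R) : W1 Omega r%:E u -> test_function Omega k ->
    sobolev_measurable Omega (u - test_sobolev k).
  move=> W1u tk; rewrite addrC -scaleN1r; apply: sobolev_measurable_lin.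
    exact: test_sobolev_measurable.
  exact: W1_measurable W1u.
apply: le_lt_trans (sobolev_norm_lin r1 a (mB _ _ W1y tf) (mB _ _ W1z tg)) _.
rewrite [e]splitr EFinD; apply: lee_ltD => //.
- by rewrite ge0_fin_numE ?mule_ge0 ?sobolev_norm_ge0// lte_mul_pinfty// (lt_trans hf)// ltry.
- apply: le_trans (lee_wpmul2l _ (ltW hf)) _ => //.
  rewrite -EFinM lee_fin mulrA ler_pdivrMr// mulrC ler_wpM2l ?divr_ge0 ?(ltW e0)//.
  by rewrite lerDl.
Qed.

(** The choices made for y, z and a y + z are unrelated; uniqueness of the continuous representative
    reconciles them. *)
Lemma C0_rep_lin a y z : W10 Omega r%:E y -> W10 Omega r%:E z ->
  forall x, C0_rep Omega (a *: y + z) x = a * C0_rep Omega y x + C0_rep Omega z x.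
Proof.
move=> Wy Wz x; have [y1 y2 y3 _] := C0_repP Wy; have [z1 z2 z3 _] := C0_repP Wz.
have [c1 c2 c3 _] := C0_repP (W10_lin a Wy Wz).
have [Ox|nOx] := pselect (Omega x); last by rewrite c2// y2// z2// mulr0 addr0.
apply: (ae_eq_continuous (g := fun x => a * C0_rep Omega y x + C0_rep Omega z x)) Ox => //.
  exact: continuous_lin.
apply: filterS3 c3 y3 z3 => u h1 h2 h3 Ou.
by rewrite h1// h2// h3.
Qed.

End embedding.

(** * Measures and charges *)

Section finite_measures.
Context {dT} {T : measurableType dT} {R : realType}.
Implicit Types (m : {finite_measure set T -> \bar R}) (D : set T) (f : T -> R).

Section finite_of_measure.
Variables (m : {measure set T -> \bar R}) (mfin : (m setT < +oo)%E).

(** The proof of finiteness is an argument so that the structure instance attached to this constant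
    can recover it. *)
Definition finite_of_measure of (m setT < +oo)%E : set T -> \bar R := m.

HB.instance Definition _ := Measure.copy (finite_of_measure mfin) m.

Let finite_of_measure_fin : fin_num_fun (finite_of_measure mfin).
Proof.
move=> U mU; rewrite ge0_fin_numE ?measure_ge0//.
by apply: le_lt_trans mfin; apply: le_measure; rewrite ?inE.
Qed.

HB.instance Definition _ := @Measure_isFinite.Build _ _ _
  (finite_of_measure mfin) finite_of_measure_fin.
End finite_of_measure.

Lemma finite_measureT m : (m setT < +oo)%E.
Proof. by rewrite ltey_eq fin_num_measure. Qed.

Section mixture.
Variables (a b : {nonneg R}) (m1 m2 : {finite_measure set T -> \bar R}).

Let mixture_fin : (measure_add (mscale a m1) (mscale b m2) setT < +oo)%E.
Proof.
by rewrite measure_addE /mscale lte_add_pinfty// lte_mul_pinfty// finite_measureT.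
Qed.

Definition mixture : {finite_measure set T -> \bar R} := finite_of_measure mixture_fin.

Lemma mixtureE A : mixture A = (a%:num%:E * m1 A + b%:num%:E * m2 A)%E.
Proof. exact: measure_addE. Qed.
End mixture.

Lemma bounded_integrable m D f (M : R) : measurable D -> measurable_fun D f ->
  (forall x, D x -> `|f x| <= M) -> m.-integrable D (EFin \o f).
Proof.
move=> mD mf fM; apply: measurable_bounded_integrable => //.
  by rewrite ltey_eq fin_num_measure.
by exists M; split=> [|e /ltW Me x Dx]; [exact: num_real|exact: le_trans (fM _ Dx) _].
Qed.

Lemma Rintegral_mscale (k : {nonneg R}) (m : {measure set T -> \bar R}) D f :
  measurable D -> m.-integrable D (EFin \o f) ->
  \int[mscale k m]_(x in D) f x = k%:num * \int[m]_(x in D) f x.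
Proof.
move=> mD i; have mf := measurable_int _ i.
rewrite /Rintegral integralE !ge0_integral_mscale//; last 2 first.
- exact: measurable_funeneg.
- exact: measurable_funepos.
rewrite -muleBr; last 2 first.
- by [].
- by rewrite fin_num_adde_defl// fin_numN integrable_neg_fin_num.
by rewrite -integralE fineM// integrable_fin_num.
Qed.

Lemma Rintegral_mixture (a b : {nonneg R}) m1 m2 D f (M : R) : measurable D ->
  measurable_fun D f -> (forall x, D x -> `|f x| <= M) ->
  \int[mixture a b m1 m2]_(x in D) f x =
  a%:num * \int[m1]_(x in D) f x + b%:num * \int[m2]_(x in D) f x.
Proof.
move=> mD mf fM.
have i1 := bounded_integrable m1 mD mf fM; have i2 := bounded_integrable m2 mD mf fM.
have sc (k : {nonneg R}) m : (mscale k m setT < +oo)%E.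
  by rewrite /mscale lte_mul_pinfty// finite_measureT.
have j1 : (mscale a m1).-integrable D (EFin \o f).
  exact: (bounded_integrable (finite_of_measure (sc a m1)) mD mf fM).
have j2 : (mscale b m2).-integrable D (EFin \o f).
  exact: (bounded_integrable (finite_of_measure (sc b m2)) mD mf fM).
rewrite -Rintegral_mscale// -Rintegral_mscale// /Rintegral -fineD.
- by congr fine; apply: integral_measure_add => //; exact/measurable_EFinP.
- exact: integrable_fin_num.
- exact: integrable_fin_num.
Qed.

Lemma eq_measure_Rintegral (m1 m2 : {measure set T -> \bar R}) D f :
  (forall A, measurable A -> m1 A = m2 A) ->
  \int[m1]_(x in D) f x = \int[m2]_(x in D) f x.
Proof.
by move=> h; congr fine; apply: eq_measure_integral => A mA _; exact: h.
Qed.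

Lemma Rintegral_le_cst m D f (M : R) : measurable D ->
  measurable_fun D f -> (forall x, D x -> `|f x| <= M) ->
  `|\int[m]_(x in D) f x| <= M * fine (m D).
Proof.
move=> mD mf fM; have i := bounded_integrable m mD mf fM.
apply: le_trans (le_normr_Rintegral mD i) _; rewrite -Rintegral_cst//.
apply: le_Rintegral => //.
  by apply: (bounded_integrable (M := M) m mD) => [|x Dx]; [exact: measurableT_comp|rewrite normr_id fM].
by apply: (bounded_integrable (M := `|M|) m mD) => // x Dx.
Qed.

End finite_measures.

Section charge_measure.
Context {dT} {T : measurableType dT} {R : realType}.
Implicit Types (u : {charge set T -> \bar R}) (m : {finite_measure set T -> \bar R}).

(** On the negative Hahn set [u] is both nonpositive and equal to a measure, so the negative Jordan
    part vanishes and the positive one is [m]. *)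
Lemma charge_integral_measure u m (X : set T) (f : T -> R) :
  (forall A, measurable A -> u A = m A) ->
  charge_integral u X f = \int[m]_(x in X) f x.
Proof.
move=> um; rewrite /charge_integral.
have neg0 A : measurable A -> jordan_neg (hahn u) A = 0%E.
  move=> mA; apply/eqP; rewrite eq_le measure_ge0 andbT.
  rewrite jordan_negE cjordan_negE /crestr0 mem_set// /crestr leeNl oppe0.
  case: (hahn u) => _ [mN _] _ _.
  by rewrite um ?measure_ge0//; exact: measurableI.
have pos A : measurable A -> jordan_pos (hahn u) A = m A.
  move=> mA; rewrite -um// (jordan_decomp (hahn u))// /cadd/= cscaleN1.
  by rewrite [X in (_ - X)%E](neg0 _ mA) sube0.
rewrite (eq_measure_Rintegral X f pos) [X in _ - X](_ : _ = 0) ?subr0//.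
rewrite (@eq_measure_Rintegral _ _ _ _ mzero) => [|A mA]; last exact: neg0.
by rewrite /Rintegral integral_measure_zero.
Qed.

(** Applied to the perturbation t (T#u0 - ubar), which must enter a given norm neighbourhood;
    linearity in t is what matters. *)
Lemma tv_norm_le u m1 m2 (t : R) : 0 <= t ->
  (forall A, measurable A -> u A = (t%:E * (m1 A - m2 A))%E) ->
  (tv_norm u <= (t * (fine (m1 setT) + fine (m2 setT)))%:E)%E.
Proof.
move=> t0 um; rewrite /tv_norm /charge_variation jordan_posE cjordan_posE jordan_negE cjordan_negE.
rewrite /crestr0 mem_set// /crestr !setTI.
case: (hahn u) => -[mP _] [mN _] _ _.
have uR A : measurable A -> u A = (t * (fine (m1 A) - fine (m2 A)))%:E.
  by move=> mA; rewrite um// EFinM EFinB !fineK// fin_num_measure.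
have le m A : measurable A -> 0 <= fine (m A) <= fine (m setT).
  move=> mA; rewrite fine_ge0//= fine_le ?fin_num_measure//.
  by apply: le_measure => //; rewrite inE.
move: (sval _).1 (sval _).2 mP mN => P N mP mN.
rewrite (uR _ mP) (uR _ mN) -EFinB lee_fin -mulrBr ler_wpM2l//.
have := le m1 _ mP; have := le m2 _ mN; have := le m1 _ mN; have := le m2 _ mP.
lra.
Qed.

End charge_measure.

(** * The state equation *)

(** From a / (a - 1) > d >= 2 follows a < 2 <= d, hence q < pOmega. Conjugation reverses order, so
    q' < pOmega gives pOmega' < q. The value q = +oo is excluded since its conjugate is 1. *)
Lemma conjugate_exponents {R : realType} (d : nat) (q pOmega : \bar R) :
  (2 <= d)%N -> (d%:R%:E < pOmega)%E -> (1 < q)%E ->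
  (d%:R%:E < hoelder_conjugate q)%E -> (hoelder_conjugate q < pOmega)%E ->
  exists a r : R, [/\ q = a%:E, hoelder_conjugate q = r%:E, 1 <= a & d%:R < r] /\
    [/\ 1 <= r, a^-1 + r^-1 = 1, (hoelder_conjugate pOmega < q)%E & (q < pOmega)%E].
Proof.
move=> d2; have d2R : 2 <= d%:R :> R by rewrite (ler_nat _ 2).
have key (a : R) : 1 < a -> d%:R < a / (a - 1) ->
    [/\ 1 <= a, a < 2, 1 <= a / (a - 1), a^-1 + (a / (a - 1))^-1 = 1 &
      forall b : R, d%:R < b -> a / (a - 1) < b -> b / (b - 1) < a].
  move=> a1; set r := a / (a - 1) => dr.
  have a0 : a != 0 by apply/eqP => ?; lra.
  have am1 : a - 1 != 0 by apply/eqP => ?; lra.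
  have rE : r * (a - 1) = a by rewrite /r divfK.
  split; [lra|nra|lra| |].
    by rewrite /r invf_div -{1}div1r -mulrDl addrC subrK divff.
  move=> b db rb; rewrite ltr_pdivrMr; last by lra.
  nra.
case: q => [a| |]//; last first.
  rewrite hoelder_conjugatey lte_fin => _ _ h _.
  by exfalso; lra.
have cE (x : R) : 1 < x -> hoelder_conjugate x%:E = (x / (x - 1))%:E.
  move=> x1; rewrite /hoelder_conjugate/= eqe (gt_eqF (lt_trans ltr01 x1)).
  by rewrite -EFinB inver subr_eq0 (gt_eqF x1) -EFinM.
move=> dp; rewrite lte_fin => a1; rewrite cE// lte_fin => dr rp.
have [k1 k2 k3 k4 k5] := key _ a1 dr.
exists a, (a / (a - 1)); split; first by split.
split=> //; last first.
  by apply: le_lt_trans dp; rewrite lee_fin (le_trans (ltW k2)).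
case: pOmega dp rp => [b| |]// dp rp.
move: dp rp; rewrite !lte_fin => db rb; rewrite cE ?lte_fin ?k5//.
by rewrite (lt_trans _ db)// (lt_le_trans _ d2R)// ltr1n.
Qed.

Section state_theory.
Context {R : realType} {d : nat}.
Local Notation V := 'rV[R]_d.
Local Notation W := (sobolev R d).
Variables (Omega X : set V) (a r : R).
Hypotheses (a1 : 1 <= a) (r1 : 1 <= r) (dr : d%:R < r) (ar : a^-1 + r^-1 = 1).
Hypotheses (aE : hoelder_conjugate a%:E = r%:E).
Hypotheses (oO : open Omega) (bO : bounded_set Omega) (mX : measurable X).
Implicit Types (y z v : W) (m : {finite_measure set V -> \bar R}) (F G : W -> R).

Let mO : measurable Omega. Proof. exact: open_measurable_rV. Qed.
Let a0 : 0 < a. Proof. exact: lt_le_trans a1. Qed.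
Let r0 : 0 < r. Proof. exact: lt_le_trans r1. Qed.
Let Ofin : (leb Omega < +oo)%E. Proof. exact: leb_bounded_lty. Qed.
Local Notation Phi m := (fun v => \int[m]_(x in X) C0_rep Omega v x).

Lemma C0_rep_measurable v : W10 Omega r%:E v -> measurable_fun X (C0_rep Omega v).
Proof.
move=> Wv; have [cv _ _ _] := C0_repP r1 dr oO bO Wv.
by apply: measurable_funTS; exact: continuous_measurable_rV.
Qed.

Lemma C0_rep_bounded v : W10 Omega r%:E v -> forall x,
  `|C0_rep Omega v x| <= morrey_constant (d := d) r * fine (sobolev_norm Omega r%:E v).
Proof.
move=> Wv x; have [_ _ _ /(_ x)] := C0_repP r1 dr oO bO Wv.
have Nv : sobolev_norm Omega r%:E v \is a fin_num.
  rewrite ge0_fin_numE ?sobolev_norm_ge0//.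
  by apply: W1_norm_lty; case: Wv.
by rewrite -{1}(fineK Nv) -EFinM lee_fin.
Qed.

(** This functional is E^* m; its boundedness is the sup bound of the embedding times the mass of
    [m]. *)
Lemma C0_measure_dual m : W10_dual Omega r%:E (Phi m).
Proof.
split=> [s y z Wy Wz|].
  have iy := bounded_integrable m mX (C0_rep_measurable Wy) (fun x _ => C0_rep_bounded Wy x).
  have iz := bounded_integrable m mX (C0_rep_measurable Wz) (fun x _ => C0_rep_bounded Wz x).
  rewrite -RintegralZl// -RintegralD//.
    by apply: eq_Rintegral => x _; exact: (C0_rep_lin r1 dr oO bO).
  by rewrite /comp; under eq_fun do rewrite EFinM; exact: integrableZl.
exists (fine (m X) * morrey_constant (d := d) r) => v Wv.
have Nv : sobolev_norm Omega r%:E v \is a fin_num.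
  rewrite ge0_fin_numE ?sobolev_norm_ge0//.
  by apply: W1_norm_lty; case: Wv.
rewrite -(fineK Nv) -EFinM lee_fin mulrC mulrCA mulrA [_ * morrey_constant _]mulrC.
rewrite (le_trans (Rintegral_le_cst m mX (C0_rep_measurable Wv) (fun x _ => C0_rep_bounded Wv x)))//=.
by rewrite mulrAC mulrA.
Qed.

Lemma weak_poisson_lin s F G y z : weak_poisson Omega a%:E F y ->
  weak_poisson Omega a%:E G z ->
  weak_poisson Omega a%:E (fun v => s * F v + G v) (s *: y + z).
Proof.
move=> [Wy hy] [Wz hz]; split; first exact: W10_lin.
move=> v Wv; rewrite -hy// -hz//; move: Wv; rewrite aE => Wv.
by apply: (pairing_linl mO s a1 r0 ar); [case: Wy|case: Wz|case: Wv].
Qed.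

(** [poisson_uniquely_solvable] compares solutions with one distinguished solution x only; y and z
    are compared through x. *)
Lemma weak_poisson_unique F y z : poisson_uniquely_solvable Omega a%:E ->
  W10_dual Omega r%:E F -> weak_poisson Omega a%:E F y ->
  weak_poisson Omega a%:E F z -> sobolev_norm Omega a%:E (z - y) = 0%E.
Proof.
rewrite /poisson_uniquely_solvable aE => PS /PS[x [[W1x _] _] hx] hy hz.
have mx := W1_measurable W1x.
have my : sobolev_measurable Omega y by apply: W1_measurable; case: hy => [[]]; eauto.
have mz : sobolev_measurable Omega z by apply: W1_measurable; case: hz => [[]]; eauto.
have mB u : sobolev_measurable Omega u -> sobolev_measurable Omega (u - x).
  by move=> mu; rewrite addrC -scaleN1r; exact: sobolev_measurable_lin.
apply/eqP; rewrite eq_le sobolev_norm_ge0 andbT.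
have -> : z - y = (z - x) - (y - x) by rewrite opprB addrA subrK.
by rewrite (le_trans (sobolev_normB a1 (mB _ mz) (mB _ my)))// hx// hx// adde0.
Qed.

(** [state] picks some solution; solvability for the functional of [m] ensures that there is one to
    pick. *)
Lemma state_weak_poisson (u : {charge set V -> \bar R}) m :
  poisson_uniquely_solvable Omega a%:E ->
  (forall A, measurable A -> u A = m A) ->
  weak_poisson Omega a%:E (Phi m) (state Omega X a%:E u).
Proof.
rewrite /poisson_uniquely_solvable aE => PS um; rewrite /state.
rewrite (_ : (fun v => _) = Phi m); last first.
  by apply/funext => v; exact: charge_integral_measure.
have [y hy _] := PS _ (C0_measure_dual m).
by apply: (xgetPex _ (ex_intro _ y hy)).
Qed.

(** [J] is a function of representatives. Continuity forces it to identify those at distance 0. *)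
Lemma W10_continuous_eq (J : W -> R) y z : W10_continuous Omega a%:E J ->
  W10 Omega a%:E y -> W10 Omega a%:E z ->
  sobolev_norm Omega a%:E (z - y) = 0%E -> J z = J y.
Proof.
move=> cJ Wy Wz zy; apply/eqP; rewrite -subr_eq0 -normr_le0; apply/ler_addgt0Pr => e e0.
have [delta d0 /(_ _ Wz)] := cJ _ Wy _ e0.
by rewrite zy lte_fin add0r => /(_ d0)/ltW.
Qed.

End state_theory.

(** * Transport cost and first-order condition *)

Section transport_cost.
Context {R : realType} {d : nat}.
Local Notation V := 'rV[R]_d.
Variables (omega0 omega1 : set V) (c : V * V -> R) (M : R) (u0 : {finite_measure set V -> \bar R}).
Local Notation X := (omega0 `*` omega1).
Hypotheses (mX : measurable X) (mc : measurable_fun X c) (cM : forall z, X z -> `|c z| <= M).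
Implicit Types pi : {finite_measure set (V * V)%type -> \bar R}.

Lemma transport_cost_Rintegral pi :
  transport_cost omega0 omega1 c pi = (\int[pi]_(z in X) c z)%:E.
Proof.
rewrite /transport_cost /Rintegral fineK//; apply: integrable_fin_num => //.
exact: (bounded_integrable pi mX mc cM).
Qed.

(** The first marginal fixes the mass of a plan, so a bounded cost makes the infimum finite from
    below. The near-optimal plans obtained here replace a minimizer. *)
Lemma Dc_real (u : set V -> \bar R) : (Dc omega0 omega1 c u0 u < +oo)%E ->
  exists D : R, [/\ Dc omega0 omega1 c u0 u = D%:E,
    forall pi, transport_plan omega0 omega1 u0 u pi -> D <= \int[pi]_(z in X) c z
    & forall e : R, 0 < e -> exists2 pi, transport_plan omega0 omega1 u0 u pi &
        \int[pi]_(z in X) c z < D + e].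
Proof.
move=> Doo.
have lb pi : transport_plan omega0 omega1 u0 u pi ->
    - (`|M| * fine (u0 setT)) <= \int[pi]_(z in X) c z.
  move=> [_ p0 _]; rewrite lerNl; apply: le_trans (ler_norm _) _; rewrite normrN.
  apply: le_trans (Rintegral_le_cst pi mX mc (fun z Xz => le_trans (cM Xz) (ler_norm M))) _.
  rewrite ler_wpM2l// fine_le ?fin_num_measure// -p0// /pushforward preimage_setT.
  by apply: le_measure => //; rewrite inE.
have Dfin : Dc omega0 omega1 c u0 u \is a fin_num.
  rewrite fin_real// Doo andbT.
  apply: (@lt_le_trans _ _ (- (`|M| * fine (u0 setT)))%:E); first exact: ltNyr.
  by apply: le_ereal_inf_tmp => _ [pi hpi <-]; rewrite transport_cost_Rintegral lee_fin lb.
exists (fine (Dc omega0 omega1 c u0 u)); rewrite fineK//; split=> // [pi hpi|e e0].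
  rewrite -lee_fin fineK// -transport_cost_Rintegral; apply: ereal_inf_lbound.
  by exists pi.
have [_ [pi hpi <-]] := lb_ereal_inf_adherent e0 Dfin.
rewrite transport_cost_Rintegral => h; exists pi => //.
by move: h; rewrite -[ereal_inf _]/(Dc omega0 omega1 c u0 u) -(fineK Dfin) -EFinD lte_fin.
Qed.

End transport_cost.

Section first_order.
Context {R : realType} {d : nat}.
Local Notation V := 'rV[R]_d.
Local Notation W := (sobolev R d).
Variables (Omega omega0 omega1 : set V) (u0 : {finite_measure set V -> \bar R}).
Variables (c : V * V -> R) (M alpha a r : R) (J : W -> R) (dJ : W -> W -> R).
Variables (ubar : {charge set V -> \bar R}) (p : W).
Hypotheses (a1 : 1 <= a) (r1 : 1 <= r) (dr : d%:R < r) (ar : a^-1 + r^-1 = 1).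
Hypotheses (aE : hoelder_conjugate a%:E = r%:E).
Hypotheses (oO : open Omega) (bO : bounded_set Omega).
Hypotheses (m0 : measurable omega0) (m1 : measurable omega1).
Local Notation X := (omega0 `*` omega1).
Hypotheses (mc : measurable_fun X c) (cM : forall z, X z -> `|c z| <= M).
Hypotheses (alpha0 : 0 < alpha) (PS : poisson_uniquely_solvable Omega a%:E).
Hypotheses (cJ : W10_continuous Omega a%:E J).
Hypotheses (gJ : forall y, W10 Omega a%:E y -> is_gateaux Omega a%:E J y (dJ y)).
Hypotheses (opt : locally_optimal Omega omega0 omega1 u0 c alpha a%:E J ubar).
Hypotheses (hp : weak_poisson Omega r%:E (dJ (state Omega omega1 a%:E ubar)) p).

Let mO : measurable Omega. Proof. exact: open_measurable_rV. Qed.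
Let mX : measurable X. Proof. exact: measurableX. Qed.
Let r0 : 0 < r. Proof. exact: lt_le_trans r1. Qed.

Lemma transport_plan_mixture (s t : {nonneg R}) (u v w : set V -> \bar R) pi1 pi2 :
  s%:num + t%:num = 1 ->
  (forall A, measurable A -> w A = (s%:num%:E * u A + t%:num%:E * v A)%E) ->
  transport_plan omega0 omega1 u0 u pi1 -> transport_plan omega0 omega1 u0 v pi2 ->
  transport_plan omega0 omega1 u0 w (mixture s t pi1 pi2).
Proof.
move=> st1 wE [c1 p1 q1] [c2 p2 q2]; split.
- by move=> A mA AX; rewrite mixtureE c1// c2// !mule0 adde0.
- move=> A mA; rewrite /pushforward mixtureE.
  move: (p1 _ mA) (p2 _ mA); rewrite /pushforward => -> ->.
  by rewrite -muleDl ?fin_num_measure// -EFinD st1 mul1e.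
- move=> A mA; rewrite /pushforward mixtureE wE//.
  by move: (q1 _ mA) (q2 _ mA); rewrite /pushforward => -> ->.
Qed.

Lemma locally_optimal_Dc : (Dc omega0 omega1 c u0 ubar < +oo)%E.
Proof.
have [_ + _] := opt; rewrite /objective.
case: (Dc _ _ _ _ _) => [x _| |_] //; first exact: ltry.
by rewrite gt0_muley// ?lte_fin.
Qed.

(** Local optimality bounds the difference quotients of [J] along z from below by - alpha (K - D),
    and the adjoint equation evaluates their limit. *)
Lemma first_order_condition (mb mt : {finite_measure set V -> \bar R}) pit (D : R) :
  (forall A, measurable A -> ubar A = mb A) -> concentrated omega1 mt ->
  transport_plan omega0 omega1 u0 mt pit ->
  Dc omega0 omega1 c u0 ubar = D%:E ->
  \int[mb]_(x in omega1) C0_rep Omega p x + alpha * D <=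
  \int[mt]_(x in omega1) C0_rep Omega p x + alpha * \int[pit]_(z in X) c z.
Proof.
move=> ub cmt hpit DD.
have [D' [DD' Dlb Dinf]] := Dc_real mX mc cM locally_optimal_Dc.
have {DD'} DE : D' = D by apply: EFin_inj; rewrite -DD -DD'.
rewrite {}DE in Dlb Dinf.
set K := \int[pit]_(z in X) c z.
pose ch := charge_of_finite_measure mt.
pose y0 := state Omega omega1 a%:E ubar.
have hp' : weak_poisson Omega r%:E (dJ y0) p by [].
pose y1 := state Omega omega1 a%:E ch.
have h0 : weak_poisson Omega a%:E _ y0 := state_weak_poisson r1 dr aE oO bO m1 PS ub.
have cht A : measurable A -> ch A = mt A by [].
have h1 : weak_poisson Omega a%:E _ y1 :=
  state_weak_poisson r1 dr aE oO bO m1 PS cht.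
pose z := (-1) *: y0 + y1.
have hz := weak_poisson_lin a1 r1 ar aE oO bO (-1) h0 h1.
have Wy0 : W10 Omega a%:E y0 by case: h0.
have Wz : W10 Omega a%:E z by case: hz.
have rE : hoelder_conjugate r%:E = a%:E by rewrite -aE hoelder_conjugateK.
have Wp : W10 Omega r%:E p by case: hp'.
(* The adjoint equation is tested with z and the equation of z with p; the two bilinear forms
   coincide. *)
have dJz : dJ y0 z = \int[mt]_(x in omega1) C0_rep Omega p x -
    \int[mb]_(x in omega1) C0_rep Omega p x.
  have [_ /(_ z)] := hp'; rewrite rE => /(_ Wz) <-.
  have [_ /(_ p)] := hz; rewrite aE => /(_ Wp); rewrite mulN1r [X in _ = X]addrC => <-.
  by apply: eq_Rintegral => x _; rewrite dotC.
(* The extra summand t keeps the norm bound strict even when both masses vanish. *)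
have key (t : R) : 0 < t -> t < 1 ->
    (tv_norm (cadd (cadd (cscale (1 - t) ubar) (cscale t ch)) (copp ubar)) <
       (t * (fine (mt setT) + fine (mb setT)) + t)%:E)%E /\
    (objective Omega omega0 omega1 u0 c alpha a%:E J
       (cadd (cscale (1 - t) ubar) (cscale t ch)) <=
     (J (y0 + t *: z) + alpha * ((1 - t) * D + t * K))%:E)%E.
  move=> t0 t1; set ut := cadd _ (cscale t ch).
  have t1' : 0 <= 1 - t by lra.
  pose s' := NngNum t1'; pose t' := NngNum (ltW t0).
  pose m := mixture s' t' mb mt.
  have utE A : measurable A -> ut A = m A.
    by move=> mA; rewrite mixtureE /ut /cadd/= /cscale/= ub.
  split.
    apply: (@le_lt_trans _ _ (t * (fine (mt setT) + fine (mb setT)))%:E); last first.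
      by rewrite lte_fin ltrDl.
    apply: tv_norm_le (ltW t0) _ => A mA.
    transitivity (m A - mb A)%E; first by rewrite -utE// -ub.
    rewrite mixtureE.
    rewrite -(fineK (fin_num_measure mb _ mA)) -(fineK (fin_num_measure mt _ mA)).
    move: (fine (mb A)) (fine (mt A)) => x y.
    by rewrite -[LHS]/((1 - t) * x + t * y - x)%:E; congr EFin; ring.
  have hyt := state_weak_poisson r1 dr aE oO bO m1 PS utE.
  (* By linearity y0 + t z is a state of the mixture too, so [J] takes the same value there as at
     the chosen state. *)
  have hyt' : weak_poisson Omega a%:E (fun v => \int[m]_(x in omega1) C0_rep Omega v x)
      (t *: z + y0).
    have [W1' W2'] := weak_poisson_lin a1 r1 ar aE oO bO t hz h0.
    split=> // v; rewrite aE => Wv; rewrite W2' ?aE//.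
    rewrite (Rintegral_mixture _ _ _ _ m1 (C0_rep_measurable r1 dr oO bO Wv)
      (fun x _ => C0_rep_bounded r1 dr oO bO Wv x))/=.
    ring.
  have dm := C0_measure_dual r1 dr oO bO m1 m.
  have JE : J (state Omega omega1 a%:E ut) = J (y0 + t *: z).
    rewrite [y0 + _]addrC; apply: (W10_continuous_eq cJ).
    - by case: hyt'.
    - by case: hyt.
    - exact: (weak_poisson_unique a1 aE PS dm hyt' hyt).
  rewrite /objective JE EFinD leeD2l// EFinM lee_pmul2l//.
  apply/lee_addgt0Pr => e e0.
  have [pi hpi pie] := Dinf _ e0.
  have hm : transport_plan omega0 omega1 u0 ut (mixture s' t' pi pit).
    apply: (transport_plan_mixture _ _ hpi hpit) => //=; first by rewrite subrK.
  apply: (@le_trans _ _ (transport_cost omega0 omega1 c (mixture s' t' pi pit))).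
    by apply: ereal_inf_lbound; exists (mixture s' t' pi pit).
  rewrite (transport_cost_Rintegral mX mc cM) (Rintegral_mixture _ _ _ _ mX mc cM)/= -EFinD lee_fin.
  rewrite -/K; nra.
have [_ _ [e e0 he]] := opt.
have cu : concentrated omega1 ubar by have [] := opt.
set B := fine (mt setT) + fine (mb setT) in key.
have B0 : 0 <= B by rewrite addr_ge0// fine_ge0.
have small (t : R) : 0 < t -> t < 1 -> t * (B + 1) <= e ->
    - (alpha * (K - D)) <= t^-1 * (J (y0 + t *: z) - J y0).
  move=> t0 t1 te; have [k1 k2] := key _ t0 t1.
  have := he (cadd (cscale (1 - t) ubar) (cscale t ch)).
  have cc : concentrated omega1 (cadd (cscale (1 - t) ubar) (cscale t ch)).
    move=> A mA AX; transitivity ((1 - t)%:E * ubar A + t%:E * mt A)%E => //.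
    by rewrite cu// cmt// !mule0 adde0.
  have k1e : ((t * B + t)%:E <= e%:E)%E by rewrite lee_fin -[X in _ + X]mulr1 -mulrDr.
  move=> /(_ cc (lt_le_trans k1 k1e)) /le_trans /(_ k2).
  rewrite /objective DD -EFinM -EFinD lee_fin -/y0 => h; clear k1 k2 k1e.
  rewrite [leRHS]mulrC ler_pdivlMr//; nra.
have [_ /(_ _ Wz) lim] := gJ Wy0.
suff : - (alpha * (K - D)) <= dJ y0 z by rewrite dJz; nra.
apply/ler_addgt0Pr => e' e'0.
have /= near0 := (proj1 (@cvgrPdist_lt _ _ _ _ _ _ _) lim) _ e'0.
have /nbhs_ballP[/= del del0 hdel] := near0 ltac:(exact _).
(* The three bounds put t in the neighbourhood where the quotient is close to its limit, below 1,
   and small enough for the competitor to lie in the neighbourhood of local optimality. *)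
pose t := Num.min (del / 2) (Num.min (1 / 2) (e / (B + 1))).
have B1 : 0 < B + 1 by lra.
have t0 : 0 < t by rewrite !lt_min !divr_gt0.
have td : t <= del / 2 by rewrite ge_min lexx.
have t12 : t <= 1 / 2 by rewrite !ge_min lexx orbT.
have te : t <= e / (B + 1) by rewrite !ge_min lexx !orbT.
have te' : t * (B + 1) <= e by rewrite -ler_pdivlMr.
have := hdel t; rewrite /ball/= sub0r normrN gtr0_norm// gt_eqF//.
move=> /(_ _ isT) h; have {h} : `|dJ y0 z - t^-1 * (J (y0 + t *: z) - J y0)| < e'.
  by apply: h; lra.
have := small _ t0 _ te'; rewrite ltr_norml => + /andP[].
move=> h; have {h} := h ltac:(lra); lra.
Qed.

End first_order.

(** * The transport map *)

Section argmin_map.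
Context {R : realType} {d : nat}.
Local Notation V := 'rV[R]_d.
Variables (omega0 omega1 : set V) (w h : V -> R) (al ga rho : R).
Hypotheses (al0 : 0 < al) (ga0 : 0 < ga).
Hypotheses (conv_h : convex_function [set: convex_lmodType V] h).
Hypothesis sub : forall x xi, omega0 x -> omega1 xi -> enorm (xi - x) < rho.
Hypothesis co : convex_set (omega1 : set (convex_lmodType V)).

(** Let psi be the function minimized at T x, and m the midpoint of T x and b. Then psi(T x) <=
    psi(m) turns the midpoint inequality into growth with the same constant [ga]. *)
Lemma argmin_map_exists : compact omega1 -> omega1 !=set0 -> continuous w ->
  (forall x a b, omega0 x -> omega1 a -> omega1 b ->
    2 * (w (a + 2^-1 *: (b - a)) + al * h (a + 2^-1 *: (b - a) - x)) + ga * enorm (b - a) ^+ 2 <=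
    (w a + al * h (a - x)) + (w b + al * h (b - x))) ->
  exists T : V -> V, [/\ forall x, omega1 (T x),
    exists y, forall x, ~ omega0 x -> T x = y &
    forall x b, omega0 x -> omega1 b ->
      w (T x) + al * h (T x - x) + ga * enorm (b - T x) ^+ 2 <= w b + al * h (b - x)].
Proof.
move=> cpt [y0 y01] cw mid.
have argmin (x : V) : exists2 z, omega1 z & forall b, omega1 b ->
    w z + al * h (z - x) <= w b + al * h (b - x).
  have cf : continuous (fun z : V => al * h (z - x) + w z).
    apply: continuous_lin => // z.
    apply: (@continuous_comp _ _ _ (fun z : V => z - x) h); last exact: convex_function_continuous.
    by apply: (@continuousB R V V id (cst x)); [exact: cvg_id|exact: cst_continuous].
  have [z z1 hz] := compact_EVT_min (ex_intro _ y0 y01) cpt (continuous_subspaceT cf).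
  exists z; first exact: set_mem.
  by move=> b /mem_set/hz; rewrite addrC [leRHS]addrC.
have [T hT] := choice (fun x => let: ex_intro2 z p q := argmin x in ex_intro _ z (conj p q)).
(* Constant outside [omega0]: the pointwise choice of minimizers carries no information on
   measurability there. *)
exists (patch (fun=> y0) omega0 T); split.
- by move=> x; rewrite /patch; case: ifP => // _; exact: (hT x).1.
- by exists y0 => x x0; rewrite /patch memNset.
- move=> x b x0 b1; rewrite /patch mem_set//.
  have [t1 t2] := hT x; have := mid _ _ _ x0 t1 b1.
  have := t2 (T x + 2^-1 *: (b - T x)).
  have m1 : omega1 (T x + 2^-1 *: (b - T x)) by apply: convex_set_segment => //; lra.
  by move=> /(_ m1); lra.
Qed.

Variable T : V -> V.
Hypothesis T1 : forall x, omega1 (T x).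
Hypothesis growth : forall x b, omega0 x -> omega1 b ->
  w (T x) + al * h (T x - x) + ga * enorm (b - T x) ^+ 2 <= w b + al * h (b - x).

(** The values of [w] cancel when T y is a competitor at x and T x a competitor at y. *)
Lemma argmin_map_cross x y : omega0 x -> omega0 y ->
  2 * ga * enorm (T x - T y) ^+ 2 <=
  al * ((h (T y - x) - h (T y - y)) - (h (T x - x) - h (T x - y))).
Proof.
move=> x0 y0; have := growth x0 (T1 y); have := growth y0 (T1 x).
by rewrite (enorm_dist (T y)); lra.
Qed.

(** Pairing the terms with the same value of T, each of the two differences of [h] has increment y -
    x, and [h] is Lipschitz on the ball of radius [rho]. *)
Lemma argmin_map_sqr : exists2 C : R, 0 <= C & forall x y, omega0 x -> omega0 y ->
  enorm (T x - T y) ^+ 2 <= C * `|x - y|.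
Proof.
have [L L0 hL] := convex_lipschitz_bounded conv_h rho.
have bd x xi : omega0 x -> omega1 xi -> `|xi - x| <= rho.
  by move=> x0 x1; rewrite (le_trans (mxnorm_le_enorm _))// ltW// sub.
exists (al * L / ga) => [|x y x0 y0]; first by rewrite divr_ge0 ?mulr_ge0// ltW.
rewrite [leRHS]mulrAC ler_pdivlMr//.
have h1 := hL _ _ (bd _ _ x0 (T1 y)) (bd _ _ y0 (T1 y)).
have h2 := hL _ _ (bd _ _ x0 (T1 x)) (bd _ _ y0 (T1 x)).
have e (z : V) : z - x - (z - y) = y - x by apply/rowP => j; rewrite !mxE; ring.
rewrite !e (distrC y) in h1 h2.
have cross := argmin_map_cross x0 y0.
have : al * (h (T y - x) - h (T y - y) - (h (T x - x) - h (T x - y))) <=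
    al * (2 * (L * `|x - y|)).
  by rewrite ler_pM2l//; move: h1 h2; rewrite !ler_norml => /andP[? ?] /andP[? ?]; lra.
lra.
Qed.

(** [argmin_map_sqr] makes [T] continuous relative to the closed set [omega0]. *)
Lemma argmin_map_measurable : compact omega0 ->
  (exists y, forall x, ~ omega0 x -> T x = y) -> measurable_fun setT T.
Proof.
move=> c0 [y hy]; have [C C0 hC] := argmin_map_sqr.
have -> : T = patch (fun=> y) omega0 T.
  by apply/funext => x; rewrite /patch; case: ifPn => // /negP xn; apply: hy => /mem_set.
apply: measurable_fun_closed_patch => [|x x0 e e0]; first exact: compact_closed.
exists (e ^+ 2 / (C + 1)) => [|z z0 xz]; first by rewrite divr_gt0 ?exprn_gt0// ltr_wpDl.
apply: le_lt_trans (mxnorm_le_enorm _) _.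
rewrite -(ltr_pXn2r (n := 2))// ?nnegrE ?enorm_ge0 ?(ltW e0)//.
apply: le_lt_trans (hC _ _ x0 z0) _.
move: xz; rewrite ltr_pdivlMr; last by rewrite ltr_wpDl.
by apply: le_lt_trans; rewrite mulrC ler_wpM2l// lerDl.
Qed.

Lemma argmin_map_hoelder : exists C : R, forall x y, omega0 x -> omega0 y ->
  enorm (T x - T y) <= C * enorm (x - y) `^ 2^-1.
Proof.
have [C C0 hC] := argmin_map_sqr; exists (Num.sqrt C) => x y x0 y0.
rewrite powR12_sqrt ?enorm_ge0// -sqrtrM//.
rewrite -[leLHS](ger0_norm (enorm_ge0 _)) -sqrtr_sqr ler_sqrt.
  by apply: le_trans (hC _ _ x0 y0) _; rewrite ler_wpM2l// mxnorm_le_enorm.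
by rewrite mulr_ge0// enorm_ge0.
Qed.

(** The second difference is now at most L |x - y| |T x - T y|; one factor |T x - T y| cancels
    against the square in [argmin_map_cross]. *)
Lemma argmin_map_lipschitz (H : V -> R) :
  C1_extension (set_diff omega1 omega0) h H ->
  (exists L : R, forall s t, set_diff omega1 omega0 s -> set_diff omega1 omega0 t ->
     enorm (gradient H s - gradient H t) <= L * enorm (s - t)) ->
  exists L : R, forall x y, omega0 x -> omega0 y ->
    enorm (T x - T y) <= L * enorm (x - y).
Proof.
move=> [U [_ subU dH hH]] [L hL]; exists (al * `|L| / (2 * ga)) => x y x0 y0.
have df s : set_diff omega1 omega0 s -> differentiable (H : V -> R^o) s.
  by move=> /subU/dH[].
pose v := T y - T x; pose xi (s : R) := T x + s *: v.
have sd z s : omega0 z -> 0 <= s <= 1 -> set_diff omega1 omega0 (xi s - z).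
  by move=> z0 s01; exists (xi s); [exact: convex_set_segment|exists z].
(* k 1 - k 0 is the second difference, seen as an increment along the segment from T x to T y. Its
   translates by -x and -y stay in [set_diff omega1 omega0] because [omega1] is convex. *)
pose k (s : R) := H (T x - x + s *: v) - H (T x - y + s *: v).
have e z s : T x - z + s *: v = xi s - z by rewrite addrAC.
have dk (s : R) : 0 <= s <= 1 -> is_derive s 1 k
    (dot (gradient H (xi s - x)) v - dot (gradient H (xi s - y)) v).
  move=> s01; apply: is_deriveB; apply: is_derive_line; rewrite e;
    by apply: derive_gradient; apply: df; exact: sd.
have [s s01] := MVT01 dk.
rewrite -dotBl /k !e.
have x1E : xi 1 = T y by rewrite /xi scale1r subrKC.
have x0E : xi 0 = T x by rewrite /xi scale0r addr0.
have hHE z u : omega0 z -> omega1 (T u) -> H (T u - z) = h (T u - z).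
  by move=> z0 u1; rewrite hH//; exists (T u) => //; exists z.
rewrite x1E x0E !hHE// => kE.
have cross := argmin_map_cross x0 y0.
have := dot_le_enorm (gradient H (xi s - x) - gradient H (xi s - y)) v.
have := hL _ _ (sd _ _ x0 s01) (sd _ _ y0 s01).
have -> : xi s - x - (xi s - y) = y - x by apply/rowP => j; rewrite !mxE; ring.
rewrite (enorm_dist y) -kE (enorm_dist (T y)) => g1 g2.
have [->|Dn] := eqVneq (enorm (T x - T y)) 0.
  by rewrite mulr_ge0 ?enorm_ge0// divr_ge0 ?mulr_ge0// ltW.
have Dp : 0 < enorm (T x - T y) by rewrite lt_def Dn enorm_ge0.
rewrite mulrAC ler_pdivlMr ?mulr_gt0//.
rewrite -(ler_pM2r Dp).
have g3 : L * enorm (x - y) <= `|L| * enorm (x - y).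
  by rewrite ler_wpM2r ?enorm_ge0// ler_norm.
have g4 := ler_wpM2r (ltW Dp) (le_trans g1 g3).
have := ler_wpM2l (ltW al0) (le_trans g2 g4).
lra.
Qed.

End argmin_map.

(** * Marginals and near-optimal plans *)

Section concentrated_theory.
Context {dT} {T : measurableType dT} {R : realType}.
Variables (m : {finite_measure set T -> \bar R}) (X : set T).
Hypotheses (cX : concentrated X m) (mX : measurable X).

Lemma concentrated_setI A : measurable A -> m A = m (A `&` X).
Proof.
move=> mA; rewrite -[in LHS](setUIDK A X) measureU.
- rewrite [X in (_ + X)%E]cX ?adde0//; first exact: measurableD.
  by rewrite -setIA (setIC (~` X)) setICr setI0.
- exact: measurableI.
- exact: measurableD.
- by rewrite setDE setIACA setICr setI0.
Qed.

Lemma Rintegral_concentrated (B : set T) (f : T -> R) (M : R) : measurable B -> X `<=` B ->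
  measurable_fun B f -> (forall x, B x -> `|f x| <= M) ->
  \int[m]_(x in B) f x = \int[m]_(x in X) f x.
Proof.
move=> mB XB mf fM; rewrite /Rintegral (negligible_integral (N := B `\` X))//.
- by rewrite setDD setIidr.
- exact: measurableD.
- exact: bounded_integrable fM.
- apply: cX; first exact: measurableD.
  by rewrite setDE -setIA (setIC (~` X)) setICr setI0.
Qed.

(** The change of variables yields an integral over the preimage of [D]; it reduces to [X], which
    carries all the mass. *)
Lemma Rintegral_marginal {dU} {U : measurableType dU} (mu : {finite_measure set U -> \bar R})
    (f : T -> U) (D : set U) (k : U -> R) (M : R) :
  measurable_fun setT f -> (forall A, measurable A -> pushforward m f A = mu A) ->
  measurable D -> X `<=` f @^-1` D ->
  measurable_fun setT k -> (forall y, D y -> `|k y| <= M) ->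
  \int[m]_(x in X) k (f x) = \int[mu]_(y in D) k y.
Proof.
move=> mf mE mD XD mk kM.
have mfD : measurable (f @^-1` D) by rewrite -[X in measurable X]setTI; exact: mf.
have mkf : measurable_fun (f @^-1` D) (k \o f).
  by apply: measurable_funTS; exact: measurableT_comp.
rewrite -(Rintegral_concentrated mfD XD mkf (fun x => kM (f x))).
rewrite -(@eq_measure_Rintegral _ _ _ (push_measure m mf) mu)//.
rewrite /Rintegral (@integral_pushforward _ _ _ _ _ _ mf m D (EFin \o k))//.
- exact/measurable_EFinP.
- exact: bounded_integrable (fun x => kM (f x)).
Qed.

Lemma chebyshev_Rintegral (f : T -> R) (t M : R) : measurable_fun X f ->
  (forall x, X x -> 0 <= f x <= M) -> 0 < t ->
  t * fine (m (X `&` [set x | t <= f x])) <= \int[m]_(x in X) f x.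
Proof.
move=> mf f0 t0.
have i : m.-integrable X (EFin \o f).
  apply: (bounded_integrable (M := M) m) => // x Xx.
  by have /andP[? ?] := f0 _ Xx; rewrite ger0_norm.
have mfE : measurable_fun X (EFin \o f) by exact/measurable_EFinP.
have mE : measurable (X `&` [set x | t <= f x]).
  rewrite (_ : [set x | t <= f x] = f @^-1` `[t, +oo[%classic); first exact: mf.
  by apply/seteqP; split=> x /=; rewrite in_itv/= andbT.
rewrite -lee_fin EFinM fineK ?fin_num_measure// fineK ?integrable_fin_num//.
have := le_integral_abse m mX mfE t0.
rewrite (eq_integral (EFin \o f)) => [|x /set_mem Xx]; last first.
  by rewrite /= ger0_norm//; have /andP[] := f0 _ Xx.
apply: le_trans; rewrite lee_pmul2l ?lte_fin//.
rewrite (_ : X `&` [set x | t <= f x] = X `&` [set x | (t%:E <= `|(EFin \o f) x|)%E])//.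
apply/seteqP; split=> x /= [Xx]; have /andP[fx _] := f0 _ Xx; by rewrite lee_fin ger0_norm.
Qed.

End concentrated_theory.

Section thickening.
Context {R : realType} {d : nat}.
Local Notation V := 'rV[R]_d.

Definition thickening (A : set V) (e : R) : set V := \bigcup_(y in A) ball y e.

Lemma thickening_measurable A e : measurable (thickening A e).
Proof.
by apply: open_measurable_rV; apply: bigcup_open => y _; exact: ball_open.
Qed.

(** A closed set is the decreasing intersection of its thickenings, so continuity from above removes
    e, and then t tends to 0. *)
Lemma finite_measure_le_thickening (m1 m2 : {finite_measure set V -> \bar R}) :
  (forall A e t, closed A -> 0 < e -> 0 < t -> (m1 A <= m2 (thickening A e) + t%:E)%E) ->
  forall A, closed A -> (m1 A <= m2 A)%E.
Proof.
move=> h A cA; pose F (n : nat) := thickening A n.+1%:R^-1.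
have FA : \bigcap_n F n = A.
  apply/seteqP; split=> [x hx|x Ax n _]; last by exists x => //; apply: ballxx; rewrite invr_gt0.
  rewrite [A](closure_id A).1// => U /nbhs_ballP[e /= e0 eU].
  have [n ne] : exists n : nat, n.+1%:R^-1 <= e.
    exists (Num.truncn e^-1); rewrite -[leRHS]invrK lef_pV2 ?posrE ?invr_gt0//.
    by apply/ltW; exact: truncnS_gt.
  have [y Ay xy] := hx n I; exists y; split=> //; apply: eU.
  by apply: ball_sym; exact: le_ball ne _ xy.
have cv : m2 \o F @ \oo --> m2 A.
  rewrite -FA; apply: nonincreasing_cvg_mu.
  - by rewrite ltey_eq fin_num_measure//; exact: thickening_measurable.
  - by move=> i; exact: thickening_measurable.
  - by rewrite FA; exact: closed_measurable_rV.
  - move=> i j ij; apply/subsetPset => x [y Ay xy]; exists y => //.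
    by apply: le_ball xy; rewrite lef_pV2 ?posrE// ler_nat.
rewrite -(cvg_lim _ cv)//; apply: lime_ge; first by apply/cvg_ex; exists (m2 A).
apply: nearW => n /=; apply/lee_addgt0Pr => t t0.
by apply: h => //; rewrite invr_gt0.
Qed.

End thickening.

Section push_finite_measure.
Context d d' (T1 : measurableType d) (T2 : measurableType d') (R : realType).
Variables (m : {finite_measure set T1 -> \bar R}) (f : T1 -> T2).
Hypothesis mf : measurable_fun setT f.

Let push_fin : (push_measure m mf setT < +oo)%E.
Proof. by rewrite push_measureE preimage_setT finite_measureT. Qed.

Definition push_finite_measure : {finite_measure set T2 -> \bar R} :=
  finite_of_measure push_fin.

Lemma push_finite_measureE A : push_finite_measure A = pushforward m f A.
Proof. by []. Qed.

End push_finite_measure.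

Lemma displacement_measurable {R : realType} {d : nat} (h : 'rV[R]_d -> R) :
  continuous h -> measurable_fun setT (fun z : 'rV[R]_d * 'rV[R]_d => h (z.2 - z.1)).
Proof.
move=> ch; apply: continuous_measurable_rV2 => z.
apply: (@continuous_comp _ _ _ (fun z : 'rV[R]_d * 'rV[R]_d => z.2 - z.1) h); last exact: ch.
apply: (@continuousB R 'rV[R]_d ('rV[R]_d * 'rV[R]_d)%type snd fst); first exact: cvg_snd.
exact: cvg_fst.
Qed.

(** * Optimality and uniqueness of the plan carried by the graph *)

Section optimality.
Context {R : realType} {d : nat}.
Local Notation V := 'rV[R]_d.
Variables (omega0 omega1 : set V) (u0 : {finite_measure set V -> \bar R}).
Variables (c : V * V -> R) (w h : V -> R) (al ga Mw M : R) (T : V -> V).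
Local Notation X := (omega0 `*` omega1).
Hypotheses (m0 : measurable omega0) (m1 : measurable omega1) (cu0 : concentrated omega0 u0).
Hypotheses (cw : continuous w) (ch : continuous h).
Hypotheses (wM : forall x, omega1 x -> `|w x| <= Mw) (cM : forall z, X z -> `|c z| <= M).
Hypothesis cE : forall x xi, omega0 x -> omega1 xi -> c (x, xi) = h (xi - x).
Hypotheses (al0 : 0 < al) (ga0 : 0 < ga).
Hypotheses (mT : measurable_fun setT T) (T1 : forall x, omega1 (T x)).
Hypothesis growth : forall x b, omega0 x -> omega1 b ->
  w (T x) + al * h (T x - x) + ga * enorm (b - T x) ^+ 2 <= w b + al * h (b - x).
Implicit Types (pi : {finite_measure set (V * V)%type -> \bar R}).

Let mX : measurable X. Proof. exact: measurableX. Qed.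

Let mw : measurable_fun setT w. Proof. exact: continuous_measurable_rV. Qed.

Let hc (z : V * V) := h (z.2 - z.1).

Let mhc : measurable_fun setT hc. Proof. exact: displacement_measurable. Qed.

Let chc z : X z -> c z = hc z.
Proof. by case: z => x xi [/= x0 x1]; exact: cE. Qed.

Let hcM z : X z -> `|hc z| <= M. Proof. by move=> Xz; rewrite -chc// cM. Qed.

Let graphX x : omega0 x -> X (x, T x). Proof. by move=> x0; split=> //=. Qed.

Lemma cost_measurable : measurable_fun X c.
Proof.
apply: (eq_measurable_fun hc); last exact: measurable_funTS.
by move=> z /set_mem Xz; rewrite chc.
Qed.

Lemma graph_measurable : measurable_fun setT (fun x => (x, T x)).
Proof. exact: measurable_fun_pair. Qed.

Local Notation graph := (push_finite_measure u0 graph_measurable).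
Local Notation mt := (push_finite_measure u0 mT).

Lemma graph_plan : transport_plan omega0 omega1 u0 mt graph.
Proof.
split=> // A mA AX; rewrite push_finite_measureE /pushforward; apply: cu0.
  by rewrite -[X in measurable X]setTI; exact: graph_measurable.
apply/seteqP; split=> // x [Ax x0].
by have : (A `&` X) (x, T x) := conj Ax (graphX x0); rewrite AX.
Qed.

(** For x in [omega0] this is psi_x(T x), the minimum of psi_x over [omega1]. *)
Let Fm x := w (T x) + al * hc (x, T x).

Let mFm : measurable_fun setT Fm.
Proof.
apply: measurable_funD; first exact: measurableT_comp.
apply: measurable_funM => //; apply: (measurableT_comp mhc graph_measurable).
Qed.

Let FmM x : omega0 x -> `|Fm x| <= Mw + al * M.
Proof.
move=> x0; rewrite /Fm (le_trans (ler_normD _ _))// lerD ?wM// normrM (gtr0_norm al0).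
by rewrite ler_wpM2l ?(ltW al0)//; exact/hcM/graphX.
Qed.

Lemma graph_value :
  \int[mt]_(x in omega1) w x + al * \int[graph]_(z in X) c z = \int[u0]_(x in omega0) Fm x.
Proof.
have -> : \int[graph]_(z in X) c z = \int[graph]_(z in X) hc z.
  by apply: eq_Rintegral => z /set_mem; exact: chc.
rewrite -(Rintegral_marginal (mu := mt) cu0 m0 mT _ m1 _ mw wM)//.
rewrite -(Rintegral_marginal (mu := graph) cu0 m0 graph_measurable _ mX _ mhc hcM)//.
have i1 : u0.-integrable omega0 (EFin \o (fun x => w (T x))).
  apply: (bounded_integrable (M := Mw) u0) => // [|x _]; last exact: wM.
  by apply: measurable_funTS; exact: measurableT_comp.
have mg : measurable_fun omega0 (fun x => hc (x, T x)).
  by apply: measurable_funTS; exact: (measurableT_comp mhc graph_measurable).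
have i2 : u0.-integrable omega0 (EFin \o (fun x => hc (x, T x))).
  by apply: (bounded_integrable (M := M) u0) => // x x0; exact/hcM/graphX.
rewrite -RintegralZl// -RintegralD//.
by rewrite /comp; under eq_fun do rewrite EFinM; exact: integrableZl.
by move=> x _; exact: T1.
Qed.

Let g (z : V * V) := enorm (z.2 - T z.1) ^+ 2.

Let mg : measurable_fun setT g.
Proof.
rewrite (_ : g = fun z => \sum_(i < d) (z.2 0 i - T z.1 0 i) ^+ 2); last first.
  by apply/funext => z; rewrite /g enorm_sqr; apply: eq_bigr => i _; rewrite !mxE expr2.
have mi i : measurable_fun setT (fun x : V => x 0 i).
  by apply: continuous_measurable_rV; exact: coord_continuous.
apply: measurable_sum => i; apply: measurable_funX; apply: measurable_funB.
- by apply: (measurableT_comp (mi i)); exact: measurable_snd.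
- by apply: (measurableT_comp (mi i)); apply: (measurableT_comp mT); exact: measurable_fst.
Qed.

(** The growth inequality itself bounds g, since ga g is at most psi_x(xi) - psi_x(T x). *)
Let gM z : X z -> 0 <= g z <= 2 * (Mw + al * M) / ga.
Proof.
case: z => x xi [/= x0 x1]; rewrite sqr_ge0/= ler_pdivlMr//.
have := growth x0 x1; have := FmM x0; have := wM x1.
have := hcM (z := (x, xi)) (conj x0 x1); rewrite -(ler_pM2l al0).
rewrite -{1}(gtr0_norm al0) -normrM !ler_norml /Fm /hc/= /g/=.
move=> /andP[? ?] /andP[? ?] /andP[? ?]; lra.
Qed.

(** Integrate the growth inequality against [pi]: its marginals convert the integral of w(xi) into
    one against mu, and that of psi_x(T x) into one against u0, which is the value of the graph
    plan. *)
Lemma plan_gap (u : set V -> \bar R) (mu : {finite_measure set V -> \bar R}) pi :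
  (forall A, measurable A -> u A = mu A) -> transport_plan omega0 omega1 u0 u pi ->
  ga * \int[pi]_(z in X) g z +
    (\int[mt]_(x in omega1) w x + al * \int[graph]_(z in X) c z) <=
  \int[mu]_(x in omega1) w x + al * \int[pi]_(z in X) c z.
Proof.
move=> umu [cpi p0 p1]; rewrite graph_value.
have q1 A : measurable A -> pushforward pi snd A = mu A by move=> mA; rewrite p1// umu.
rewrite -(Rintegral_marginal cpi mX measurable_fst p0 m0 _ mFm FmM); last by move=> z [].
rewrite -(Rintegral_marginal cpi mX measurable_snd q1 m1 _ mw wM); last by move=> z [].
have [mFf mws] : measurable_fun X (fun z => Fm z.1) /\ measurable_fun X (fun z => w z.2).
  by split; apply: measurable_funTS; apply: measurableT_comp.
have iF : pi.-integrable X (EFin \o (fun z => Fm z.1)).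
  by apply: (bounded_integrable (M := Mw + al * M) pi) => // z [z0 _]; exact: FmM.
have iw : pi.-integrable X (EFin \o (fun z => w z.2)).
  by apply: (bounded_integrable (M := Mw) pi) => // z [_ z1]; exact: wM.
have ic : pi.-integrable X (EFin \o c).
  by apply: (bounded_integrable (M := M) pi) => //; exact: cost_measurable.
have ig : pi.-integrable X (EFin \o g).
  apply: (bounded_integrable (M := 2 * (Mw + al * M) / ga) pi) => //.
    exact: measurable_funTS.
  by move=> z /gM/andP[g0 gm]; rewrite ger0_norm.
have Z (k : R) f : pi.-integrable X (EFin \o f) -> pi.-integrable X (EFin \o (fun z => k * f z)).
  by move=> i; rewrite /comp; under eq_fun do rewrite EFinM; exact: integrableZl.
have Dd f1 f2 : pi.-integrable X (EFin \o f1) -> pi.-integrable X (EFin \o f2) ->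
    pi.-integrable X (EFin \o (fun z => f1 z + f2 z)).
  by move=> i1 i2; rewrite /comp; under eq_fun do rewrite EFinD; exact: integrableD.
rewrite -!RintegralZl// -!RintegralD//; try exact: Z.
apply: le_Rintegral => //; try by apply: Dd => //; exact: Z.
move=> [x xi] Xz; rewrite (chc Xz); move: Xz => [/= x0 x1].
by have := growth x0 x1; rewrite /Fm /hc /g/=; lra.
Qed.

Section first_order_consequences.
Variables (ubar : set V -> \bar R) (mb : {finite_measure set V -> \bar R}) (D : R).
Hypothesis ub : forall A, measurable A -> ubar A = mb A.
Hypothesis DD : Dc omega0 omega1 c u0 ubar = D%:E.
Hypothesis Dinf : forall e : R, 0 < e -> exists2 pi, transport_plan omega0 omega1 u0 ubar pi &
  \int[pi]_(z in X) c z < D + e.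
Hypothesis first_order : \int[mb]_(x in omega1) w x + al * D <=
  \int[mt]_(x in omega1) w x + al * \int[graph]_(z in X) c z.

Lemma near_optimal_plan pi (e : R) : transport_plan omega0 omega1 u0 ubar pi ->
  \int[pi]_(z in X) c z <= D + e -> ga * \int[pi]_(z in X) g z <= al * e.
Proof.
move=> hpi; rewrite -(ler_pM2l al0); have := plan_gap ub hpi; move: first_order; lra.
Qed.

Let dev (r : R) := X `&` [set z | r <= enorm (z.2 - T z.1)].

Let devE (r : R) : 0 < r -> dev r = X `&` [set z | r ^+ 2 <= g z].
Proof.
move=> r0; apply/seteqP; split=> z /= [Xz].
  by rewrite /g ler_pXn2r// ?nnegrE ?enorm_ge0// ltW.
by rewrite /g ler_pXn2r// ?nnegrE ?enorm_ge0// ltW.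
Qed.

Let mdev (r : R) : 0 < r -> measurable (dev r).
Proof.
move=> r0; rewrite devE// (_ : [set z | r ^+ 2 <= g z] = g @^-1` `[r ^+ 2, +oo[%classic).
  by apply: measurableI => //; rewrite -[X in measurable X]setTI; exact: mg.
by apply/seteqP; split=> x /=; rewrite in_itv/= andbT.
Qed.

Lemma near_optimal_deviation (r t : R) : 0 < r -> 0 < t ->
  exists2 pi, transport_plan omega0 omega1 u0 ubar pi & (pi (dev r) <= t%:E)%E.
Proof.
move=> r0 t0; have r20 : 0 < r ^+ 2 by rewrite exprn_gt0.
(* With this accuracy the integral of g is at most r^2 t, and Chebyshev's inequality gives mass at
   most t where g >= r^2. *)
have e0 : 0 < ga * (r ^+ 2 * t) / al by rewrite divr_gt0// mulr_gt0// mulr_gt0.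
have [pi hpi /ltW/(near_optimal_plan hpi)] := Dinf e0.
rewrite [al * _]mulrC divfK ?gt_eqF// ler_pM2l// => gi; exists pi => //.
have := chebyshev_Rintegral pi mX (measurable_funTS mg) gM r20.
rewrite -devE// => /le_trans /(_ gi); rewrite ler_pM2l// -lee_fin fineK// fin_num_measure//.
exact: mdev.
Qed.

(** [S1] and [S2] stand for xi and T x in either order: off the deviation set, S2 z is within r of
    S1 z. The two orders give the two inequalities of [target_marginal]. *)
Lemma near_optimal_marginals (S1 S2 : V * V -> V) pi (r t : R) (A : set V) : 0 < r ->
  transport_plan omega0 omega1 u0 ubar pi ->
  measurable_fun setT S1 -> measurable_fun setT S2 ->
  (forall z, enorm (z.2 - T z.1) = enorm (S1 z - S2 z)) ->
  closed A -> (pi (dev r) <= t%:E)%E ->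
  (pi (S1 @^-1` A) <= pi (S2 @^-1` thickening A r) + t%:E)%E.
Proof.
move=> r0 [cpi _ _] mS1 mS2 S12 cA pit.
have mA : measurable (S1 @^-1` A).
  by rewrite -[X in measurable X]setTI; apply: mS1 => //; exact: closed_measurable_rV.
have mB : measurable (S2 @^-1` thickening A r).
  by rewrite -[X in measurable X]setTI; apply: mS2 => //; exact: thickening_measurable.
rewrite (concentrated_setI cpi mX mA); apply: le_trans (leeD2l _ pit).
apply: le_trans (measureU2 pi mB (mdev r0)); apply: le_measure; rewrite ?inE.
- exact: measurableI.
- by apply: measurableU => //; exact: mdev.
- move=> z [/= Az Xz]; have [rz|zr] := leP r (enorm (z.2 - T z.1)); [by right|left].
  exists (S1 z) => //; rewrite -ball_normE/=.
  by apply: le_lt_trans (mxnorm_le_enorm _) _; rewrite -S12.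
Qed.

(** The plan depends on the radius and on the tolerance, but its images under the second projection
    and under T composed with the first are always [ubar] and T#u0. This replaces a limit of
    plans. *)
Lemma target_marginal A : measurable A -> ubar A = mt A.
Proof.
move=> mA; rewrite ub//; apply: finite_measure_eq_closed => // {mA}A cA.
have mTf : measurable_fun setT (T \o fst : V * V -> V).
  by apply: measurableT_comp => //; exact: measurable_fst.
have p1 pi B : transport_plan omega0 omega1 u0 ubar pi -> measurable B ->
    pi (snd @^-1` B) = mb B.
  by move=> [_ _ q1] mB; rewrite -ub// -q1.
have p0 pi B : transport_plan omega0 omega1 u0 ubar pi -> measurable B ->
    pi ((T \o fst) @^-1` B) = mt B.
  move=> [_ q0 _] mB; rewrite comp_preimage push_finite_measureE /pushforward -q0//.
  by rewrite -[X in measurable X]setTI; exact: mT.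
apply/eqP; rewrite eq_le; apply/andP; split; apply: (finite_measure_le_thickening _ cA) => {cA}A e t cA e0 t0.
- have [pi hpi pit] := near_optimal_deviation e0 t0.
  rewrite -(p1 _ _ hpi (closed_measurable_rV cA)) -(p0 _ _ hpi (thickening_measurable A e)).
  exact: near_optimal_marginals hpi measurable_snd mTf _ cA pit.
- have [pi hpi pit] := near_optimal_deviation e0 t0.
  rewrite -(p0 _ _ hpi (closed_measurable_rV cA)) -(p1 _ _ hpi (thickening_measurable A e)).
  by apply: near_optimal_marginals hpi mTf measurable_snd _ cA pit => // z; rewrite enorm_dist.
Qed.

(** Since ubar = T#u0, the integrals of [w] cancel in [plan_gap], so the graph plan costs no more
    than any other plan; in particular the infimum is attained. *)
Lemma graph_optimal : optimal_plan omega0 omega1 c u0 ubar graph.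
Proof.
have [c1 c2 c3] := graph_plan.
have hgraph : transport_plan omega0 omega1 u0 ubar graph.
  by split=> // A mA; rewrite c3// target_marginal.
split=> //; apply/eqP; rewrite eq_le; apply/andP; split; last first.
  by apply: ereal_inf_lbound; exists graph.
rewrite DD (transport_cost_Rintegral mX cost_measurable cM) lee_fin.
apply/ler_addgt0Pr => e e0; have [pi hpi /ltW pie] := Dinf e0.
apply: le_trans pie; have := plan_gap ub hpi.
rewrite (@eq_measure_Rintegral _ _ _ mb mt omega1 w) => [|A mA]; last first.
  exact: etrans (esym (ub mA)) (target_marginal mA).
have : 0 <= ga * \int[pi]_(z in X) g z.
  by rewrite mulr_ge0 ?(ltW ga0)//; apply: Rintegral_ge0 => z /gM/andP[].
by move=> gi gap; rewrite -(ler_pM2l al0); lra.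
Qed.

Lemma optimal_plan_unique pi : optimal_plan omega0 omega1 c u0 ubar pi ->
  forall A, measurable A -> pi A = graph A.
Proof.
move=> [hpi]; rewrite (transport_cost_Rintegral mX cost_measurable cM) DD => -[piD] A mA.
have [cpi p0 _] := hpi.
have g0 : \int[pi]_(z in X) g z <= 0.
  have := @near_optimal_plan pi 0 hpi; rewrite addr0 mulr0 piD => /(_ (lexx _)).
  by rewrite pmulr_rle0.
have ig : pi.-integrable X (EFin \o g).
  apply: (bounded_integrable (M := 2 * (Mw + al * M) / ga) pi) => //.
    exact: measurable_funTS.
  by move=> z /gM/andP[z0 gm]; rewrite ger0_norm.
have [N [mN N0 hN]] : ae_eq pi X (EFin \o g) (cst 0%E).
  apply/ae_eq_integral_abs => //; first exact: measurable_int ig.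
  rewrite (eq_integral (EFin \o g)) => [|z /set_mem/gM/andP[z0 _]]; last first.
    by rewrite /= ger0_norm.
  rewrite -[LHS]fineK ?integrable_fin_num//; congr EFin; apply/eqP.
  by rewrite eq_le g0; apply: Rintegral_ge0 => z /gM/andP[].
(* With no loss in accuracy the integral of g vanishes, so [pi] lives on the graph of T up to the
   null set [N] and is determined by its first marginal. *)
have gN z : X z -> ~ N z -> z.2 = T z.1.
  move=> Xz nN; apply/eqP; rewrite -subr_eq0; apply/eqP/enorm_eq0/eqP.
  apply/negPn/negP => gz; apply: nN; apply: hN => /= /(_ Xz) [].
  by move/eqP; rewrite expf_eq0/= (negbTE gz).
pose B := (fun x => (x, T x)) @^-1` A.
have mB : measurable B by rewrite -[X in measurable X]setTI; exact: graph_measurable.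
have mfB : measurable (fst @^-1` B : set (V * V)).
  by rewrite -[X in measurable X]setTI; exact: measurable_fst.
rewrite push_finite_measureE /pushforward -/B -p0// /pushforward.
rewrite (concentrated_setI cpi mX mA) (concentrated_setI cpi mX mfB).
have le (C C' : set (V * V)) : measurable C -> measurable C' -> C `<=` C' `|` N ->
    (pi C <= pi C')%E.
  move=> mC mC' CN; rewrite -[leRHS]adde0 -N0.
  apply: le_trans (measureU2 pi mC' mN); apply: le_measure; rewrite ?inE//.
  exact: measurableU.
apply/eqP; rewrite eq_le !le//; try exact: measurableI.
- move=> [x xi] [/= Bx Xz]; have [Nz|nNz] := pselect (N (x, xi)); [by right|left; split=> //].
  by have /= -> := gN (x, xi) Xz nNz.
- move=> [x xi] [Az Xz]; have [Nz|nNz] := pselect (N (x, xi)); [by right|left; split=> //].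
  by have /= xiE := gN _ Xz nNz; rewrite /= /B/= -xiE.
Qed.

End first_order_consequences.
End optimality.

Theorem theorem6p3 (R : realType) (d : nat)
  (Omega omega0 omega1 : set 'rV[R]_d)
  (u0 : {finite_measure set 'rV[R]_d -> \bar R})
  (c : 'rV[R]_d * 'rV[R]_d -> R) (alpha : R) (pOmega q : \bar R)
  (J : sobolev R d -> R) (dJ : sobolev R d -> sobolev R d -> R)
  (h : 'rV[R]_d -> R) (beta : R -> R) (rho kappa : R)
  (ubar : {charge set 'rV[R]_d -> \bar R})
  (p : sobolev R d) (P : 'rV[R]_d -> R) :
  let q' := hoelder_conjugate q in
  (* standing assumptions *)
  (d = 2 \/ d = 3)%N ->
  lipschitz_domain Omega ->
  omega0 !=set0 -> compact omega0 ->
  omega1 !=set0 -> compact omega1 -> omega1 `<=` closure Omega ->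
  concentrated omega0 u0 ->
  {within omega0 `*` omega1, continuous c} ->
  0 < alpha ->
  (d%:R%:E < pOmega)%E ->
  (forall r : \bar R, (hoelder_conjugate pOmega < r)%E -> (r < pOmega)%E ->
     poisson_uniquely_solvable Omega r) ->
  (1 < q)%E -> (d%:R%:E < q')%E -> (q' < pOmega)%E ->
  (d = 3%N -> (q' < 6%:R%:E)%E) ->
  W10_continuous Omega q J ->
  (forall y, W10 Omega q y -> is_gateaux Omega q J y (dJ y)) ->
  (* convexity *)
  convex_set (omega1 : set (convex_lmodType 'rV[R]_d)) ->
  (forall x xi, omega0 x -> omega1 xi -> c (x, xi) = h (xi - x)) ->
  convex_function [set: convex_lmodType 'rV[R]_d] h ->
  (forall r : R, 0 < r -> 0 < beta r /\
     forall x xs xi xis, subdiff h x xs -> subdiff h xi xis ->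
       eball r x -> eball r xi ->
       beta r * enorm (x - xi) ^+ 2 <= dot (xs - xis) (x - xi)) ->
  0 < rho -> set_diff omega1 omega0 `<=` eball rho ->
  (* local optimality and the adjoint state *)
  locally_optimal Omega omega0 omega1 u0 c alpha q J ubar ->
  weak_poisson Omega q' (dJ (state Omega omega1 q ubar)) p ->
  C1_extension omega1 (C0_rep Omega p) P ->
  kappa < alpha * beta rho ->
  (forall xi zeta, omega1 xi -> omega1 zeta ->
     - kappa * enorm (xi - zeta) ^+ 2 <=
     dot (gradient P xi - gradient P zeta) (xi - zeta)) ->
  (* u0 being concentrated on omega0, the values of T elsewhere are irrelevant *)
  exists T : 'rV[R]_d -> 'rV[R]_d,
  [/\ measurable_fun [set: 'rV[R]_d] T /\
        (forall x, omega0 x -> omega1 (T x)),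
      exists pi, [/\ optimal_plan omega0 omega1 c u0 ubar pi,
        (forall pi', optimal_plan omega0 omega1 c u0 ubar pi' ->
           forall A, measurable A -> pi' A = pi A)
        & forall A, measurable A -> pi A = pushforward u0 (fun x => (x, T x)) A],
      forall A, measurable A -> pushforward u0 T A = ubar A,
      exists C : R, forall x y, omega0 x -> omega0 y ->
        enorm (T x - T y) <= C * enorm (x - y) `^ 2^-1
    & forall H : 'rV[R]_d -> R,
        C1_extension (set_diff omega1 omega0) h H ->
        (exists L : R, forall s t, set_diff omega1 omega0 s ->
           set_diff omega1 omega0 t ->
           enorm (gradient H s - gradient H t) <= L * enorm (s - t)) ->
        exists L : R, forall x y, omega0 x -> omega0 y ->
          enorm (T x - T y) <= L * enorm (x - y)].
Proof.
move=> q' d23 [oO _ _ bO _] _ c0 o1 c1 _ cu0 _ al0 dp PS q1 dq' q'p _ cJ gJ co cE ch mono rho0 sub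
  opt hp [U [_ sU dP PE]] kap monoP.
have d2 : (2 <= d)%N by case: d23 => ->.
have [a [r [[qE q'E a1 dr] [r1 ar pq qp]]]] := conjugate_exponents d2 dp q1 dq' q'p.
have {}PS := PS _ pq qp.
rewrite /q' q'E in hp; subst q; rename q'E into aE.
have m0 := compact_measurable_rV c0; have m1 := compact_measurable_rV c1.
have Wp : W10 Omega r%:E p by case: hp.
have [cw _ _ _] := C0_repP r1 dr oO bO Wp.
set w := C0_rep Omega p in cw PE.
have wM x : omega1 x -> `|w x| <= _ := fun _ => C0_rep_bounded r1 dr oO bO Wp x.
have sub' x xi : omega0 x -> omega1 xi -> enorm (xi - x) < rho.
  by move=> x0 x1; apply: sub; exists xi => //; exists x.
(* The constant of the midpoint inequality with be = beta rho; it is positive exactly because kappa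
   < alpha beta. *)
pose ga := (alpha * beta rho - kappa) / 4.
have ga0 : 0 < ga by rewrite divr_gt0// subr_gt0.
have mid x a' b : omega0 x -> omega1 a' -> omega1 b ->
    2 * (w (a' + 2^-1 *: (b - a')) + alpha * h (a' + 2^-1 *: (b - a') - x)) +
      ga * enorm (b - a') ^+ 2 <= (w a' + alpha * h (a' - x)) + (w b + alpha * h (b - x)).
  move=> x0 a'1 b1; rewrite !PE//; last by apply: convex_set_segment => //; lra.
  apply: (midpoint_strong_convexity ch al0 (mono _ rho0).2 _ co monoP) => //.
    by move=> y /sU/dP[].
  by move=> y y1; exact: sub'.
have [T [T1 Tout growth]] := argmin_map_exists ch co c1 o1 cw mid.
have mT := argmin_map_measurable al0 ga0 ch sub' T1 growth c0 Tout.
have hcont := convex_function_continuous ch.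
have [L L0 hL] := convex_lipschitz_bounded ch rho.
have cM z : (omega0 `*` omega1) z -> `|c z| <= `|h 0| + L * rho.
  case: z => x xi [/= x0 x1]; rewrite cE//.
  have n1 : `|xi - x| <= rho by rewrite (le_trans (mxnorm_le_enorm _))// ltW// sub'.
  have := hL _ 0 n1; rewrite normr0 subr0 => /(_ (ltW rho0)) h1.
  rewrite -[h (xi - x)](subrK (h 0)) (le_trans (ler_normD _ _))// addrC lerD2l.
  by rewrite (le_trans h1)// ler_wpM2l.
have mc := cost_measurable hcont cE.
have mX : measurable (omega0 `*` omega1) by exact: measurableX.
have [D [DD Dlb Dinf]] := Dc_real mX mc cM (locally_optimal_Dc al0 opt).
(* Any plan exhibits [ubar] as a marginal, hence as a finite nonnegative measure; the accuracy 1 is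
   arbitrary. *)
have [pi0 [_ _ p01] _] := Dinf 1 ltr01.
pose mb := push_finite_measure pi0 measurable_snd.
have ub A : measurable A -> ubar A = mb A by move=> mA; rewrite push_finite_measureE p01.
have cmt : concentrated omega1 (push_finite_measure u0 mT).
  move=> A mA A1; rewrite push_finite_measureE /pushforward.
  rewrite (_ : T @^-1` A = set0) ?measure0//; apply/seteqP; split=> // x Ax.
  by have : (A `&` omega1) (T x) by []; rewrite A1.
have fo := first_order_condition a1 r1 dr ar aE oO bO m0 m1 mc cM al0 PS cJ gJ opt hp ub cmt
  (graph_plan cu0 mT T1) DD.
exists T; split.
- by split.
- exists (push_finite_measure u0 (graph_measurable mT)); split=> //.
  + exact: (graph_optimal m0 m1 cu0 cw hcont wM cM cE al0 ga0 T1 growth ub DD Dinf fo).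
  + exact: (optimal_plan_unique m0 m1 cu0 cw hcont wM cM cE al0 ga0 T1 growth ub DD fo).
- move=> A mA; rewrite -push_finite_measureE.
  by rewrite -(target_marginal m0 m1 cu0 cw hcont wM cM cE al0 ga0 T1 growth ub Dinf fo).
- exact: (argmin_map_hoelder al0 ga0 ch sub' T1 growth).
- move=> H C1H LH; exact: (argmin_map_lipschitz al0 ga0 co T1 growth C1H LH).
Qed.
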